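(* Let $c\colon E^1\to G$ be a labeling of a row-finite directed graph $E=(E^0,E^1,r,s)$ by a discrete group $G$, and let $\delta$ be the coaction of $G$ on $C^*(E)$ determined by $\delta(s_f)=s_f\otimes c(f)$ and $\delta(p_v)=p_v\otimes 1$ for $f\in E^1$, $v\in E^0$. Then $$C^*(E)\times_\delta G\cong C^*(E\times_c G),$$ equivariantly for the dual action $\widehat\delta$ of $G$ on $C^*(E)\times_\delta G$ and the action $\gamma$ of $G$ on $C^*(E\times_c G)$ given by $\gamma_t(s_{(f,s)})=s_{(f,st^{-1})}$ and $\gamma_t(p_{(v,s)})=p_{(v,st^{-1})}$ for $s,t\in G$, $f\in E^1$, $v\in E^0$.
   Context: A directed graph $E=(E^0,E^1,r,s)$ consists of a set $E^0$ of vertices, a set $E^1$ of edges, and range and source maps $r,s\colon E^1\to E^0$. It is row-finite if $s^{-1}(v)$ is finite for every $v\in E^0$; sources and sinks are allowed (a sink is a vertex emitting no edges). A Cuntz-Krieger $E$-family in a $C^*$-algebra $B$ is a collection $\{t_f,q_v\mid f\in E^1,v\in E^0\}$ of partial isometries $t_f$ and mutually orthogonal projections $q_v$ in $B$ such that $t_f^*t_f=q_{r(f)}$ for each $f\in E^1$ and $q_v=\sum_{s(f)=v}t_ft_f^*$ for every $v\in E^0$ which is not a sink. $C^*(E)$ is the universal $C^*$-algebra generated by a Cuntz-Krieger $E$-family, and its canonical generators are denoted $\{s_f,p_v\}$. A labeling of $E$ by a group $G$ is a function $c\colon E^1\to G$. The skew-product graph $E\times_c G$ has vertex set $E^0\times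 G$, edge set $E^1\times G$, and range and source maps $r(f,t)=(r(f),t)$, $s(f,t)=(s(f),c(f)t)$. It is row-finite when $E$ is. $G$ acts on it by $t\cdot(v,s)=(v,st^{-1})$, $t\cdot(f,s)=(f,st^{-1})$, and $\gamma$ is the induced action on $C^*(E\times_cG)$. For a discrete group $G$, $C^*(G)$ is the full group $C^*$-algebra, with elements of $G$ identified with their canonical unitaries. A coaction of $G$ on a $C^*$-algebra $A$ is an injective nondegenerate homomorphism $\delta\colon A\to A\otimes C^*(G)$ (spatial tensor product) with $(\delta\otimes\mathrm{id})\circ\delta=(\mathrm{id}\otimes\delta_G)\circ\delta$, where $\delta_G(t)=t\otimes t$ for $t\in G$. (A coaction $\delta$ of $G$ on $C^*(E)$ with the stated values on generators exists, and is clearly unique.) A covariant representation of $(A,G,\delta)$ is a pair $(\pi,\mu)$ of nondegenerate homomorphisms of $A$ and $C_0(G)$ into a multiplier algebra $M(B)$ with $(\pi\otimes\mathrm{id})(\delta(a))=(\mu\otimes\mathrm{id})(w_G)(\pi(a)\otimes1)(\mu\otimes\mathrm{id})(w_G)^*$ for $a\in A$, where $w_G\in M(C_0(G)\otimes C^*(G))$ is the function $s\mapsto s$. The crossed product $A\times_\delta G$ is the universal $C^*$-algebra generated by a covariant representation $(j_A,j_G)$ of $(A,G,\delta)$; it is densely spanned by the products $j_A(a)j_G(g)$. The dual action $\widehat\delta$ of $G$ on $A\times_\delta G$ is given by $\widehat\delta_s(j_A(a)j_G(\chi_{\{u\}}))=j_A(a)j_G(\chi_{\{us^{-1}\}})$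 for $s,u\in G$, $a\in A$, where $\chi_K$ denotes the characteristic function of $K$. ''Equivariantly'' means that there is an isomorphism intertwining the two actions of $G$. *)

(* Defs.v *)
From HB Require Import structures.
From mathcomp Require Import all_boot all_order all_algebra.
From mathcomp Require Import all_classical all_reals all_analysis.
From mathcomp Require Import complex ring lra.

Set Implicit Arguments.
Unset Strict Implicit.
Unset Printing Implicit Defensive.

Import Order.TTheory GRing.Theory Num.Theory.
Import numFieldNormedType.Exports.

Local Open Scope classical_set_scope.
Local Open Scope ring_scope.

HB.mixin Record Lmodule_isStarAlg (R : realType) A of GRing.Lmodule R[i] A := {
  amul : A -> A -> A;
  star : A -> A;
  amulA : associative amul;
  amul_linearl : forall (b : A) (k : R[i]) (x y : A),
    amul (k *: x + y) b = k *: amul x b + amul y b;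
  amul_linearr : forall (a : A) (k : R[i]) (x y : A),
    amul a (k *: x + y) = k *: amul a x + amul a y;
  star_semilinear : forall (k : R[i]) (x y : A),
    star (k *: x + y) = k^* *: star x + star y;
  starK : involutive star;
  starM : forall x y : A, star (amul x y) = amul (star y) (star x)
}.

#[short(type="starAlgType")]
HB.structure Definition StarAlg (R : realType) :=
  {A of Lmodule_isStarAlg R A & GRing.Lmodule R[i] A}.

Notation "x ** y" := (amul x y) (at level 40, left associativity) : ring_scope.

(* No unit is required; norms take values in the nonnegative reals of R[i]. *)
HB.mixin Record NormedStarAlg_isCStarAlg (R : realType) A
    of StarAlg R A & CompleteNormedModule R[i] A := {
  amul_norm_le : forall x y : A, `|x ** y| <= `|x| * `|y|;
  cstar_identity : forall x : A, `|star x ** x| = `|x| ^+ 2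
}.

#[short(type="cstarAlgType")]
HB.structure Definition CStarAlg (R : realType) :=
  {A of NormedStarAlg_isCStarAlg R A & StarAlg R A
      & CompleteNormedModule R[i] A}.

HB.mixin Record NormedModule_isHilbert (R : realType) H
    of CompleteNormedModule R[i] H := {
  inner : H -> H -> R[i];
  inner_linearl : forall (z : H) (k : R[i]) (x y : H),
    inner (k *: x + y) z = k * inner x z + inner y z;
  inner_conj : forall x y : H, inner y x = (inner x y)^*;
  inner_norm : forall x : H, inner x x = `|x| ^+ 2
}.

#[short(type="hilbertType")]
HB.structure Definition Hilbert (R : realType) :=
  {H of NormedModule_isHilbert R H & CompleteNormedModule R[i] H}.

Section StarAlgebras.
Context {R : realType}.

Definition star_hom (A B : starAlgType R) (f : A -> B) : Prop :=
  [/\ linear f, {morph f : x y / x ** y} & {morph f : x / star x}].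

Definition lin_span (V : lmodType R[i]) (S : set V) : set V :=
  [set v | exists n (k : 'I_n -> R[i]) (x : 'I_n -> V),
     (forall i, S (x i)) /\ v = \sum_(i < n) k i *: x i].

Definition generates (A : cstarAlgType R) (S : set A) : Prop :=
  forall X : set A, closed X -> X 0 ->
    (forall (k : R[i]) x y, X x -> X y -> X (k *: x + y)) ->
    (forall x y, X x -> X y -> X (x ** y)) ->
    (forall x, X x -> X (star x)) ->
    S `<=` X -> X = setT.

Definition is_unit (A : starAlgType R) (e : A) : Prop :=
  forall x : A, e ** x = x /\ x ** e = x.

Definition projection (A : starAlgType R) (q : A) : Prop :=
  q ** q = q /\ star q = q.

Definition partial_isometry (A : starAlgType R) (t : A) : Prop :=
  t ** star t ** t = t.

Definition bounded_op (V W : normedModType R[i]) (f : V -> W) : Prop :=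
  exists2 M : R[i], 0 <= M & forall x, `|f x| <= M * `|x|.

Definition star_action (G : groupType) (A : starAlgType R)
    (alpha : G -> A -> A) : Prop :=
  [/\ forall t, star_hom (alpha t),
      forall a, alpha 1%g a = a &
      forall s t a, alpha (s * t)%g a = alpha s (alpha t a)].

End StarAlgebras.

Section CStarTheory.
Context {R : realType}.
Implicit Types A : cstarAlgType R.

Lemma star_norm A (x : A) : `|star x| = `|x|.
Proof.
have le_star (y : A) : `|y| <= `|star y|.
  have [->|y0] := eqVneq y 0; first by rewrite normr0.
  have y_gt0 : 0 < `|y| by rewrite normr_gt0.
  by rewrite -(ler_pM2r y_gt0) -expr2 -cstar_identity amul_norm_le.
by apply/eqP; rewrite eq_le le_star -{2}(starK x) le_star.
Qed.

End CStarTheory.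

(* M(A) is the algebra of double centralizers (L, R) of A, with product
   (L, R)(L', R') = (L L', R' R). *)
Section Multiplier.
Context {R : realType} (A : cstarAlgType R).

Definition double_centralizer : {pred (A -> A) * (A -> A)} := fun m =>
  `[< [/\ linear m.1 /\ linear m.2,
          bounded_op m.1 /\ bounded_op m.2,
          forall a b, m.1 (a ** b) = m.1 a ** b,
          forall a b, m.2 (a ** b) = a ** m.2 b &
          forall a b, m.2 a ** b = a ** m.1 b] >].

Record multiplier := Multiplier {
  mult_val : (A -> A) * (A -> A);
  _ : mult_val \in double_centralizer
}.

HB.instance Definition _ := [isSub for mult_val].
HB.instance Definition _ := [Choice of multiplier by <:].

Definition lact (m : multiplier) : A -> A := (val m).1.
Definition ract (m : multiplier) : A -> A := (val m).2.

Lemma amulDl (a b c : A) : (a + b) ** c = a ** c + b ** c.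
Proof. by have := amul_linearl c 1 a b; rewrite !scale1r. Qed.

Lemma amulDr (a b c : A) : a ** (b + c) = a ** b + a ** c.
Proof. by have := amul_linearr a 1 b c; rewrite !scale1r. Qed.

Lemma amul0 (a : A) : a ** 0 = 0.
Proof. by apply: (addrI (a ** 0)); rewrite -amulDr !addr0. Qed.

Lemma mul0a (a : A) : 0 ** a = 0.
Proof. by apply: (addrI (0 ** a)); rewrite -amulDl !addr0. Qed.

Lemma amulZl (k : R[i]) (a b : A) : (k *: a) ** b = k *: (a ** b).
Proof. by have := amul_linearl b k a 0; rewrite !addr0 mul0a addr0. Qed.

Lemma amulZr (k : R[i]) (a b : A) : a ** (k *: b) = k *: (a ** b).
Proof. by have := amul_linearr a k b 0; rewrite !addr0 amul0 addr0. Qed.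

Lemma multP (m : multiplier) :
  [/\ linear (lact m) /\ linear (ract m),
      bounded_op (lact m) /\ bounded_op (ract m),
      forall a b, lact m (a ** b) = lact m a ** b,
      forall a b, ract m (a ** b) = a ** ract m b &
      forall a b, ract m a ** b = a ** lact m b].
Proof. by have /asboolP := valP m. Qed.

Lemma linear0 (f : A -> A) : linear f -> f 0 = 0.
Proof.
by move=> lf; have := lf (-1) 0 0; rewrite !scaler0 addr0 scaleN1r addNr.
Qed.

Lemma linearDZ (f : A -> A) : linear f ->
  (forall x y, f (x + y) = f x + f y) /\ (forall k x, f (k *: x) = k *: f x).
Proof.
move=> lf; split=> [x y|k x].
  by have := lf 1 x y; rewrite !scale1r.
by have := lf k x 0; rewrite (linear0 lf) !addr0.
Qed.

Lemma bounded_op_comb (k : R[i]) (f g : A -> A) :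
  bounded_op f -> bounded_op g -> bounded_op (k *: f + g).
Proof.
move=> [M M0 fM] [N N0 gN]; exists (`|k| * M + N).
  by rewrite addr_ge0// mulr_ge0.
move=> x; rewrite (le_trans (ler_normD _ _))// mulrDl lerD//.
by rewrite normrZ -mulrA ler_wpM2l.
Qed.

Lemma bounded_op_comp (f g : A -> A) :
  bounded_op f -> bounded_op g -> bounded_op (f \o g).
Proof.
move=> [M M0 fM] [N N0 gN]; exists (M * N); first by rewrite mulr_ge0.
by move=> x; rewrite (le_trans (fM _))// -mulrA ler_wpM2l.
Qed.

Lemma double_centralizer_submod : submod_closed double_centralizer.
Proof.
split.
  rewrite unfold_in; apply/asboolP; split => /=.
  - by split=> k x y /=; rewrite scaler0 addr0.
  - by split; exists 0 => // x; rewrite mul0r normr0.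
  - by move=> a b; rewrite mul0a.
  - by move=> a b; rewrite amul0.
  - by move=> a b; rewrite mul0a amul0.
move=> k m n; rewrite !unfold_in => /asboolP[[ml mr] [bml bmr] m1 m2 m3].
move=> /asboolP[[nl nr] [bnl bnr] n1 n2 n3]; apply/asboolP.
have comb (f g : A -> A) (x : A) : (k *: f + g) x = k *: f x + g x by [].
have lin (f g : A -> A) : linear f -> linear g -> linear (k *: f + g).
  move=> lf lg l x y; rewrite !comb lf lg !scalerDr !scalerA mulrC.
  by rewrite -!addrA; congr (_ + _); rewrite addrCA.
split => /=.
- by split; apply: lin.
- by split; apply: bounded_op_comb.
- by move=> a b; rewrite !comb m1 n1 amulDl amulZl.
- by move=> a b; rewrite !comb m2 n2 amulDr amulZr.
- by move=> a b; rewrite !comb amulDl amulDr amulZl amulZr m3 n3.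
Qed.

HB.instance Definition _ :=
  GRing.isSubmodClosed.Build R[i] _ double_centralizer
    double_centralizer_submod.
HB.instance Definition _ := [SubChoice_isSubLmodule of multiplier by <:].

Lemma mult_mul_subproof (m n : multiplier) :
  (lact m \o lact n, ract n \o ract m) \in double_centralizer.
Proof.
have [[ml mr] [bml bmr] m1 m2 m3] := multP m.
have [[nl nr] [bnl bnr] n1 n2 n3] := multP n.
rewrite unfold_in; apply/asboolP; split => /=.
- by split=> k x y /=; rewrite ?nl ?ml ?mr ?nr.
- by split; apply: bounded_op_comp.
- by move=> a b; rewrite n1 m1.
- by move=> a b; rewrite m2 n2.
- by move=> a b; rewrite n3 m3.
Qed.

Definition mult_mul (m n : multiplier) : multiplier :=
  Multiplier (mult_mul_subproof m n).

Lemma star_additive (x y : A) : star (x + y) = star x + star y.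
Proof.
by have := star_semilinear 1 x y; rewrite rmorph1 !scale1r.
Qed.

Lemma mult_star_subproof (m : multiplier) :
  (fun a => star (ract m (star a)), fun a => star (lact m (star a)))
    \in double_centralizer.
Proof.
have [[ml mr] [bml bmr] m1 m2 m3] := multP m.
rewrite unfold_in; apply/asboolP; split => /=.
- by split=> k x y /=; rewrite star_semilinear ?ml ?mr star_semilinear conjCK.
- have bstar f : bounded_op f -> bounded_op (fun a : A => star (f (star a)) : A).
    by case=> M M0 fM; exists M => // x; rewrite star_norm -(star_norm x).
  by split; apply: bstar.
- by move=> a b; rewrite starM m2 starM starK.
- by move=> a b; rewrite starM m1 starM starK.
- by move=> a b; rewrite -[b in LHS]starK -starM -m3 starM starK.
Qed.

Definition mult_star (m : multiplier) : multiplier :=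
  Multiplier (mult_star_subproof m).

Lemma mult_eq (m n : multiplier) :
  lact m =1 lact n -> ract m =1 ract n -> m = n.
Proof.
move=> el er; apply: val_inj; rewrite /lact /ract in el er.
by rewrite (surjective_pairing (val m)) (surjective_pairing (val n));
  congr pair; apply/funext.
Qed.

Lemma lact_comb (k : R[i]) (m n : multiplier) (a : A) :
  lact (k *: m + n) a = k *: lact m a + lact n a.
Proof. by []. Qed.

Lemma ract_comb (k : R[i]) (m n : multiplier) (a : A) :
  ract (k *: m + n) a = k *: ract m a + ract n a.
Proof. by []. Qed.

Lemma lact_mul (m n : multiplier) (a : A) :
  lact (mult_mul m n) a = lact m (lact n a).
Proof. by []. Qed.

Lemma ract_mul (m n : multiplier) (a : A) :
  ract (mult_mul m n) a = ract n (ract m a).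
Proof. by []. Qed.

Lemma lact_star (m : multiplier) (a : A) :
  lact (mult_star m) a = star (ract m (star a)).
Proof. by []. Qed.

Lemma ract_star (m : multiplier) (a : A) :
  ract (mult_star m) a = star (lact m (star a)).
Proof. by []. Qed.

Lemma mult_mulA : associative mult_mul.
Proof.
by move=> m n p; apply: mult_eq => a; rewrite ?lact_mul ?ract_mul.
Qed.

Lemma mult_linearl (n : multiplier) (k : R[i]) (x y : multiplier) :
  mult_mul (k *: x + y) n = k *: mult_mul x n + mult_mul y n.
Proof.
have [[nl nr] _ _ _ _] := multP n.
apply: mult_eq => a.
  by rewrite lact_mul !lact_comb !lact_mul.
by rewrite ract_mul !ract_comb !ract_mul nr.
Qed.

Lemma mult_linearr (n : multiplier) (k : R[i]) (x y : multiplier) :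
  mult_mul n (k *: x + y) = k *: mult_mul n x + mult_mul n y.
Proof.
have [[nl nr] _ _ _ _] := multP n.
apply: mult_eq => a.
  by rewrite lact_mul !lact_comb !lact_mul nl.
by rewrite ract_mul !ract_comb !ract_mul.
Qed.

Lemma mult_star_semilinear (k : R[i]) (x y : multiplier) :
  mult_star (k *: x + y) = k^* *: mult_star x + mult_star y.
Proof.
apply: mult_eq => a.
  by rewrite lact_star ract_comb star_semilinear lact_comb !lact_star.
by rewrite ract_star lact_comb star_semilinear ract_comb !ract_star.
Qed.

Lemma mult_starK : involutive mult_star.
Proof.
by move=> m; apply: mult_eq => a;
  rewrite ?(lact_star, ract_star) ?(lact_star, ract_star) !starK.
Qed.

Lemma mult_starM (m n : multiplier) :
  mult_star (mult_mul m n) = mult_mul (mult_star n) (mult_star m).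
Proof.
apply: mult_eq => a.
  by rewrite lact_star ract_mul lact_mul !lact_star starK.
by rewrite ract_star lact_mul ract_mul !ract_star starK.
Qed.

HB.instance Definition _ := Lmodule_isStarAlg.Build R multiplier
  mult_mulA mult_linearl mult_linearr mult_star_semilinear mult_starK
  mult_starM.

Lemma mult_one_subproof :
  ((fun a : A => a), (fun a : A => a)) \in double_centralizer.
Proof.
by rewrite unfold_in; apply/asboolP; split=> //=; split; exists 1 => // x;
  rewrite mul1r.
Qed.

Definition mult_one : multiplier := Multiplier mult_one_subproof.

Lemma to_mult_subproof (a : A) :
  (amul a, fun b => b ** a) \in double_centralizer.
Proof.
rewrite unfold_in; apply/asboolP; split => /=.
- split=> k x y; [exact: amul_linearr|exact: amul_linearl].
- split; exists `|a| => // x; rewrite ?amul_norm_le//.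
  by rewrite mulrC amul_norm_le.
- by move=> b c; rewrite amulA.
- by move=> b c; rewrite amulA.
- by move=> b c; rewrite amulA.
Qed.

Definition to_mult (a : A) : multiplier := Multiplier (to_mult_subproof a).

End Multiplier.

Arguments mult_one {R A}.
Arguments to_mult {R A} a.

(* The functions vanishing at infinity on the discrete space T. *)
Section C0.
Context {R : realType} (T : choiceType).

Local Notation normc := (@Normc.normc R).

Definition vanishing : {pred T -> R[i]} := fun f =>
  `[< forall e : R[i], 0 < e -> finite_set [set t | e <= `|f t|] >].

Record C0 := MkC0 { C0_val :> T -> R[i]; _ : C0_val \in vanishing }.

HB.instance Definition _ := [isSub for C0_val].
HB.instance Definition _ := [Choice of C0 by <:].

Lemma normcE (z : R[i]) : `|z| = (normc z)%:C%C.
Proof. by []. Qed.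

Lemma normc_ge0 (z : R[i]) : 0 <= normc z.
Proof. by case: z => a b; exact: sqrtr_ge0. Qed.

Lemma normcD (x y : R[i]) : normc (x + y) <= normc x + normc y.
Proof. by rewrite -lecR rmorphD /= -!normcE ler_normD. Qed.

Lemma vanishingP (f : T -> R[i]) : reflect
  (forall e : R[i], 0 < e -> finite_set [set t | e <= `|f t|])
  (f \in vanishing).
Proof. by rewrite unfold_in; exact: asboolP. Qed.

Lemma C0P (f : C0) (e : R[i]) : 0 < e -> finite_set [set t | e <= `|f t|].
Proof. by move: e; apply/vanishingP; exact: valP. Qed.

Lemma vanishing_bounded (f : T -> R[i]) : f \in vanishing ->
  exists2 M : R, 0 <= M & forall t, normc (f t) <= M.
Proof.
move=> /vanishingP /(_ 1 ltr01) /finite_seqP[s sE].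
exists (1 + \sum_(t <- s) normc (f t)).
  by rewrite addr_ge0// sumr_ge0// => t _; exact: normc_ge0.
move=> t; have [ts|tNs] := boolP (t \in s).
  rewrite (big_rem t ts)/= addrCA lerDl addr_ge0//.
  by rewrite sumr_ge0// => u _; exact: normc_ge0.
have : ~ [set t | 1 <= `|f t|] t by rewrite sE /=; apply/negP.
move=> /= /negP; rewrite -real_ltNge ?normr_real// => /ltW.
rewrite -[`|_|]/((normc (f t))%:C)%C -[1]/((1%:C)%C) lecR => /le_trans; apply.
by rewrite lerDl sumr_ge0// => u _; exact: normc_ge0.
Qed.

Lemma vanishing_submod : submod_closed vanishing.
Proof.
split.
  apply/vanishingP => e e0; rewrite (_ : [set _ | _] = set0)//.
  by apply/seteqP; split => // t /=; rewrite normr0 => /(lt_le_trans e0); rewrite ltxx.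
move=> k f g /vanishingP fv /vanishingP gv; apply/vanishingP => e e0.
have e2 : 0 < e / 2 by rewrite divr_gt0.
have k1 : 0 < `|k| + 1 by rewrite ltr_wpDl.
apply: (@sub_finite_set _ _
  ([set t | e / 2 / (`|k| + 1) <= `|f t|] `|` [set t | e / 2 <= `|g t|])).
  move=> t /= et; rewrite /setU /=; apply: contrapT => /not_orP[].
  move=> /negP + /negP; rewrite -!real_ltNge ?ger0_real ?divr_ge0// ?ltW//.
  rewrite ltr_pdivlMr// => ft gt.
  have : `|(k *: f + g) t| < e; last first.
    by move=> /(le_lt_trans et); rewrite ltxx.
  rewrite [e in _ < e]splitr (le_lt_trans (ler_normD _ _))// ler_ltD//.
  rewrite [X in `|X|]/(k * f t) normrM (le_trans _ (ltW ft))// mulrC.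
  by rewrite ler_wpM2l// lerDl.
by rewrite finite_setU; split; [apply: fv; rewrite divr_gt0|exact: gv].
Qed.

HB.instance Definition _ :=
  GRing.isSubmodClosed.Build R[i] _ vanishing vanishing_submod.
HB.instance Definition _ := [SubChoice_isSubLmodule of C0 by <:].

Lemma C0_eq (f g : C0) : f =1 g -> f = g.
Proof. by move=> fg; apply: val_inj; apply/funext. Qed.

Definition C0_sup (f : C0) : R := sup [set normc (f t) | t in [set: T]].

Lemma C0_bounded (f : C0) : has_ubound [set normc (f t) | t in [set: T]].
Proof.
have [M _ fM] := vanishing_bounded (valP f).
by exists M => _ [t _ <-].
Qed.

Lemma C0_sup_ge (f : C0) t : normc (f t) <= C0_sup f.
Proof. by apply: ub_le_sup; [exact: C0_bounded|exists t]. Qed.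

Lemma C0_sup_ge0 (f : C0) : 0 <= C0_sup f.
Proof.
have [[x [t _ tx]]|S0] := pselect ([set normc (f t) | t in [set: T]] !=set0).
  by rewrite (le_trans _ (C0_sup_ge f t))// normc_ge0.
rewrite /C0_sup; move/set0P/negP/negPn/eqP : S0 => ->.
by rewrite sup0.
Qed.

Lemma C0_sup_le (f : C0) (M : R) :
  0 <= M -> (forall t, normc (f t) <= M) -> C0_sup f <= M.
Proof.
move=> M0 fM.
have [S0|/set0P/negP/negPn/eqP S0] :=
  pselect ([set normc (f t) | t in [set: T]] !=set0).
  by apply: ge_sup => // _ [t _ <-].
by rewrite /C0_sup S0 sup0.
Qed.

Lemma C0_norm_triangle (f g : C0) :
  (C0_sup (f + g))%:C%C <= (C0_sup f)%:C%C + (C0_sup g)%:C%C.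
Proof.
rewrite -rmorphD /= lecR C0_sup_le ?addr_ge0 ?C0_sup_ge0// => t.
by rewrite (le_trans (normcD _ _))// lerD ?C0_sup_ge.
Qed.

Lemma C0_normZ (k : R[i]) (f : C0) :
  (C0_sup (k *: f))%:C%C = `|k| * (C0_sup f)%:C%C.
Proof.
have le (l : R[i]) (g : C0) : C0_sup (l *: g) <= normc l * C0_sup g.
  rewrite C0_sup_le ?mulr_ge0 ?normc_ge0 ?C0_sup_ge0// => t.
  rewrite [X in normc X](_ : _ = l * g t)// Normc.normcM ler_wpM2l ?normc_ge0//.
  exact: C0_sup_ge.
rewrite -[`|k|]/((normc k)%:C)%C -rmorphM; congr (_%:C%C).
apply/eqP; rewrite eq_le le /=.
have [->|k0] := eqVneq k 0; first by rewrite Normc.normc0 mul0r C0_sup_ge0.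
have nk0 : 0 < normc k.
  rewrite lt_neqAle normc_ge0 andbT eq_sym; apply: contra k0 => /eqP.
  by move=> /Normc.eq0_normc ->.
rewrite mulrC -ler_pdivlMr// -Normc.normcV mulrC.
by rewrite (le_trans _ (le _ _))// scalerA mulVf// scale1r.
Qed.

Lemma C0_norm_eq0 (f : C0) : (C0_sup f)%:C%C = 0 :> R[i] -> f = 0.
Proof.
move=> [f0]; apply: C0_eq => t; apply: Normc.eq0_normc.
by apply/eqP; rewrite eq_le normc_ge0 andbT -f0 C0_sup_ge.
Qed.

HB.instance Definition _ := Lmodule_isNormed.Build R[i] C0
  C0_norm_triangle C0_normZ C0_norm_eq0.

Lemma C0_normE (f : C0) : `|f| = (C0_sup f)%:C%C.
Proof. by []. Qed.

Lemma C0_mul_subproof (f g : C0) : (fun t => f t * g t) \in vanishing.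
Proof.
have [M M0 gM] := vanishing_bounded (valP g).
apply/vanishingP => e e0.
have M1 : 0 < (M + 1)%:C%C by rewrite ltcR ltr_wpDl.
apply: (@sub_finite_set _ _ [set t | e / (M + 1)%:C%C <= `|f t|]); last first.
  by apply: C0P; rewrite divr_gt0.
move=> t /=; rewrite normrM ler_pdivrMr// => /le_trans; apply.
by rewrite ler_wpM2l// lecR (le_trans (gM _))// lerDl.
Qed.

Definition C0_mul (f g : C0) : C0 := MkC0 (C0_mul_subproof f g).

Lemma C0_star_subproof (f : C0) : (fun t => (f t)^*) \in vanishing.
Proof.
by apply/vanishingP => e e0; under eq_set do rewrite norm_conjC; exact: C0P.
Qed.

Definition C0_star (f : C0) : C0 := MkC0 (C0_star_subproof f).

Lemma C0_combE (k : R[i]) (f g : C0) t : (k *: f + g) t = k * f t + g t.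
Proof. by []. Qed.

Lemma C0_mulE (f g : C0) t : C0_mul f g t = f t * g t.
Proof. by []. Qed.

Lemma C0_starE (f : C0) t : C0_star f t = (f t)^*.
Proof. by []. Qed.

Lemma C0_mulA : associative C0_mul.
Proof. by move=> f g h; apply: C0_eq => t; exact: mulrA. Qed.

Lemma C0_mul_linearl (h : C0) (k : R[i]) (f g : C0) :
  C0_mul (k *: f + g) h = k *: C0_mul f h + C0_mul g h.
Proof.
by apply: C0_eq => t; rewrite !(C0_combE, C0_mulE) mulrDl mulrA.
Qed.

Lemma C0_mul_linearr (h : C0) (k : R[i]) (f g : C0) :
  C0_mul h (k *: f + g) = k *: C0_mul h f + C0_mul h g.
Proof.
by apply: C0_eq => t; rewrite !(C0_combE, C0_mulE) mulrDr mulrCA.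
Qed.

Lemma C0_star_semilinear (k : R[i]) (f g : C0) :
  C0_star (k *: f + g) = k^* *: C0_star f + C0_star g.
Proof.
by apply: C0_eq => t; rewrite !(C0_combE, C0_starE) rmorphD rmorphM.
Qed.

Lemma C0_starK : involutive C0_star.
Proof. by move=> f; apply: C0_eq => t; exact: conjCK. Qed.

Lemma C0_starM (f g : C0) : C0_star (C0_mul f g) = C0_mul (C0_star g) (C0_star f).
Proof.
have conjM (a b : R[i]) : (a * b)^* = b^* * a^* by rewrite rmorphM mulrC.
by apply: C0_eq => t; exact: conjM.
Qed.

HB.instance Definition _ := Lmodule_isStarAlg.Build R C0
  C0_mulA C0_mul_linearl C0_mul_linearr C0_star_semilinear C0_starK C0_starM.

Lemma C0_mul_norm (f g : C0) : `|f ** g| <= `|f| * `|g|.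
Proof.
rewrite !C0_normE -rmorphM lecR C0_sup_le ?mulr_ge0 ?C0_sup_ge0// => t.
by rewrite [leLHS]Normc.normcM ler_pM ?normc_ge0 ?C0_sup_ge.
Qed.

Lemma C0_cstar (f : C0) : `|star f ** f| = `|f| ^+ 2.
Proof.
have sqE t : normc ((star f ** f) t) = normc (f t) ^+ 2.
  apply: (@complexI R); rewrite -normcE [X in `|X|]/((f t)^* * f t).
  by rewrite normrM norm_conjC normcE -rmorphM.
rewrite !C0_normE -rmorphXn; congr (_%:C%C); apply/eqP; rewrite eq_le.
apply/andP; split.
  rewrite C0_sup_le ?sqr_ge0// => t; rewrite sqE lerXn2r ?nnegrE//.
  - exact: normc_ge0.
  - exact: C0_sup_ge0.
  - exact: C0_sup_ge.
rewrite -[leRHS]sqr_sqrtr ?C0_sup_ge0// lerXn2r ?nnegrE ?C0_sup_ge0 ?sqrtr_ge0//.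
rewrite C0_sup_le ?sqrtr_ge0// => t.
rewrite -(ger0_norm (normc_ge0 _)) -sqrtr_sqr ler_wsqrtr// -sqE.
exact: C0_sup_ge.
Qed.

Lemma C0_cauchy_lim (F : set_system C0) (a : C0 -> R) : ProperFilter F ->
  cauchy F -> (forall f g, `|a f - a g|%:C%C <= `|f - g|) ->
  exists l : R, forall (e : R) (A : set C0), F A ->
    (forall f g, A f -> A g -> `|f - g| < e%:C%C) ->
    forall f, A f -> `|a f - l| <= e.
Proof.
move=> FF Fc alip.
have acvg : cvg (a @ F).
  apply: cauchy_cvg; apply/cauchy_ballP => e e0.
  have /cauchy_ballP /(_ e%:C%C) := Fc; rewrite ltcR => /(_ e0).
  move=> [[P Q] [/= FP FQ] PQ]; exists (a @` P, a @` Q) => /=.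
    by split; [apply: filterS FP => f Pf|apply: filterS FQ => f Qf]; exists f.
  move=> [_ _] /= [[f Pf <-] [g Qg <-]].
  by rewrite /ball /= -ltcR (le_lt_trans (alip _ _))//; exact: (PQ (f, g)).
exists (lim (a @ F)) => e A FA Asmall f Af.
have cn : (fun g => `|a f - a g|) @ F --> `|a f - lim (a @ F)|.
  by apply: cvg_norm; apply: cvgB => //; exact: cvg_cst.
rewrite -(cvg_lim _ cn)//; apply: limr_le; first by apply/cvg_ex; eexists; exact: cn.
near=> g.
have Ag : A g by near: g.
by rewrite -lecR (le_trans (alip _ _))// ltW// Asmall.
Unshelve. all: by end_near. Qed.

Lemma C0_complete (F : set_system C0) : ProperFilter F -> cauchy F -> cvg F.
Proof.
move=> FF Fc.
have small (e : R) : 0 < e -> exists2 A : set C0, F A &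
    forall f g, A f -> A g -> `|f - g| < e%:C%C.
  move=> e0; have /cauchy_ballP /(_ e%:C%C) := Fc; rewrite ltcR => /(_ e0).
  move=> [[P Q] [/= FP FQ] PQ]; exists (P `&` Q); first exact: filterI.
  by move=> f g [Pf _] [_ Qg]; exact: (PQ (f, g)).
have Relip t (f g : C0) : `|complex.Re (f t) - complex.Re (g t)|%:C%C <= `|f - g|.
  rewrite (_ : complex.Re (f t) - complex.Re (g t) = complex.Re ((f - g) t)).
    by rewrite (le_trans (normc_ge_Re _))// normcE C0_normE lecR C0_sup_ge.
  by rewrite [(f - g) t]/(f t - g t); case: (f t) (g t) => [a b] [c d].
have Imlip t (f g : C0) : `|complex.Im (f t) - complex.Im (g t)|%:C%C <= `|f - g|.
  rewrite (_ : complex.Im (f t) - complex.Im (g t) = complex.Im ((f - g) t)).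
    rewrite (@le_trans _ _ `|(f - g) t|)//; last first.
      by rewrite normcE C0_normE lecR C0_sup_ge.
    case: ((f - g) t) => a b /=; rewrite normcE lecR /= -sqrtr_sqr.
    by rewrite ler_wsqrtr// lerDr sqr_ge0.
  by rewrite [(f - g) t]/(f t - g t); case: (f t) (g t) => [a b] [c d].
have [x xP] := choice (fun t => C0_cauchy_lim FF Fc (Relip t)).
have [y yP] := choice (fun t => C0_cauchy_lim FF Fc (Imlip t)).
pose l t : R[i] := (x t +i* y t)%C.
have fl (e : R) (A : set C0) : F A ->
    (forall f g, A f -> A g -> `|f - g| < e%:C%C) ->
    forall f, A f -> forall t, `|f t - l t| <= (e + e)%:C%C.
  move=> FA Ae f Af t.
  have := xP t e A FA Ae f Af; have := yP t e A FA Ae f Af.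
  rewrite /l; case: (f t) => [a b] /= be ae.
  rewrite (_ : _ - _ = (a - x t)%:C%C + 'i%C * (b - y t)%:C%C); last first.
    by apply/eqP; rewrite eq_complex /=; apply/andP; split; apply/eqP; ring.
  rewrite (le_trans (ler_normD _ _))// normrM.
  rewrite (_ : `|'i%C| = 1) ?mul1r; last first.
    by rewrite normcE /= expr0n expr1n add0r sqrtr1.
  have -> : (e + e)%:C%C = e%:C%C + e%:C%C :> R[i] by rewrite rmorphD.
  by rewrite lerD// normcE lecR /= expr0n addr0 sqrtr_sqr.
have lv : l \in vanishing.
  apply/vanishingP => e e0.
  have [r r0 er] : exists2 r : R, 0 < r & e = r%:C%C.
    have /complex_realP [r er] := gtr0_real e0.
    by exists r => //; rewrite -ltcR -er.
  have r4 : 0 < r / 4 by rewrite divr_gt0.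
  have [A FA Ae] := small _ r4.
  have [f Af] := filter_ex FA.
  apply: (@sub_finite_set _ _ [set t | (r / 2)%:C%C <= `|f t|]); last first.
    by apply: C0P; rewrite ltcR divr_gt0.
  move=> t /= et; have := fl _ _ FA Ae f Af t.
  move: et; rewrite er !normcE !lecR => rl flr.
  have : normc (l t) <= normc (f t) + normc (f t - l t).
    rewrite -lecR rmorphD /= -!normcE.
    by have := ler_normB (f t) (f t - l t); rewrite subKr.
  lra.
pose L : C0 := MkC0 lv.
apply/cvg_ex; exists L; apply/cvgrPdist_lt => e e0.
have [r r0 er] : exists2 r : R, 0 < r & e = r%:C%C.
  have /complex_realP [r er] := gtr0_real e0.
  by exists r => //; rewrite -ltcR -er.
have r4 : 0 < r / 4 by rewrite divr_gt0.
have [A FA Ae] := small _ r4.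
apply: filterS (FA) => f Af.
rewrite distrC C0_normE er ltcR (@le_lt_trans _ _ (r / 4 + r / 4))//; last lra.
apply: C0_sup_le; first lra.
by move=> t; rewrite -lecR; exact: (fl _ _ FA Ae f Af t).
Qed.

HB.instance Definition _ := Uniform_isComplete.Build C0 C0_complete.
HB.instance Definition _ :=
  NormedStarAlg_isCStarAlg.Build R C0 C0_mul_norm C0_cstar.

Lemma chi_subproof (t : T) :
  (fun s => if s == t then 1 else 0) \in vanishing.
Proof.
apply/vanishingP => e e0; apply: (@sub_finite_set _ _ [set t]) => // s /=.
case: eqP => // _; rewrite normr0 => e_le0.
by have := lt_le_trans e0 e_le0; rewrite ltxx.
Qed.

(* The characteristic function of {t}. *)
Definition chi (t : T) : C0 := MkC0 (chi_subproof t).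

End C0.

Arguments C0 R T : clear implicits.
Arguments chi {R T} t.

Section TensorProducts.
Context {R : realType}.

Record is_rep (A : cstarAlgType R) (H : hilbertType R) (pi : A -> H -> H) :
    Prop := IsRep {
  rep_op : forall a, linear (pi a) /\ bounded_op (pi a);
  rep_linear : forall (k : R[i]) a b x,
    pi (k *: a + b) x = k *: pi a x + pi b x;
  rep_mul : forall a b x, pi (a ** b) x = pi a (pi b x);
  rep_star : forall a x y, inner (pi a x) y = inner x (pi (star a) y)
}.

(* |\sum_i x_i (x) y_i|^2 in the Hilbert space tensor product of H and K. *)
Definition tensor_sqnorm (H K : hilbertType R) (I : finType)
    (x : I -> H) (y : I -> K) : R[i] :=
  \sum_(i : I) \sum_(j : I) inner (x i) (x j) * inner (y i) (y j).

(* |\sum_i a_i (x) b_i| <= M for the spatial norm, i.e., the operator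
   \sum_i pi(a_i) (x) sigma(b_i) has norm at most M on the Hilbert space tensor
   product of H and K for all representations pi of A on H, sigma of B on K;
   it is tested on the dense subspace of the finite sums \sum_j x_j (x) y_j. *)
Definition spatial_norm_le (A B : cstarAlgType R) (n : nat)
    (a : 'I_n -> A) (b : 'I_n -> B) (M : R[i]) : Prop :=
  forall (H K : hilbertType R) (pi : A -> H -> H) (sigma : B -> K -> K),
    is_rep pi -> is_rep sigma ->
    forall (m : nat) (x : 'I_m -> H) (y : 'I_m -> K),
      tensor_sqnorm (fun ij : 'I_n * 'I_m => pi (a ij.1) (x ij.2))
                    (fun ij : 'I_n * 'I_m => sigma (b ij.1) (y ij.2))
        <= M ^+ 2 * tensor_sqnorm x y.

Definition lin_indep (V : lmodType R[i]) (n : nat) (x : 'I_n -> V) : Prop :=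
  forall k : 'I_n -> R[i], \sum_(i < n) k i *: x i = 0 -> forall i, k i = 0.

(* A completion of the algebraic tensor product of A and B in the spatial
   norm; [tensor_inj] says that the algebraic tensor product embeds. *)
Record spatial_tensor (A B : cstarAlgType R) := SpatialTensor {
  tensor_alg :> cstarAlgType R;
  tensor : A -> B -> tensor_alg;
  tensor_linearl : forall b, linear (fun a => tensor a b);
  tensor_linearr : forall a, linear (tensor a);
  tensor_mul : forall a b a' b',
    tensor a b ** tensor a' b' = tensor (a ** a') (b ** b');
  tensor_star : forall a b, star (tensor a b) = tensor (star a) (star b);
  tensor_inj : forall n (a : 'I_n -> A) (b : 'I_n -> B), lin_indep b ->
    \sum_(i < n) tensor (a i) (b i) = 0 -> forall i, a i = 0;
  tensor_norm : forall n (a : 'I_n -> A) (b : 'I_n -> B) (M : R[i]), 0 <= M ->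
    (`|\sum_(i < n) tensor (a i) (b i)| <= M <-> spatial_norm_le a b M);
  tensor_dense : dense (lin_span [set z | exists a b, z = tensor a b])
}.

End TensorProducts.

Section Homomorphisms.
Context {R : realType}.
Implicit Types A B C D : cstarAlgType R.

Definition nondegenerate A B (pi : A -> multiplier B) : Prop :=
  dense (lin_span [set b' | exists a b, b' = lact (pi a) b]).

(* The strictly continuous extension of a nondegenerate theta : A -> M(B) to
   M(A) maps m to n. *)
Definition ext_maps A B (theta : A -> multiplier B)
    (m : multiplier A) (n : multiplier B) : Prop :=
  forall a, n ** theta a = theta (lact m a).

(* k = m (x) n. *)
Definition mult_tensor A B (T : spatial_tensor A B)
    (m : multiplier A) (n : multiplier B) (k : multiplier T) : Prop :=
  forall a b, lact k (tensor T a b) = tensor T (lact m a) (lact n b).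

(* Phi = pi (x) rho : A (x) B -> C (x) D. *)
Definition hom_tensor A B C D (S : spatial_tensor A B) (T : spatial_tensor C D)
    (pi : A -> C) (rho : B -> D) (Phi : S -> T) : Prop :=
  star_hom Phi /\
  forall a b, Phi (tensor S a b) = tensor T (pi a) (rho b).

(* Phi = pi (x) id : A (x) C -> M(B (x) C). *)
Definition hom_tensor_id A B C (S : spatial_tensor A C) (T : spatial_tensor B C)
    (pi : A -> multiplier B) (Phi : S -> multiplier T) : Prop :=
  star_hom Phi /\
  forall a c, mult_tensor (pi a) (to_mult c) (Phi (tensor S a c)).

End Homomorphisms.

Record digraph := Digraph {
  vertex : choiceType;
  edge : choiceType;
  rng : edge -> vertex;
  src : edge -> vertex
}.

Definition row_finite (E : digraph) : Prop :=
  forall v : vertex E, finite_set [set f | src f = v].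

Definition sink (E : digraph) (v : vertex E) : Prop :=
  forall f : edge E, src f <> v.

Definition skew_product (E : digraph) (G : groupType) (c : edge E -> G) :
    digraph :=
  @Digraph (vertex E * G)%type (edge E * G)%type
    (fun ft => (rng ft.1, ft.2)) (fun ft => (src ft.1, (c ft.1 * ft.2)%g)).

Section Universal.
Context {R : realType}.

Record ck_family (E : digraph) (B : starAlgType R)
    (t : edge E -> B) (q : vertex E -> B) : Prop := CKFamily {
  ck_pisom : forall f, partial_isometry (t f);
  ck_proj : forall v, projection (q v);
  ck_orth : forall v w, v <> w -> q v ** q w = 0;
  ck_rng : forall f, star (t f) ** t f = q (rng f);
  ck_src : forall v, ~ sink v ->
    q v = \sum_(f \in [set f | src f = v]) (t f ** star (t f))
}.

(* For universal algebras, existence of the induced map is stated; its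
   uniqueness follows from the generation (or density) field. *)
Record is_graph_calg (E : digraph) (A : cstarAlgType R)
    (s : edge E -> A) (p : vertex E -> A) : Prop := IsGraphCalg {
  graph_ck : ck_family s p;
  graph_gen : generates (range s `|` range p);
  graph_univ : forall (B : cstarAlgType R) (t : edge E -> B) (q : vertex E -> B),
    ck_family t q -> exists phi : A -> B,
      [/\ star_hom phi, forall f, phi (s f) = t f & forall v, phi (p v) = q v]
}.

(* The algebra B is unital, with unit u 1. *)
Record unitary_rep (G : groupType) (B : starAlgType R) (u : G -> B) : Prop :=
    UnitaryRep {
  urep_unit : is_unit (u 1%g);
  urep_mul : forall s t, u (s * t)%g = u s ** u t;
  urep_star : forall t, star (u t) = u (t^-1)%g
}.

Record is_group_calg (G : groupType) (B : cstarAlgType R) (u : G -> B) : Prop :=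
    IsGroupCalg {
  group_urep : unitary_rep u;
  group_gen : generates (range u);
  group_univ : forall (C : cstarAlgType R) (v : G -> C), unitary_rep v ->
    exists phi : B -> C, star_hom phi /\ forall t, phi (u t) = v t
}.

End Universal.

Section Coactions.
Context {R : realType} (TP : forall A B : cstarAlgType R, spatial_tensor A B).
Context {G : groupType} {CG : cstarAlgType R} (u : G -> CG).

Notation "a \ot b" := (tensor (TP _ _) a b)
  (at level 40, left associativity) : ring_scope.

(* alpha is the canonical isomorphism from A (x) (CG (x) CG) to
   (A (x) CG) (x) CG. *)
Record is_coaction (A : cstarAlgType R) (delta : A -> TP A CG) : Prop :=
    IsCoaction {
  coact_hom : star_hom delta;
  coact_inj : injective delta;
  coact_nondeg : nondegenerate (fun a => to_mult (delta a));
  coact_id : exists (deltaG : CG -> TP CG CG)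
      (delta_id : TP A CG -> TP (TP A CG) CG)
      (id_deltaG : TP A CG -> TP A (TP CG CG))
      (alpha : TP A (TP CG CG) -> TP (TP A CG) CG),
    [/\ star_hom deltaG /\ (forall t, deltaG (u t) = u t \ot u t),
        hom_tensor delta id delta_id,
        hom_tensor id deltaG id_deltaG,
        star_hom alpha /\
          (forall a b c, alpha (a \ot (b \ot c)) = (a \ot b) \ot c) &
        forall a, delta_id (delta a) = alpha (id_deltaG (delta a))]
}.

(* w is the function t |-> u t in M(C_0(G) (x) C^*(G)), where
   C_0(G) (x) C^*(G) is C_0(G, C^*(G)) with f (x) x the function
   t |-> f t *: x. *)
Definition is_wG (w : multiplier (TP (C0 R G) CG)) : Prop :=
  forall t x, lact w (chi t \ot x) = chi t \ot (u t ** x).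

(* W = (mu (x) id)(w_G); w, W and the maps pi (x) id, mu (x) id are uniquely
   determined by their defining properties. *)
Record covariant_rep (A : cstarAlgType R) (delta : A -> TP A CG)
    (B : cstarAlgType R) (pi : A -> multiplier B) (mu : C0 R G -> multiplier B) :
    Prop := CovariantRep {
  cov_pi : star_hom pi;
  cov_mu : star_hom mu;
  cov_pi_nondeg : nondegenerate pi;
  cov_mu_nondeg : nondegenerate mu;
  cov_eq : exists (pi_id : TP A CG -> multiplier (TP B CG))
      (mu_id : TP (C0 R G) CG -> multiplier (TP B CG))
      (w : multiplier (TP (C0 R G) CG)) (W : multiplier (TP B CG)),
    [/\ hom_tensor_id pi pi_id,
        hom_tensor_id mu mu_id,
        is_wG w,
        ext_maps mu_id w W &
        forall a, exists2 pi1 : multiplier (TP B CG),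
          mult_tensor (pi a) mult_one pi1 &
          pi_id (delta a) = W ** pi1 ** star W]
}.

Record is_crossed_product (A : cstarAlgType R) (delta : A -> TP A CG)
    (D : cstarAlgType R) (jA : A -> multiplier D) (jG : C0 R G -> multiplier D) :
    Prop := IsCrossedProduct {
  cross_cov : covariant_rep delta jA jG;
  cross_in : forall a g, exists d, to_mult d = jA a ** jG g;
  cross_dense :
    dense (lin_span [set d | exists a g, to_mult d = jA a ** jG g]);
  cross_univ : forall (B : cstarAlgType R)
      (pi : A -> multiplier B) (mu : C0 R G -> multiplier B),
    covariant_rep delta pi mu -> exists theta : D -> multiplier B,
      [/\ star_hom theta, nondegenerate theta,
          forall a, ext_maps theta (jA a) (pi a) &
          forall g, ext_maps theta (jG g) (mu g)]
}.

Definition is_dual_action (A D : cstarAlgType R)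
    (jA : A -> multiplier D) (jG : C0 R G -> multiplier D)
    (dual : G -> D -> D) : Prop :=
  star_action dual /\
  forall (s t : G) (a : A) (d d' : D),
    to_mult d = jA a ** jG (chi t) ->
    to_mult d' = jA a ** jG (chi (t * s^-1)%g) ->
    dual s d = d'.

End Coactions.

Definition is_skew_action (R : realType) (G : groupType) (E : digraph)
    (c : edge E -> G) (B : cstarAlgType R)
    (s : edge (skew_product c) -> B) (p : vertex (skew_product c) -> B)
    (gamma : G -> B -> B) : Prop :=
  [/\ star_action gamma,
      forall (t r : G) (f : edge E),
        gamma t (s (f, r)) = s (f, (r * t^-1)%g) &
      forall (t r : G) (v : vertex E),
        gamma t (p (v, r)) = p (v, (r * t^-1)%g)].

(* Main.v *)
Require Import Defs.
From HB Require Import structures.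
From mathcomp Require Import all_boot all_order all_algebra.
From mathcomp Require Import finmap.
From mathcomp Require Import all_classical all_reals all_analysis.
From mathcomp Require Import complex ring lra.

(** The family [jA(s_f) jG(chi_r)], [jA(p_v) jG(chi_r)] in the crossed product D
    satisfies the Cuntz-Krieger relations of the skew product: slicing the
    covariance condition gives [jA(s_f) jG(chi_r) = jG(chi_{c(f) r}) jA(s_f)],
    because distinct group elements are distinct in C^*(G) (regular
    representation). This gives phi : B -> D. Conversely the strictly convergent
    sums [sum_r s_(f,r)], [sum_v p_(v,r)] in M(B) form a covariant
    representation, hence theta : D -> M(B), and [theta \o phi] is the inclusion
    of B in M(B); so phi is isometric, its range is closed, and it is dense.

    A *-homomorphism of C*-algebras is contractive for an elementary reason: if
    [h] is self-adjoint and [|h| < 1], then [1 - h^2] is a square by a fixed point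
    iteration, so the image of [h] is the real part of a unitary. The same square
    roots, applied in M(B), bound tensor products of maps and extend
    representations of B to M(B) on their essential subspace. *)

Set Implicit Arguments.
Unset Strict Implicit.
Unset Printing Implicit Defensive.

Import Order.TTheory GRing.Theory Num.Theory.
Import numFieldNormedType.Exports.

Local Open Scope classical_set_scope.
Local Open Scope ring_scope.

(** * Real-valued norms and dense spans *)

(** The Cuntz-Krieger relations only say that the range projections at a vertex add up to a
    projection. Their orthogonality, on which every computation with sums of edges rests, has to be
    extracted; in place of positivity and spectral theory it comes from extremality of a projection
    in the unit ball of its corner. Since the algebras need not be unital, a square root of 1 - h is
    carried by y = 1 - sqrt(1 - h) alone.

    The spatial norm is defined through representations of the two factors. A homomorphism A -> M(B)
    can therefore be tensored with the identity only if each representation of B induces one of A,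
    which is the reason for extending representations to M(B).

    Density of the range of phi is an invariance statement: the elements a of A such that jA(a), and
    likewise its adjoint, maps phi(B) into itself form a closed *-subalgebra containing the
    generators. Since A is the closed span of the products a p_v, the range then contains every
    jA(a) jG(chi_r). The isomorphism is the inverse of phi. *)

Definition rnorm (R : realType) (V : normedModType R[i]) (x : V) : R :=
  complex.Re `|x|.

Notation "⟦ x ⟧" := (rnorm x) (at level 0, x at level 99, format "⟦ x ⟧").

Section RealNorm.
Context {R : realType}.
Implicit Types V W : normedModType R[i].

Lemma rnormE V (x : V) : `|x| = ⟦x⟧%:C%C.
Proof. by rewrite /rnorm RRe_real// ger0_real. Qed.

Lemma rnorm_ge0 V (x : V) : 0 <= ⟦x⟧.
Proof. by rewrite -lecR -rnormE normr_ge0. Qed.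

Lemma rnorm_leC V (x : V) (M : R) : (⟦x⟧ <= M) = (`|x| <= M%:C%C).
Proof. by rewrite rnormE lecR. Qed.

Lemma rnorm_ltC V (x : V) (M : R) : (⟦x⟧ < M) = (`|x| < M%:C%C).
Proof. by rewrite rnormE ltcR. Qed.

Lemma rnormD V (x y : V) : ⟦x + y⟧ <= ⟦x⟧ + ⟦y⟧.
Proof. by rewrite rnorm_leC rmorphD /= -!rnormE ler_normD. Qed.

Lemma rnormZ V (k : R[i]) (x : V) : ⟦k *: x⟧ = Normc.normc k * ⟦x⟧.
Proof. by apply: complexI; rewrite rmorphM /= -!rnormE normrZ. Qed.

Lemma rnorm0 V : ⟦0 : V⟧ = 0.
Proof. by apply: complexI; rewrite -rnormE normr0. Qed.

Lemma rnorm0_eq0 V (x : V) : ⟦x⟧ <= 0 -> x = 0.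
Proof.
by rewrite rnorm_leC => xle; apply/eqP; rewrite -normr_le0.
Qed.

Lemma rnormN V (x : V) : ⟦- x⟧ = ⟦x⟧.
Proof. by rewrite /rnorm normrN. Qed.

Lemma rdistC V (x y : V) : ⟦x - y⟧ = ⟦y - x⟧.
Proof. by rewrite -rnormN opprB. Qed.

Lemma rnormB V (x y : V) : ⟦x - y⟧ <= ⟦x⟧ + ⟦y⟧.
Proof. by rewrite (le_trans (rnormD _ _))// rnormN. Qed.

Lemma rdist_triangle V (y x z : V) : ⟦x - z⟧ <= ⟦x - y⟧ + ⟦y - z⟧.
Proof. by rewrite (le_trans _ (rnormD _ _))// addrA subrK. Qed.

Lemma rnormBB V (x y : V) : ⟦x⟧ <= ⟦x - y⟧ + ⟦y⟧.
Proof. by rewrite (le_trans _ (rnormD _ _))// subrK. Qed.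

Lemma rnorm_sum V (I : Type) (r : seq I) (P : pred I) (F : I -> V) :
  ⟦\sum_(i <- r | P i) F i⟧ <= \sum_(i <- r | P i) ⟦F i⟧.
Proof.
elim/big_rec2 : _ => [|i a b _ ab]; first by rewrite rnorm0.
by rewrite (le_trans (rnormD _ _))// lerD2l.
Qed.

Lemma normc_real (k : R) : 0 <= k -> Normc.normc (k%:C%C : R[i]) = k.
Proof. by move=> k0; apply: complexI; rewrite -Defs.normcE ger0_norm// lecR. Qed.

Lemma le_eps (x y : R) : (forall e, 0 < e -> x <= y + e) -> x <= y.
Proof.
move=> H; rewrite leNgt; apply/negP => yx.
have := H ((x - y) / 2); rewrite divr_gt0 ?subr_gt0// => /(_ isT); lra.
Qed.

Lemma rnorm_eps V (x : V) : (forall e, 0 < e -> ⟦x⟧ <= e) -> x = 0.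
Proof. by move=> H; apply: rnorm0_eq0; apply: le_eps => e e0; rewrite add0r H. Qed.

Definition approx V (S : set V) : set V :=
  [set x | forall e : R, 0 < e -> exists2 y, S y & ⟦x - y⟧ < e].

Lemma approx_closure V (S : set V) : approx S = closure S.
Proof.
apply/seteqP; split => x.
  move=> Sx A /nbhs_ballP [e /= e0 eA].
  have [r er] : exists r : R, e = r%:C%C.
    by have /complex_realP [r er] := gtr0_real e0; exists r.
  move: e0; rewrite er ltcR => /Sx [y Sy xy]; exists y; split => //.
  by apply: eA; rewrite -ball_normE /= er -rnorm_ltC.
move=> Sx e e0; have [] := Sx (ball x e%:C%C).
  by apply: nbhsx_ballx; rewrite ltcR.
by move=> y [Sy]; rewrite -ball_normE /= -rnorm_ltC; exists y.
Qed.

Lemma subset_approx V (S : set V) : S `<=` approx S.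
Proof. by move=> x Sx e e0; exists x => //; rewrite subrr rnorm0. Qed.

Lemma approxS V (S T : set V) : S `<=` T -> approx S `<=` approx T.
Proof. by move=> ST x Sx e /Sx[y /ST]; exists y. Qed.

Lemma approx_idem V (S : set V) : approx (approx S) `<=` approx S.
Proof.
move=> x Sx e e0; have e2 : 0 < e / 2 by rewrite divr_gt0.
have [y /(_ _ e2)[z Sz yz] xy] := Sx _ e2; exists z => //.
by have := rdist_triangle y x z; lra.
Qed.

Lemma closedP V (S : set V) : approx S `<=` S <-> closed S.
Proof.
rewrite approx_closure; split => [|/closure_id <-//].
by move=> cS; apply/closure_id/seteqP; split => //; exact: subset_closure.
Qed.

Lemma denseP V (S : set V) : dense S <-> forall x, approx S x.
Proof.
split => [dS x e e0|dS].
  have [] := dS (ball x e%:C%C).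
    by exists x; apply: ballxx; rewrite ltcR.
  by apply: ball_open; rewrite ltcR.
  move=> y [+ Sy]; rewrite -ball_normE /= -rnorm_ltC.
  by exists y.
move=> O [x Ox] Oo; have : closure S x by rewrite -approx_closure.
by move=> /(_ O (open_nbhs_nbhs (conj Oo Ox)))[y [Sy Oy]]; exists y.
Qed.

Definition tends V (u : nat -> V) (l : V) : Prop :=
  forall e : R, 0 < e -> exists N, forall n, (N <= n)%N -> ⟦u n - l⟧ < e.

Definition rcauchy V (u : nat -> V) : Prop :=
  forall e : R, 0 < e -> exists N, forall m n, (N <= m)%N -> (N <= n)%N ->
    ⟦u m - u n⟧ < e.

Lemma tends_approx V (S : set V) (u : nat -> V) l :
  (forall n, S (u n)) -> tends u l -> approx S l.
Proof.
move=> Su ul e /ul[N uN]; exists (u N) => //; rewrite rdistC; exact: uN.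
Qed.

Lemma complete_tends (V : completeNormedModType R[i]) (u : nat -> V) :
  rcauchy u -> exists l, tends u l.
Proof.
move=> uc.
have : cauchy (u @ \oo).
  apply/cauchy_ballP => e e0.
  have [r er] : exists r : R, e = r%:C%C.
    by have /complex_realP [r er] := gtr0_real e0; exists r.
  move: e0; rewrite er ltcR => /uc[N uN].
  exists ([set x | exists2 n, (N <= n)%N & x = u n],
          [set x | exists2 n, (N <= n)%N & x = u n]) => /=.
    by split; exists N => // n /= Nn; exists n.
  move=> [_ _] /= [[m Nm ->] [n Nn ->]].
  by rewrite -ball_normE /= -rnorm_ltC; exact: uN.
move=> /cauchy_cvg /cvg_ex[l /cvgrPdist_lt ul]; exists l => e e0.
have [|N _ NP] := ul e%:C%C; first by rewrite ltcR.
by exists N => n Nn; rewrite rdistC rnorm_ltC; exact: NP.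
Qed.

Lemma invS_small (e : R) : 0 < e -> exists N, forall n, (N <= n)%N ->
  n.+1%:R^-1 < e.
Proof.
move=> e0; exists (Num.trunc e^-1) => n Nn.
rewrite invf_plt ?posrE ?ltr0n//.
by rewrite (lt_le_trans (truncnS_gt _))// ler_nat ltnS.
Qed.

Lemma approx_seq V (S : set V) x : approx S x ->
  exists2 u : nat -> V, (forall n, S (u n)) & tends u x.
Proof.
move=> Sx.
have /choice[u uP] (n : nat) : exists y, S y /\ ⟦x - y⟧ < n.+1%:R^-1.
  by have [|y] := Sx n.+1%:R^-1; [rewrite invr_gt0|exists y].
exists u => [n|e /invS_small[N NP]]; first by case: (uP n).
by exists N => n Nn; rewrite rdistC (lt_trans (proj2 (uP n)))// NP.
Qed.

(** The completeness structure asks for Cauchy filters, while all limits below are built from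
    sequences; points chosen in shrinking members of the filter reduce the one to the other. *)
Lemma complete_filter V : (forall u : nat -> V, rcauchy u -> exists l, tends u l) ->
  forall F : set_system V, ProperFilter F -> cauchy F -> cvg F.
Proof.
move=> Vc F FF Fc.
have small (e : R) : 0 < e -> exists A : set V, F A /\
    forall f g, A f -> A g -> ⟦f - g⟧ < e.
  move=> e0; have /cauchy_ballP /(_ e%:C%C) := Fc; rewrite ltcR => /(_ e0).
  move=> [[P Q] [/= FP FQ] PQ]; exists (P `&` Q); split; first exact: filterI.
  move=> f g [Pf _] [_ Qg]; have := PQ (f, g) (conj Pf Qg).
  by rewrite /ball_ /= -ball_normE /= -rnorm_ltC.
have /choice[A AP] (n : nat) := small n.+1%:R^-1 (eqbRL (invr_gt0 _) (ltr0Sn _ _)).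
(* The small members of the filter are made nested, so that points chosen in them form a Cauchy
   sequence. *)
pose C := fix C n := if n is m.+1 then A n `&` C m else A 0%N.
have FC n : F (C n).
  by elim: n => [|n IH] /=; [case: (AP 0%N)|apply: filterI => //; case: (AP n.+1)].
have CA m n : (m <= n)%N -> C n `<=` A m.
  elim: n => [|n IH]; first by rewrite leqn0 => /eqP ->.
  by rewrite leq_eqVlt ltnS => /orP[/eqP -> x []//|/IH Cm x /= [_ /Cm]].
have /choice[u uC] n : exists x, C n x by exact: filter_ex (FC n).
have uu N m n : (N <= m)%N -> (N <= n)%N -> ⟦u m - u n⟧ < N.+1%:R^-1.
  by move=> Nm Nn; apply: (proj2 (AP N)); apply: CA (uC _).
have [l ul] : exists l, tends u l.
  apply: Vc => e /invS_small[N /(_ N (leqnn _)) Ne]; exists N => m n Nm Nn.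
  by rewrite (lt_trans _ Ne)// uu.
apply/cvg_ex; exists l; apply/cvgrPdist_lt => e e0.
have [r er] : exists r : R, e = r%:C%C.
  by have /complex_realP [r er] := gtr0_real e0; exists r.
move: e0; rewrite er ltcR => r0.
have r2 : 0 < r / 2 by rewrite divr_gt0.
have [N NP] := invS_small r2; have [N' N'P] := ul _ r2.
pose K := maxn N N'.
apply: filterS (proj1 (AP K)) => x Ax; rewrite -rnorm_ltC.
have uKx : ⟦u K - x⟧ < r / 2.
  rewrite (lt_trans (proj2 (AP K) _ _ _ Ax))//; first exact: CA (uC K).
  by apply: NP; exact: leq_maxl.
have := N'P K (leq_maxr _ _); rewrite rdistC.
by have := rdist_triangle (u K) l x; lra.
Qed.

End RealNorm.

(** * Linear maps, finite combinations and extension by continuity *)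

Section LinearMaps.
Context {R : realType}.

Section Linear.
Context {U V : lmodType R[i]} {f : U -> V}.
Hypothesis fl : linear f.

Lemma linD x y : f (x + y) = f x + f y.
Proof. by have := fl 1 x y; rewrite !scale1r. Qed.

Lemma lin0 : f 0 = 0.
Proof. by apply: (addrI (f 0)); rewrite -linD !addr0. Qed.

Lemma linZ k x : f (k *: x) = k *: f x.
Proof. by have := fl k x 0; rewrite !addr0 lin0 addr0. Qed.

Lemma linN x : f (- x) = - f x.
Proof. by rewrite -scaleN1r linZ scaleN1r. Qed.

Lemma linB x y : f (x - y) = f x - f y.
Proof. by rewrite linD linN. Qed.

Lemma lin_sum (I : Type) (r : seq I) (P : pred I) (F : I -> U) :
  f (\sum_(i <- r | P i) F i) = \sum_(i <- r | P i) f (F i).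
Proof.
elim/big_rec2 : _ => [|i a b _ <-]; first exact: lin0.
exact: linD.
Qed.

End Linear.

(** Coefficients and indices are kept in a list so that one list can be evaluated in two families
    [g] and [h]; a bounded map sending [g i] to [h i] then amounts to a norm inequality between the
    two evaluations. *)
Definition comb (V : lmodType R[i]) (I : Type) (g : I -> V)
  (l : seq (R[i] * I)) : V := \sum_(p <- l) p.1 *: g p.2.

Definition span (V : lmodType R[i]) (I : Type) (g : I -> V) : set V :=
  [set v | exists l, v = comb g l].

Lemma comb_lin (V : lmodType R[i]) (I : Type) (k : R[i])
    (l l' : seq (R[i] * I)) : exists l'', forall g : I -> V,
  comb g l'' = k *: comb g l + comb g l'.
Proof.
exists ([seq (k * p.1, p.2) | p <- l] ++ l') => g.
rewrite /comb big_cat big_map scaler_sumr; congr (_ + _).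
by apply: eq_bigr => p _; rewrite scalerA.
Qed.

Lemma comb_lin2 (V W : lmodType R[i]) (I : Type) (k : R[i])
    (l l' : seq (R[i] * I)) (g : I -> V) (h : I -> W) : exists l'',
  comb g l'' = k *: comb g l + comb g l' /\
  comb h l'' = k *: comb h l + comb h l'.
Proof.
exists ([seq (k * p.1, p.2) | p <- l] ++ l').
rewrite /comb !big_cat !big_map !scaler_sumr.
by split; congr (_ + _); apply: eq_bigr => p _; rewrite scalerA.
Qed.

Lemma comb1 (V : lmodType R[i]) (I : Type) (g : I -> V) i : comb g [:: (1, i)] = g i.
Proof. by rewrite /comb big_seq1 scale1r. Qed.

Lemma span_gen (V : lmodType R[i]) (I : Type) (g : I -> V) i : span g (g i).
Proof. by exists [:: (1, i)]; rewrite comb1. Qed.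

Lemma span_lin (V : lmodType R[i]) (I : Type) (g : I -> V) k x y :
  span g x -> span g y -> span g (k *: x + y).
Proof.
by move=> [l ->] [l' ->]; have [l'' E] := comb_lin V k l l'; exists l''.
Qed.

Lemma span_min (V : lmodType R[i]) (I : Type) (g : I -> V) (S : set V) :
  S 0 -> (forall k x y, S x -> S y -> S (k *: x + y)) -> (forall i, S (g i)) ->
  span g `<=` S.
Proof.
move=> S0 Sl Sg _ [l ->]; rewrite /comb; elim: l => [|p l IH].
  by rewrite big_nil.
by rewrite big_cons; exact: Sl.
Qed.

Lemma lin_spanE (V : lmodType R[i]) (S : set V) (I : Type) (g : I -> V) :
  S = range g -> lin_span S = span g.
Proof.
move=> SE; apply/seteqP; split => x.
  move=> [n [k [y [Sy ->]]]].
  elim/big_rec : _ => [|i z _]; first by exists [::]; rewrite /comb big_nil.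
  by apply: span_lin; have := Sy i; rewrite SE => -[j _ <-]; exact: span_gen.
move=> [l ->]; exists (size l), (fun i => (tnth (in_tuple l) i).1),
  (fun i => g (tnth (in_tuple l) i).2); split.
  by move=> i; rewrite SE; exists (tnth (in_tuple l) i).2.
by rewrite /comb big_tnth.
Qed.

Lemma lin_comb (V W : lmodType R[i]) (I : Type) (g : I -> V) (f : V -> W) l :
  linear f -> f (comb g l) = comb (f \o g) l.
Proof. by move=> lf; rewrite /comb (lin_sum lf); apply: eq_bigr => p _; exact: linZ. Qed.

End LinearMaps.

Section Lipschitz.
Context {R : realType} {V W : normedModType R[i]}.

Lemma approx_eq0 (F : V -> W) (C : R) (S : set V) x :
  (forall x y, ⟦F x - F y⟧ <= C * ⟦x - y⟧) -> (forall y, S y -> F y = 0) ->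
  approx S x -> F x = 0.
Proof.
move=> FC F0 Sx; apply: rnorm_eps => e e0.
have C1 : 0 < `|C| + 1 by rewrite ltr_wpDl.
have [y Sy xy] := Sx (e / (`|C| + 1)) (divr_gt0 e0 C1).
rewrite -[F x]subr0 -(F0 y Sy) (le_trans (FC _ _))//.
rewrite (@le_trans _ _ ((`|C| + 1) * ⟦x - y⟧))//; last first.
  by rewrite mulrC -ler_pdivlMr// ltW.
rewrite ler_wpM2r ?rnorm_ge0//.
by rewrite (le_trans (ler_norm _))// lerDl.
Qed.

Lemma approx_linear_eq (F G : V -> W) (C D : R) (S : set V) x :
  linear F -> linear G ->
  (forall x, ⟦F x⟧ <= C * ⟦x⟧) -> (forall x, ⟦G x⟧ <= D * ⟦x⟧) ->
  (forall y, S y -> F y = G y) -> approx S x -> F x = G x.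
Proof.
move=> Fl Gl FC GD FG Sx; apply/eqP; rewrite -subr_eq0; apply/eqP.
apply: (@approx_eq0 (fun x => F x - G x) (C + D) S) => // [y z|y Sy].
  have -> : F y - G y - (F z - G z) = F (y - z) - G (y - z).
    by rewrite (linB Fl) (linB Gl) !opprD !opprK addrACA.
  by rewrite (le_trans (rnormB _ _))// mulrDl lerD.
by rewrite FG// subrr.
Qed.

Lemma dense_linear_eq (F G : V -> W) (C D : R) (I : Type) (g : I -> V) :
  (forall x, approx (span g) x) ->
  linear F -> linear G ->
  (forall x, ⟦F x⟧ <= C * ⟦x⟧) -> (forall x, ⟦G x⟧ <= D * ⟦x⟧) ->
  (forall i, F (g i) = G (g i)) -> F =1 G.
Proof.
move=> gd Fl Gl FC GD FG x.
apply: (@approx_linear_eq F G C D (span g)) => //.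
move=> _ [l ->]; rewrite (lin_comb _ _ Fl) (lin_comb _ _ Gl).
by rewrite /comb; apply: eq_bigr => p _ /=; rewrite FG.
Qed.

Lemma approx_lip (F : V -> W) (C : R) (S : set V) (T : set W) x :
  (forall x y, ⟦F x - F y⟧ <= C * ⟦x - y⟧) -> (forall y, S y -> approx T (F y)) ->
  approx S x -> approx T (F x).
Proof.
move=> FC ST Sx; apply: approx_idem => e e0.
have C1 : 0 < `|C| + 1 by rewrite ltr_wpDl.
have [y Sy xy] := Sx (e / (`|C| + 1)) (divr_gt0 e0 C1).
exists (F y); first exact: ST.
rewrite (le_lt_trans (FC _ _))//.
rewrite (@le_lt_trans _ _ ((`|C| + 1) * ⟦x - y⟧))//; last first.
  by rewrite mulrC -ltr_pdivlMr.
rewrite ler_wpM2r ?rnorm_ge0//.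
by rewrite (le_trans (ler_norm _))// lerDl.
Qed.

Lemma approx_submod (S : set V) : S 0 ->
  (forall (k : R[i]) x y, S x -> S y -> S (k *: x + y)) ->
  forall (k : R[i]) x y, approx S x -> approx S y -> approx S (k *: x + y).
Proof.
move=> S0 Sl k x y Sx Sy e e0.
have k1 : 0 < Normc.normc k + 1 by rewrite ltr_wpDl// normc_ge0.
have e2 : 0 < e / 2 by rewrite divr_gt0.
have [x' Sx' xx'] := Sx (e / 2 / (Normc.normc k + 1)) (divr_gt0 e2 k1).
have [y' Sy' yy'] := Sy (e / 2) e2.
exists (k *: x' + y'); first exact: Sl.
have -> : k *: x + y - (k *: x' + y') = k *: (x - x') + (y - y').
  by rewrite scalerBr opprD addrACA.
rewrite (le_lt_trans (rnormD _ _))// rnormZ [e]splitr ler_ltD//.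
move: xx'; rewrite ltr_pdivlMr// => /ltW; apply: le_trans.
by rewrite mulrC ler_wpM2l ?rnorm_ge0// lerDl.
Qed.

End Lipschitz.

Section Extension.
Context {R : realType} {V : normedModType R[i]} {W : completeNormedModType R[i]}.
Context (I : Type) (g : I -> V) (h : I -> W) (M : R).
Hypothesis M0 : 0 <= M.
Hypothesis gd : forall x, approx (span g) x.
Hypothesis gh : forall l, ⟦comb h l⟧ <= M * ⟦comb g l⟧.

(** The closure of the relation between [comb g l] and [comb h l]. The bound [gh] makes this closure
    single-valued, so the map never has to be checked separately for being well defined on the
    span. *)
Let rel (v : V) (w : W) : Prop := forall e : R, 0 < e ->
  exists l, ⟦v - comb g l⟧ < e /\ ⟦w - comb h l⟧ < e.

Let rel_lin k v w v' w' : rel v w -> rel v' w' -> rel (k *: v + v') (k *: w + w').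
Proof.
move=> vw vw' e e0.
have k1 : 0 < Normc.normc k + 1 by rewrite ltr_wpDl// normc_ge0.
have e2 : 0 < e / 2 by rewrite divr_gt0.
have [l [vl wl]] := vw (e / 2 / (Normc.normc k + 1)) (divr_gt0 e2 k1).
have [l' [vl' wl']] := vw' (e / 2) e2.
have [l'' [gl hl]] := comb_lin2 k l l' g h.
exists l''; rewrite gl hl.
have aux (U : normedModType R[i]) (x y x' y' : U) :
    ⟦x - x'⟧ < e / 2 / (Normc.normc k + 1) -> ⟦y - y'⟧ < e / 2 ->
    ⟦k *: x + y - (k *: x' + y')⟧ < e.
  move=> xx' yy'.
  have -> : k *: x + y - (k *: x' + y') = k *: (x - x') + (y - y').
    by rewrite scalerBr opprD addrACA.
  rewrite (le_lt_trans (rnormD _ _))// rnormZ [e]splitr ler_ltD//.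
  move: xx'; rewrite ltr_pdivlMr// => /ltW; apply: le_trans.
  by rewrite mulrC ler_wpM2l ?rnorm_ge0// lerDl.
by split; exact: aux.
Qed.

Let rel_le v w : rel v w -> ⟦w⟧ <= M * ⟦v⟧.
Proof.
move=> vw; apply: le_eps => e e0.
have M1 : 0 < M + 1 by rewrite ltr_wpDl.
have [l [vl wl]] := vw (e / (M + 1)) (divr_gt0 e0 M1).
have wle := rnormBB w (comb h l).
have vle : ⟦comb g l⟧ <= ⟦v - comb g l⟧ + ⟦v⟧ by rewrite rdistC; exact: rnormBB.
rewrite (le_trans wle)// (le_trans (lerD (ltW wl) (gh l)))//.
rewrite (le_trans (lerD (lexx _) (ler_wpM2l M0 vle)))//.
rewrite (le_trans (lerD (lexx _) (ler_wpM2l M0 (lerD (ltW vl) (lexx _)))))//.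
rewrite mulrDr addrA [leRHS]addrC lerD2r// -{1}[e / _]mul1r -mulrDl addrC.
by rewrite mulrC divfK// gt_eqF.
Qed.

Let rel_ex v : exists w, rel v w.
Proof.
have [u /choice[l ul] uv] := approx_seq (gd v).
have hd m n : ⟦comb h (l m) - comb h (l n)⟧ <= M * ⟦u m - u n⟧.
  have [l'' [gl hl]] := comb_lin2 (-1) (l n) (l m) g h.
  by rewrite addrC -scaleN1r -hl (le_trans (gh _))// gl -!ul scaleN1r addrC.
have M1 : 0 < M + 1 by rewrite ltr_wpDl.
have [w hw] : exists w, tends (fun n => comb h (l n)) w.
  apply: complete_tends => e e0.
  have e2 : 0 < e / (M + 1) / 2 by rewrite !divr_gt0.
  have [N NP] := uv _ e2; exists N => m n Nm Nn.
  rewrite (le_lt_trans (hd _ _))// (@le_lt_trans _ _ ((M + 1) * ⟦u m - u n⟧))//.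
    by rewrite ler_wpM2r ?rnorm_ge0// lerDl.
  rewrite mulrC -ltr_pdivlMr//.
  have := rdist_triangle v (u m) (u n); rewrite (rdistC v).
  by have := NP _ Nm; have := NP _ Nn; lra.
exists w => e e0; have [N NP] := uv _ e0; have [N' N'P] := hw _ e0.
exists (l (maxn N N')); rewrite -ul !(rdistC _ (u _)) (rdistC w).
by split; [exact: NP (leq_maxl _ _)|exact: N'P (leq_maxr _ _)].
Qed.

Lemma bounded_extension : exists T : V -> W,
  [/\ linear T, forall x, ⟦T x⟧ <= M * ⟦x⟧ & forall i, T (g i) = h i].
Proof.
have /choice[T TP] := rel_ex; exists T.
have Tu v w : rel v w -> T v = w.
  move=> vw; apply/eqP; rewrite -subr_eq0 -oppr_eq0 opprB; apply/eqP/rnorm0_eq0.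
  have := rel_le (rel_lin (-1) (TP v) vw); rewrite !scaleN1r !addNr rnorm0 mulr0.
  by rewrite addrC.
split.
- by move=> k x y; apply/Tu/rel_lin.
- by move=> x; exact: rel_le.
- move=> i; apply: Tu => e e0; exists [:: (1, i)].
  by rewrite !comb1 !subrr !rnorm0.
Qed.

End Extension.

(** * Linear identities in modules by reflection *)

Section LinearIdentities.
Context {K : comNzRingType} {V : lmodType K}.

Inductive lterm :=
| LAtom of nat | LZero | LAdd of lterm & lterm | LOpp of lterm
| LScale of K & lterm | LMuln of lterm & nat.

Fixpoint leval (env : seq V) (t : lterm) : V := match t with
  | LAtom n => env`_n
  | LZero => 0
  | LAdd t t' => leval env t + leval env t'
  | LOpp t => - leval env t
  | LScale k t => k *: leval env t
  | LMuln t n => leval env t *+ n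
  end.

Fixpoint lcoef (t : lterm) (i : nat) : K := match t with
  | LAtom n => if n == i then 1 else 0
  | LZero => 0
  | LAdd t t' => lcoef t i + lcoef t' i
  | LOpp t => - lcoef t i
  | LScale k t => k * lcoef t i
  | LMuln t n => lcoef t i *+ n
  end.

Lemma leval_coef (env : seq V) t :
  leval env t = \sum_(i < size env) lcoef t i *: env`_i.
Proof.
elim: t => /= [n||t -> t' ->|t ->|k t ->|t -> n].
- have [ns|ns] := ltnP n (size env); last first.
    rewrite nth_default// big1// => i _.
    by rewrite gtn_eqF ?scale0r// (leq_trans _ ns).
  rewrite (bigD1 (Ordinal ns))//= eqxx scale1r big1 ?addr0// => i.
  by rewrite eq_sym -val_eqE /= => /negPf ->; rewrite scale0r.
- by rewrite big1// => i _; rewrite scale0r.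
- by rewrite -big_split; apply: eq_bigr => i _; rewrite scalerDl.
- by rewrite -sumrN; apply: eq_bigr => i _; rewrite scaleNr.
- by rewrite scaler_sumr; apply: eq_bigr => i _; rewrite scalerA.
- by rewrite -sumrMnl; apply: eq_bigr => i _; rewrite scalerMnl.
Qed.

(** A conjunction rather than a quantified statement, so that it unfolds into one scalar equation
    per atom. *)
Fixpoint lcoef_eq (n : nat) (t t' : lterm) : Prop :=
  if n is m.+1 then lcoef t m = lcoef t' m /\ lcoef_eq m t t' else True.

Lemma leval_eq (env : seq V) t t' :
  lcoef_eq (size env) t t' -> leval env t = leval env t'.
Proof.
have eqc n : lcoef_eq n t t' -> forall i, (i < n)%N -> lcoef t i = lcoef t' i.
  elim: n => //= n IH [tn /IH tt'] i.
  by rewrite ltnS leq_eqVlt => /orP[/eqP -> //|]; exact: tt'.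
move=> /eqc tt'; rewrite !leval_coef; apply: eq_bigr => i _.
by rewrite tt'.
Qed.

End LinearIdentities.

Ltac lterm_index x env := lazymatch env with
  | x :: _ => constr:(0%N)
  | _ :: ?env' => let n := lterm_index x env' in constr:(S n)
  end.

Ltac lterm_add x env := match env with
  | context [cons x _] => env
  | _ => constr:(x :: env)
  end.

Ltac lterm_atoms e env := lazymatch e with
  | (?a + ?b)%R => let env' := lterm_atoms a env in lterm_atoms b env'
  | (- ?a)%R => lterm_atoms a env
  | (?k *: ?a)%R => lterm_atoms a env
  | (?a *+ ?n)%R => lterm_atoms a env
  | 0%R => env
  | _ => lterm_add e env
  end.

Ltac lterm_reify K e env := lazymatch e with
  | (?a + ?b)%R => let a' := lterm_reify K a env in
                   let b' := lterm_reify K b env in constr:(@LAdd K a' b')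
  | (- ?a)%R => let a' := lterm_reify K a env in constr:(@LOpp K a')
  | (?k *: ?a)%R => let a' := lterm_reify K a env in constr:(@LScale K k a')
  | (?a *+ ?n)%R => let a' := lterm_reify K a env in constr:(@LMuln K a' n)
  | 0%R => constr:(@LZero K)
  | _ => let n := lterm_index e env in constr:(@LAtom K n)
  end.

(* Proves identities in a left module that hold coefficientwise. *)
Ltac lmod_over K := lazymatch goal with
  |- @eq ?V ?a ?b =>
    let env0 := lterm_atoms a (@nil V) in
    let env := lterm_atoms b env0 in
    let a' := lterm_reify K a env in
    let b' := lterm_reify K b env in
    refine (@leval_eq K _ env a' b' _);
    cbn [lcoef_eq lcoef size eqn eq_op]; simpl; repeat split; try (first [ring | by field])
  end.

Ltac lmod := lazymatch goal with
  | R : realType |- _ => lmod_over constr:((R[i] : comNzRingType))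
  end.

(** * Square roots in C*-algebras and contractivity of *-homomorphisms *)

Section CStarBasics.
Context {R : realType} {A : cstarAlgType R}.
Implicit Types x y z : A.

Lemma amull_linear x : linear (amul x).
Proof. by move=> k y z; exact: amul_linearr. Qed.

Lemma amulr_linear x : linear (fun y => y ** x).
Proof. by move=> k y z; exact: amul_linearl. Qed.

Lemma amulBl x y z : (x - y) ** z = x ** z - y ** z.
Proof. exact: (linB (amulr_linear z)). Qed.

Lemma amulBr x y z : z ** (x - y) = z ** x - z ** y.
Proof. exact: (linB (amull_linear z)). Qed.

Lemma amul_suml (I : Type) (r : seq I) (P : pred I) (F : I -> A) x :
  (\sum_(i <- r | P i) F i) ** x = \sum_(i <- r | P i) F i ** x.
Proof. exact: (lin_sum (amulr_linear x)). Qed.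

Lemma amul_sumr (I : Type) (r : seq I) (P : pred I) (F : I -> A) x :
  x ** (\sum_(i <- r | P i) F i) = \sum_(i <- r | P i) x ** F i.
Proof. exact: (lin_sum (amull_linear x)). Qed.

Lemma star0 : star (0 : A) = 0.
Proof. by apply: (addrI (star 0)); rewrite -star_additive !addr0. Qed.

Lemma starZ (k : R[i]) x : star (k *: x) = k^* *: star x.
Proof. by have := star_semilinear k x 0; rewrite !addr0 star0 addr0. Qed.

Lemma starN x : star (- x) = - star x.
Proof. by rewrite -scaleN1r starZ rmorphN rmorph1 scaleN1r. Qed.

Lemma starB x y : star (x - y) = star x - star y.
Proof. by rewrite star_additive starN. Qed.

Lemma star_sum (I : Type) (r : seq I) (P : pred I) (F : I -> A) :
  star (\sum_(i <- r | P i) F i) = \sum_(i <- r | P i) star (F i).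
Proof.
elim/big_rec2 : _ => [|i a b _ <-]; first exact: star0.
exact: star_additive.
Qed.

Lemma rnormM x y : ⟦x ** y⟧ <= ⟦x⟧ * ⟦y⟧.
Proof. by rewrite rnorm_leC rmorphM /= -!rnormE amul_norm_le. Qed.

Lemma rnorm_star x : ⟦star x⟧ = ⟦x⟧.
Proof. by rewrite /rnorm star_norm. Qed.

Lemma rnorm_cstar x : ⟦star x ** x⟧ = ⟦x⟧ ^+ 2.
Proof. by apply: complexI; rewrite rmorphXn /= -!rnormE cstar_identity. Qed.

Lemma rnorm_sa x : star x = x -> ⟦x ** x⟧ = ⟦x⟧ ^+ 2.
Proof. by rewrite -rnorm_cstar => ->. Qed.

Lemma rnorm_eq x y : star x ** x = star y ** y -> ⟦x⟧ = ⟦y⟧.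
Proof.
move=> xy; apply/eqP; rewrite -(@eqrXn2 _ 2) ?rnorm_ge0//.
by rewrite -!rnorm_cstar xy.
Qed.

Lemma amul_eq0 x : (forall y, x ** y = 0) -> x = 0.
Proof.
move=> x0; apply: rnorm0_eq0; rewrite -rnorm_star le_eqVlt -sqrf_eq0.
by rewrite -rnorm_cstar starK x0 rnorm0 eqxx.
Qed.

Lemma amul_eq0l x : (forall y, y ** x = 0) -> x = 0.
Proof.
move=> x0; apply: rnorm0_eq0; rewrite le_eqVlt -sqrf_eq0.
by rewrite -rnorm_cstar x0 rnorm0 eqxx.
Qed.

Lemma rnorm_proj x : projection x -> ⟦x⟧ <= 1.
Proof.
move=> [xx sx]; have := rnorm_sa sx; rewrite xx => /eqP.
rewrite -subr_eq0 expr2 -{1}[⟦x⟧]mulr1 -mulrBr mulf_eq0 subr_eq0.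
by move=> /orP[/eqP ->|/eqP <-].
Qed.

Lemma amul_lip x : forall y z, ⟦x ** y - x ** z⟧ <= ⟦x⟧ * ⟦y - z⟧.
Proof. by move=> y z; rewrite -amulBr rnormM. Qed.

Lemma amulr_lip x : forall y z, ⟦y ** x - z ** x⟧ <= ⟦x⟧ * ⟦y - z⟧.
Proof. by move=> y z; rewrite -amulBl mulrC rnormM. Qed.

End CStarBasics.

Section SquareRoot.
Context {R : realType} {A : cstarAlgType R}.
Implicit Types x y z h : A.

Lemma geometric_cauchy (V : normedModType R[i]) (u : nat -> V) (q : R) :
  0 <= q < 1 -> (forall n, ⟦u n.+1 - u n⟧ <= q ^+ n) -> rcauchy u.
Proof.
move=> /andP[q0 q1] uq.
have q1' : 0 < 1 - q by rewrite subr_gt0.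
have dist n k : ⟦u (n + k)%N - u n⟧ <= (1 - q)^-1 * (q ^+ n - q ^+ (n + k)).
  elim: k => [|k IH]; first by rewrite addn0 !subrr rnorm0 mulr0.
  rewrite addnS (le_trans (rdist_triangle (u (n + k)%N) _ _))//.
  rewrite (le_trans (lerD (uq _) IH))// exprS le_eqVlt; apply/orP; left.
  by apply/eqP; field; rewrite gt_eqF.
have distq n k : (n <= k)%N -> ⟦u k - u n⟧ <= (1 - q)^-1 * q ^+ n.
  move=> /subnKC <-; rewrite (le_trans (dist _ _))//.
  by rewrite ler_wpM2l ?invr_ge0 ?(ltW q1')// gerBl exprn_ge0.
have qcvg : (fun n => q ^+ n) @ \oo --> (0 : R^o).
  by apply: cvg_expr; rewrite ger0_norm.
move=> e e0.
have e2 : 0 < (1 - q) * (e / 2) by rewrite mulr_gt0 ?divr_gt0.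
move/cvgrPdist_lt : qcvg => /(_ _ e2)[N _ /(_ N (leqnn N)) /=].
rewrite sub0r normrN ger0_norm ?exprn_ge0// -ltr_pdivrMl// => qN.
exists N => m n Nm Nn; have := rdist_triangle (u N) (u m) (u n).
rewrite (rdistC (u N)); have := distq _ _ Nm; have := distq _ _ Nn.
lra.
Qed.

(** Squaring has Lipschitz constant 2q on the ball of radius q, so the iteration for the square root
    contracts there by the factor q. *)
Lemma sqrt_iter_lip x y q : ⟦x⟧ <= q -> ⟦y⟧ <= q ->
  ⟦x ** x - y ** y⟧ <= 2 * q * ⟦x - y⟧.
Proof.
move=> xq yq; have -> : x ** x - y ** y = x ** (x - y) + (x - y) ** y.
  by rewrite amulBr amulBl addrA subrK.
rewrite (le_trans (rnormD _ _))// -mulrA mulr_natl mulr2n lerD//.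
  by rewrite (le_trans (rnormM _ _))// ler_wpM2r// rnorm_ge0.
by rewrite (le_trans (rnormM _ _))// mulrC ler_wpM2r// rnorm_ge0.
Qed.

(* [1 - y] is the square root of [1 - h], found as the limit of the iteration
   y |-> (h + y^2) / 2; commuting with [h] and left multiplication by a local
   unit of [h] pass to the limit. *)
Lemma sqrt_one_sub h : star h = h -> ⟦h⟧ < 1 -> exists y,
  [/\ star y = y, y + y = h + y ** y,
      forall z, z ** h = h ** z -> z ** y = y ** z &
      forall g, g ** h = h -> g ** y = y].
Proof.
move=> sh; set q := ⟦h⟧ => q1; have q0 : 0 <= q by exact: rnorm_ge0.
pose F y := 2^-1 *: (h + y ** y); pose u n := iter n F 0.
have half : Normc.normc (2^-1 : R[i]) = 2^-1.
  by rewrite -(@normc_real _ 2^-1) ?invr_ge0// fmorphV rmorph_nat.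
(* The ball of radius q is invariant because (q + q^2) / 2 <= q. *)
have uq n : ⟦u n⟧ <= q.
  elim: n => [|n IH]; first by rewrite /u /= rnorm0.
  rewrite /u /= -/(u n) rnormZ.
  rewrite half ler_pdivrMl// (le_trans (rnormD _ _))//.
  rewrite [leRHS]mulr_natl mulr2n lerD// (le_trans (rnormM _ _))//.
  rewrite (le_trans (ler_pM _ _ IH IH)) ?rnorm_ge0//.
  by rewrite ler_piMr// ltW.
have dF n : u n.+2 - u n.+1 = 2^-1 *: (u n.+1 ** u n.+1 - u n ** u n).
  by rewrite -[u n.+2]/(F (u n.+1)) -{2}[u n.+1]/(F (u n)) /F -scalerBr
    opprD addrACA subrr add0r.
have du n : ⟦u n.+1 - u n⟧ <= q ^+ n.
  elim: n => [|n IH]; first by rewrite expr0 subr0 (le_trans (uq _))// ltW.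
  rewrite dF rnormZ half ler_pdivrMl// (le_trans (sqrt_iter_lip (uq _) (uq _)))//.
  by rewrite exprS -mulrA ler_wpM2l// ler_wpM2l.
have [y uy] : exists y, tends u y.
  by apply/complete_tends/(geometric_cauchy _ du); rewrite q0.
have yq : ⟦y⟧ <= q.
  apply: le_eps => e /uy[N /(_ _ (leqnn N)) uNy].
  have := rnormBB y (u N); rewrite rdistC; have := uq N; lra.
(* A Lipschitz equation that holds along the iterates holds for their limit. Self-adjointness,
   commutation and the local unit are all of this kind. *)
have lim0 (G : A -> A) (C : R) : (forall x z, ⟦G x - G z⟧ <= C * ⟦x - z⟧) ->
    (forall n, G (u n) = 0) -> G y = 0.
  move=> GC G0; apply: (approx_eq0 GC (S := range u)) => [_ [n _ <-]//|].
  by apply: tends_approx uy => n; exists n.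
exists y; split.
- apply/eqP; rewrite -subr_eq0; apply/eqP.
  apply: (lim0 (fun x => star x - x) 2) => [x z|n].
    have -> : star x - x - (star z - z) = star (x - z) - (x - z).
      by rewrite starB !opprD !opprK addrACA.
    by rewrite (le_trans (rnormB _ _))// rnorm_star mulr_natl mulr2n.
  elim: n => [|n /eqP]; first by rewrite /u /= star0 subr0.
  rewrite subr_eq0 => /eqP IH; rewrite /u /= -/(u n) starZ star_additive starM sh IH.
  by rewrite fmorphV rmorph_nat subrr.
- apply/eqP; rewrite -subr_eq0; apply/eqP/rnorm_eps => e e0.
  have e8 : 0 < e / 8 by rewrite divr_gt0.
  have [N NP] := uy _ e8.
  have -> : y + y - (h + y ** y) =
      (y - u N.+1) + (y - u N.+1) + (u N ** u N - y ** y).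
    have -> : h = u N.+1 + u N.+1 - u N ** u N.
      by rewrite -mulr2n -scaler_nat /u /= scalerA divff ?pnatr_eq0// scale1r addrK.
    by rewrite !opprD opprK [in RHS](addrACA y) !addrA.
  have uq' := sqrt_iter_lip (uq N) yq.
  rewrite (le_trans (rnormD _ _))// (le_trans (lerD (rnormD _ _) uq'))//.
  have := NP _ (leqnn N); have := NP _ (leqnSn N); rewrite (rdistC y).
  have : 2 * q * ⟦u N - y⟧ <= 2 * ⟦u N - y⟧.
    by rewrite ler_wpM2r ?rnorm_ge0// -[leRHS]mulr1 ler_wpM2l// ltW.
  lra.
- move=> z zh; apply/eqP; rewrite -subr_eq0; apply/eqP.
  apply: (lim0 (fun x => z ** x - x ** z) (⟦z⟧ + ⟦z⟧)) => [x w|n].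
    have -> : z ** x - x ** z - (z ** w - w ** z) =
       (z ** x - z ** w) - (x ** z - w ** z) by rewrite !opprD !opprK addrACA.
    rewrite (le_trans (rnormB _ _))// mulrDl lerD ?amul_lip//.
    exact: amulr_lip.
  elim: n => [|n /eqP]; first by rewrite /u /= amul0 mul0a subr0.
  rewrite subr_eq0 => /eqP IH; rewrite /u /= -/(u n) amulZl amulZr.
  by rewrite amulDl amulDr zh !amulA IH -!amulA IH subrr.
- move=> g gh; apply/eqP; rewrite -subr_eq0; apply/eqP.
  apply: (lim0 (fun x => g ** x - x) (⟦g⟧ + 1)) => [x w|n].
    have -> : g ** x - x - (g ** w - w) = (g ** x - g ** w) - (x - w).
      by rewrite !opprD !opprK addrACA.
    by rewrite (le_trans (rnormB _ _))// mulrDl mul1r lerD ?amul_lip.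
  elim: n => [|n /eqP]; first by rewrite /u /= amul0 subr0.
  rewrite subr_eq0 => /eqP IH; rewrite /u /= -/(u n) amulZr.
  by rewrite amulDr gh amulA IH subrr.
Qed.

End SquareRoot.

Section Contractive.
Context {R : realType}.
Implicit Types A B : cstarAlgType R.

Lemma conj_i : ('i%C : R[i])^* = - 'i%C.
Proof. by apply/eqP; rewrite eq_complex /= oppr0 !eqxx. Qed.

(* [X + iY] and [X - iY] both have square norm |X*X + Y*Y|. *)
Lemma rnorm_sum_squares A (X Y : A) : star X ** Y = star Y ** X ->
  ⟦X⟧ ^+ 2 <= ⟦star X ** X + star Y ** Y⟧.
Proof.
move=> XY; set N := ⟦_ + _⟧.
have sq (j : R[i]) : j^* = - j -> j * j = -1 -> ⟦X + j *: Y⟧ ^+ 2 = N.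
  move=> sj jj; rewrite -rnorm_cstar star_additive starZ sj; congr (⟦_⟧).
  rewrite amulDl !amulDr !amulZl !amulZr scalerA mulNr jj opprK scale1r.
  by rewrite XY scaleNr !addrA addrK.
have ii : ('i%C : R[i]) * 'i%C = -1.
  by apply/eqP; rewrite eq_complex /= !mul0r !mul1r sub0r addr0 oppr0 !eqxx.
have N0 : 0 <= N by exact: rnorm_ge0.
have le (Z : A) : ⟦Z⟧ ^+ 2 = N -> ⟦Z⟧ = Num.sqrt N.
  by move=> <-; rewrite sqrtr_sqr ger0_norm ?rnorm_ge0.
have p := le _ (sq _ conj_i ii).
have m : ⟦X - 'i%C *: Y⟧ = Num.sqrt N.
  rewrite -scaleNr; apply/le/sq; last by rewrite mulrNN.
  by rewrite rmorphN /= conj_i.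
have : ⟦X⟧ <= Num.sqrt N.
  have := rnormD (X + 'i%C *: Y) (X - 'i%C *: Y).
  rewrite p m addrACA subrr addr0 -mulr2n -scaler_nat rnormZ.
  by rewrite -(rmorph_nat (@real_complex R)) normc_real//; lra.
by move=> XN; rewrite -[leRHS](sqr_sqrtr N0) lerXn2r ?nnegrE ?rnorm_ge0 ?sqrtr_ge0.
Qed.

Section StarHom.
Context {A : cstarAlgType R} {B : starAlgType R} {f : A -> B}.
Hypothesis fh : star_hom f.

Lemma star_hom_linear : linear f. Proof. by case: fh. Qed.
Lemma star_homM x y : f (x ** y) = f x ** f y. Proof. by case: fh => _ /(_ x y). Qed.
Lemma star_homV x : f (star x) = star (f x). Proof. by case: fh => _ _ /(_ x). Qed.
End StarHom.

(** In a unital algebra k + i(1 - z) would be a unitary with real part k, since (1 - z)^2 = 1 - k^2.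
    To do without a unit, both parts are multiplied by k: with X = k^2 and Y = (1 - z)k the sum of
    squares is k(k^2 + 1 - k^2)k = k^2, hence the fourth power of the norm of k is at most its
    square. *)
Lemma star_hom_sa_le1 A B (f : A -> B) (h : A) : star_hom f ->
  star h = h -> ⟦h⟧ < 1 -> ⟦f h⟧ <= 1.
Proof.
move=> fh sh h1; have fl := star_hom_linear fh.
have shh : star (h ** h) = h ** h by rewrite starM sh.
have hh1 : ⟦h ** h⟧ < 1 by rewrite rnorm_sa// expr_lt1 ?rnorm_ge0.
have [y [sy yy yh _]] := sqrt_one_sub shh hh1.
have hy : h ** y = y ** h by apply: yh; rewrite amulA.
set k := f h; set z := f y.
have sk : star k = k by rewrite /k -(star_homV fh) sh.
have sz : star z = z by rewrite /z -(star_homV fh) sy.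
have kz : k ** z = z ** k by rewrite -!(star_homM fh) hy.
have zz : z + z = k ** k + z ** z.
  by rewrite -!(star_homM fh) -!(linD fl) yy.
pose Y := k - z ** k.
have kY : star (k ** k) ** Y = star Y ** (k ** k).
  rewrite /Y starB !starM sk sz amulBr amulBl !amulA; congr (_ - _).
  by rewrite -(amulA k k z) [in LHS]kz amulA.
have := rnorm_sum_squares kY.
have -> : star (k ** k) ** (k ** k) + star Y ** Y = k ** k.
  rewrite /Y starB !starM sk sz amulBl !amulBr.
  have -> : k ** z ** (z ** k) = k ** (z ** z) ** k by rewrite !amulA.
  have -> : z ** z = z + z - k ** k by rewrite zz addrC addKr.
  rewrite amulBr amulDr amulBl amulDl !amulA.
  set a := k ** k ** k ** k; set c := k ** z ** k.
  have -> : c - (c + c - a) = a - c.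
    by rewrite opprB addrCA opprD !addrA addrK.
  by rewrite opprB (addrA (_ - c)) (subrK c) (addrC a) (subrK a).
rewrite rnorm_sa// => le1.
have : ⟦k⟧ ^+ 2 <= 1.
  have [->|k0] := eqVneq (⟦k⟧ ^+ 2) 0; first exact: ler01.
  by rewrite -(@ler_pM2l _ (⟦k⟧ ^+ 2)) ?mulr1 -?expr2// lt_neqAle eq_sym k0 sqr_ge0.
by rewrite expr_le1// rnorm_ge0.
Qed.

Lemma star_hom_sa_le A B (f : A -> B) (h : A) : star_hom f ->
  star h = h -> ⟦f h⟧ <= ⟦h⟧.
Proof.
move=> fh sh; apply: le_eps => e e0.
have t0 : 0 < ⟦h⟧ + e by rewrite ltr_wpDl ?rnorm_ge0.
have ti : Normc.normc ((⟦h⟧ + e)^-1%:C%C : R[i]) = (⟦h⟧ + e)^-1.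
  by rewrite normc_real// invr_ge0 ltW.
have := @star_hom_sa_le1 A B f ((⟦h⟧ + e)^-1%:C%C *: h) fh.
rewrite starZ sh (linZ (star_hom_linear fh)) !rnormZ ti => H.
rewrite -(@ler_pM2l _ (⟦h⟧ + e)^-1) ?invr_gt0// mulVf ?gt_eqF//; apply: H.
  by congr (_ *: _); apply/eqP; rewrite eq_complex /= oppr0 !eqxx.
by rewrite -[ltRHS](mulVf (lt0r_neq0 t0)) ltr_pM2l ?invr_gt0// ltrDl.
Qed.

Theorem star_hom_contractive A B (f : A -> B) (a : A) : star_hom f -> ⟦f a⟧ <= ⟦a⟧.
Proof.
move=> fh; rewrite -ler_sqr ?nnegrE ?rnorm_ge0//.
rewrite -!rnorm_cstar -(star_homV fh) -(star_homM fh).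
by apply: star_hom_sa_le => //; rewrite starM starK.
Qed.

End Contractive.

(** * Orthogonality of range projections *)

Section Projections.
Context {R : realType} {A : cstarAlgType R}.
Implicit Types e g h x : A.

(** The symmetry 1 - 2e is unitary, so multiplication by it is isometric, and 1 - e is the average
    of 1 and 1 - 2e. *)
Lemma rnorm_sub_proj e x : projection e -> ⟦x - e ** x⟧ <= ⟦x⟧.
Proof.
move=> [ee se].
have U : ⟦x - 2 *: (e ** x)⟧ = ⟦x⟧.
  apply: rnorm_eq; rewrite starB starZ starM se rmorph_nat amulBl !amulBr.
  rewrite !amulZl !amulZr scalerA.
  have -> : star x ** e ** (e ** x) = star x ** (e ** x).
    by rewrite amulA -(amulA (star x) e) ee amulA.
  by rewrite -!amulA; lmod.
have : x - e ** x = 2^-1 *: (x + (x - 2 *: (e ** x))).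
  by lmod.
move=> ->; rewrite rnormZ.
have -> : Normc.normc (2^-1 : R[i]) = 2^-1.
  by rewrite -(@normc_real _ 2^-1) ?invr_ge0// fmorphV rmorph_nat.
by rewrite ler_pdivrMl// mulr_natl mulr2n (le_trans (rnormD _ _))// U.
Qed.

(* A projection is an extreme point of the unit ball of its corner. With
   [0 < r < 1], the elements [g - r (g - h)] and [g - r (g + h)] are squares of
   commuting self-adjoint elements and add up to [2 (1 - r) g]. *)
Lemma proj_extreme g h : projection g -> star h = h -> g ** h = h ->
  ⟦g + h⟧ <= 1 -> ⟦g - h⟧ <= 1 -> h = 0.
Proof.
move=> pg sh gh gph gmh; have [gg sg] := pg.
have hg : h ** g = h by rewrite -{1}sh -{1}sg -starM gh.
(* The square roots need norms strictly below 1, so everything is scaled by r; letting r tend to 1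
   in this bound forces [h] to vanish. *)
have main (r : R) : 0 < r < 1 -> r * ⟦h⟧ <= 3 * (1 - r).
  move=> /andP[r0 r1]; set rc : R[i] := r%:C%C.
  have crc : rc^* = rc by apply/eqP; rewrite eq_complex /= oppr0 !eqxx.
  have nrc : Normc.normc rc = r by rewrite normc_real// ltW.
  have root k : star k = k -> g ** k = k -> ⟦k⟧ <= 1 ->
      exists y, [/\ star y = y, g ** y = y, y ** g = y,
        y + y = rc *: k + y ** y & forall z, z ** k = k ** z -> z ** y = y ** z].
    move=> sk gk k1; have [||y [sy yy yz yg]] := @sqrt_one_sub R A (rc *: k).
    - by rewrite starZ crc sk.
    - by rewrite rnormZ nrc (le_lt_trans _ r1)// ler_piMr// ltW.
    have gy : g ** y = y by apply: yg; rewrite amulZr gk.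
    exists y; split => //; first by rewrite -{1}sy -{1}sg -starM gy.
    by move=> z zk; apply: yz; rewrite amulZr amulZl zk.
  have [||//|y1 [sy1 gy1 y1g yy1 yz1]] := root (g - h).
  - by rewrite starB sg sh.
  - by rewrite amulBr gg gh.
  have [||//|y2 [sy2 gy2 y2g yy2 yz2]] := root (g + h).
  - by rewrite star_additive sg sh.
  - by rewrite amulDr gg gh.
  have y12 : y1 ** y2 = y2 ** y1.
    apply: yz2; symmetry; apply: yz1.
    by rewrite !(amulBr, amulBl, amulDr, amulDl) gg gh hg; lmod.
  (* In the corner of [g], where [g] is the unit, this is (1 - y)^2 = 1 - r k. *)
  have sq y k : g ** y = y -> y ** g = y -> y + y = rc *: k + y ** y ->
      (g - y) ** (g - y) = g - rc *: k.
    move=> gy yg yy; rewrite amulBl !amulBr gg gy yg.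
    have -> : rc *: k = y + y - y ** y by rewrite yy addrK.
    by lmod.
  have ss := sq _ _ gy1 y1g yy1; have tt := sq _ _ gy2 y2g yy2.
  have XY : star (g - y1) ** (g - y2) = star (g - y2) ** (g - y1).
    by rewrite !starB sg sy1 sy2 !amulBl !amulBr gg gy1 y1g gy2 y2g y12; lmod.
  have := rnorm_sum_squares XY.
  rewrite !starB sg sy1 sy2 ss tt.
  have -> : g - rc *: (g - h) + (g - rc *: (g + h)) = (2 * (1 - rc)) *: g by lmod.
  have n1r : Normc.normc (1 - rc) = 1 - r.
    by rewrite -(normc_real (_ : 0 <= 1 - r)) ?subr_ge0 ?(ltW r1)// rmorphB rmorph1.
  rewrite rnormZ Normc.normcM n1r -(rmorph_nat (@real_complex R)) normc_real//.
  move=> sle; have g1 := rnorm_proj pg.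
  (* The square of g - y1 has norm at most 2(1 - r) by the sum of squares, and the remaining
     multiple of [g] contributes 1 - r; this gives the constant 3. *)
  have : ⟦rc *: h⟧ <= ⟦(g - y1) ** (g - y1)⟧ + ⟦(1 - rc) *: g⟧.
    have -> : rc *: h = (g - y1) ** (g - y1) - (1 - rc) *: g by rewrite ss; lmod.
    exact: rnormB.
  rewrite rnorm_sa ?starB ?sg ?sy1// !rnormZ nrc n1r => /le_trans; apply.
  have : (1 - r) * ⟦g⟧ <= 1 - r by rewrite ler_piMr// subr_ge0 ltW.
  lra.
apply: rnorm0_eq0; rewrite leNgt; apply/negP => h0.
have h3 : 0 < 3 + ⟦h⟧ by lra.
(* A value of r below 1 with r(3 + |h|) = 3 + |h|/2, which exceeds 3 and so contradicts the
   bound. *)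
have := main ((3 + ⟦h⟧ / 2) / (3 + ⟦h⟧)).
rewrite divr_gt0 ?ltr_pdivrMr// ?mul1r; last lra.
rewrite ltrD2l; set r := _ / (3 + _).
have rE : r * (3 + ⟦h⟧) = 3 + ⟦h⟧ / 2 by rewrite /r divfK// gt_eqF.
move=> /(_ _)/wrap[]; first lra.
lra.
Qed.

End Projections.

Section OrthogonalSums.
Context {R : realType} {A : cstarAlgType R}.

(* Compress by [g = e j]: with [b i = g (e i) g], the element [n g + b k]
   (where [n + 1] is the number of summands) equals [g q g] plus [n - 1]
   contractions [g - b i], so [proj_extreme] applies to [b k / n]. *)
Lemma proj_sum_orth (I : eqType) (r : seq I) (e : I -> A) (j k : I) : uniq r ->
  (forall i, projection (e i)) -> projection (\sum_(i <- r) e i) ->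
  j \in r -> k \in r -> j != k -> e k ** e j = 0.
Proof.
move=> ur pe pq jr kr jk; set g := e j; set q := \sum_(i <- r) e i.
have pg : projection g by exact: pe.
have [gg sg] := pg; have g1 := rnorm_proj pg.
pose b i := g ** e i ** g.
have bE i : b i = star (e i ** g) ** (e i ** g).
  by rewrite starM sg (pe i).2 !amulA -(amulA g (e i)) (pe i).1.
have bj : b j = g by rewrite /b -/g gg gg.
have gb i : ⟦g - b i⟧ <= 1.
  have -> : g - b i = g ** (g - e i ** g) by rewrite amulBr gg amulA.
  rewrite (le_trans (rnormM _ _))// (le_trans (ler_wpM2r (rnorm_ge0 _) g1))//.
  by rewrite mul1r (le_trans (rnorm_sub_proj _ (pe i))).
pose F := \sum_(i <- r | (i != k) && (i != j)) (g - b i).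
pose N : nat := (\sum_(i <- r | (i != k) && (i != j)) 1)%N.
have FN : ⟦F⟧ <= N%:R.
  by rewrite (le_trans (rnorm_sum _ _ _))// natr_sum ler_sum.
have sumE (V : nmodType) (H : I -> V) : \sum_(i <- r) H i =
    H k + (H j + \sum_(i <- r | (i != k) && (i != j)) H i).
  by rewrite (bigD1_seq k)//= -big_filter (bigD1_seq j) ?filter_uniq ?mem_filter
    ?jk ?jr//= big_filter_cond.
have qE : g ** q ** g = b k + (g + (N%:R *: g - F)).
  rewrite /q amul_sumr amul_suml (sumE A b) bj; congr (_ + (_ + _)).
  by rewrite /F sumrB scaler_nat -sumrMnr opprB addrC subrK.
(* With this scaling, g + c b_k and g - c b_k are both averages of N + 1 elements of norm at most
   1. *)
set c : R := N.+1%:R^-1.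
have c0 : 0 <= c by rewrite invr_ge0.
have cN : c * N%:R + c = 1.
  by rewrite -{2}[c]mulr1 -mulrDr natr1 mulVf// pnatr_eq0.
have cN' : c * (N%:R + 1) = 1 by rewrite mulrDr mulr1.
have cNC : c%:C%C * N%:R + c%:C%C = 1 :> R[i].
  by rewrite -(rmorph_nat (@real_complex R)) -rmorphM -rmorphD cN.
have gE : g = (c%:C%C * N%:R + c%:C%C) *: g by rewrite cNC scale1r.
have cc : (c%:C%C : R[i])^* = c%:C%C by apply/eqP; rewrite eq_complex /= oppr0 !eqxx.
have sb : star (b k) = b k by rewrite /b !starM sg (pe k).2 amulA.
have : c%:C%C *: b k = 0.
  apply: (proj_extreme pg).
  - by rewrite starZ cc sb.
  - by rewrite amulZr /b !amulA gg.
  - have -> : g + c%:C%C *: b k = c%:C%C *: (g ** q ** g + F).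
      by rewrite {1}gE qE; lmod.
    rewrite rnormZ normc_real// -cN' ler_wpM2l//.
    rewrite addrC (le_trans (rnormD _ _))// lerD//.
    have q1 := rnorm_proj pq; rewrite (le_trans (rnormM _ _))//.
    rewrite -[leRHS]mulr1 ler_pM ?rnorm_ge0// (le_trans (rnormM _ _))//.
    by rewrite -[leRHS]mulr1 ler_pM ?rnorm_ge0.
  - have -> : g - c%:C%C *: b k = c%:C%C *: (N%:R *: g + (g - b k)).
      by rewrite {1}gE; lmod.
    rewrite rnormZ normc_real// -cN' ler_wpM2l//.
    rewrite (le_trans (rnormD _ _))// lerD// rnormZ.
    by rewrite -(rmorph_nat (@real_complex R)) normc_real// ler_piMr.
move=> /eqP; rewrite scaler_eq0 => /orP[|/eqP bk].
  by move=> /eqP/complexI/eqP; rewrite invr_eq0 pnatr_eq0.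
apply: rnorm0_eq0; rewrite le_eqVlt -sqrf_eq0.
by rewrite -rnorm_cstar -bE bk rnorm0 eqxx.
Qed.

End OrthogonalSums.

(** * Relations that follow from the Cuntz-Krieger relations *)

Section CuntzKrieger.
Context {R : realType} {E : digraph} {A : cstarAlgType R}.
Context {t : edge E -> A} {q : vertex E -> A}.
Hypothesis Ef : row_finite E.
Hypothesis ck : ck_family t q.

Lemma ck_range_proj f : projection (t f ** star (t f)).
Proof.
split; last by rewrite starM starK.
by rewrite amulA (ck_pisom ck f).
Qed.

Lemma ck_seqE v : ~ sink v ->
  q v = \sum_(f <- fset_set [set f | src f = v]) (t f ** star (t f)).
Proof. by move=> /(ck_src ck) ->; rewrite fsbig_finite. Qed.

(** The definition of a family does not ask for this. Row-finiteness makes the relation at [src f] a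
    genuine finite sum of projections whose value is a projection, and such summands are mutually
    orthogonal. *)
Lemma ck_range_orth f f' : f != f' -> src f = src f' ->
  t f ** star (t f) ** (t f' ** star (t f')) = 0.
Proof.
move=> ff' sff'.
have ns : ~ sink (src f) by move=> /(_ f).
have mem g : src g = src f -> g \in fset_set [set g | src g = src f].
  by move=> gf; rewrite in_fset_set// inE.
apply: (@proj_sum_orth _ _ _ (fset_set [set g | src g = src f])
  (fun g => t g ** star (t g)) f' f).
- exact: fset_uniq.
- exact: ck_range_proj.
- by rewrite -(ck_seqE ns); exact: (ck_proj ck).
- exact: mem.
- exact: mem.
- by rewrite eq_sym.
Qed.

Lemma ck_srcM f : q (src f) ** t f = t f.
Proof.
have ns : ~ sink (src f) by move=> /(_ f).
rewrite (ck_seqE ns) (bigD1_seq f) ?fset_uniq//=; last by rewrite in_fset_set// inE.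
rewrite amulDl (ck_pisom ck f) amul_suml big_seq_cond big1 ?addr0// => g.
move=> /andP[+ gf]; rewrite in_fset_set// inE /= => sgf.
by rewrite -(ck_pisom ck f) amulA ck_range_orth ?mul0a.
Qed.

Lemma ck_rngM f : t f ** q (rng f) = t f.
Proof. by rewrite -(ck_rng ck) amulA (ck_pisom ck f). Qed.

Lemma ck_srcM0 v f : v <> src f -> q v ** t f = 0.
Proof. by move=> vf; rewrite -(ck_srcM f) amulA (ck_orth ck vf) mul0a. Qed.

Lemma ck_rngM0 v f : v <> rng f -> t f ** q v = 0.
Proof.
move=> vf; rewrite -(ck_rngM f) -amulA (ck_orth ck) ?amul0//.
exact: nesym.
Qed.

Lemma ck_starM_eq0 f f' : f <> f' -> star (t f) ** t f' = 0.
Proof.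
move=> ff'; have [sff'|sff'] := eqVneq (src f) (src f').
  have sE : star (t f) = star (t f) ** (t f ** star (t f)).
    by rewrite -{1}(ck_pisom ck f) !starM starK.
  rewrite sE -(ck_pisom ck f') -amulA (amulA (t f ** _)) ck_range_orth//.
    by rewrite mul0a amul0.
  exact/eqP.
rewrite -(ck_srcM f) -(ck_srcM f') starM (ck_proj ck _).2 -!amulA (amulA (q _)).
by rewrite (ck_orth ck) ?mul0a ?amul0//; exact/eqP.
Qed.

End CuntzKrieger.

(** * Adjointable operators and the C*-algebra M(A) *)

Section AdjointableOperators.
Context {R : realType}.

(* Covers both a Hilbert space (Z = C) and a C*-algebra acting on itself by
   left multiplication ([ip x y = x^* y]). *)
Record pairing (V : completeNormedModType R[i]) (Z : normedModType R[i]) := Pairing {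
  pip : V -> V -> Z;
  ip_flip : Z -> Z;
  ip_flipE : forall x y, ip_flip (pip x y) = pip y x;
  ip_linear : forall x, linear (pip x);
  ip_semilinear : forall (k : R[i]) x y z,
    pip (k *: x + y) z = k^* *: pip x z + pip y z;
  ip_le : forall x y, ⟦pip x y⟧ <= ⟦x⟧ * ⟦y⟧;
  ip_norm : forall x, ⟦pip x x⟧ = ⟦x⟧ ^+ 2
}.

Context {V : completeNormedModType R[i]} {Z : normedModType R[i]}.
Variable P : pairing V Z.
Local Notation ip := (pip P).

Lemma ip_inj x y : (forall z, ip z x = ip z y) -> x = y.
Proof.
move=> xy; apply/eqP; rewrite -subr_eq0; apply/eqP/rnorm0_eq0.
rewrite le_eqVlt -sqrf_eq0 -(ip_norm P) (linB (ip_linear P _)) xy.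
by rewrite subrr rnorm0 eqxx.
Qed.

Lemma ip_sym (f g : V -> V) : (forall x y, ip (f x) y = ip x (g y)) ->
  forall x y, ip (g x) y = ip x (f y).
Proof. by move=> fg x y; rewrite -(ip_flipE P) -fg (ip_flipE P). Qed.

Lemma ip_adj_linear (f g : V -> V) : (forall x y, ip (f x) y = ip x (g y)) ->
  linear f.
Proof.
move=> /ip_sym gf k x y; apply: ip_inj => z.
by rewrite -gf (ip_linear P) !gf -(ip_linear P).
Qed.

Lemma ip_adj_bounded (f g : V -> V) (M : R) :
  (forall x y, ip (f x) y = ip x (g y)) -> 0 <= M ->
  (forall x, ⟦f x⟧ <= M * ⟦x⟧) -> forall x, ⟦g x⟧ <= M * ⟦x⟧.
Proof.
move=> fg M0 fM x; have [gx0|gx0] := leP ⟦g x⟧ 0.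
  by rewrite (le_trans gx0)// mulr_ge0// rnorm_ge0.
rewrite -(ler_pM2l gx0) -expr2 -(ip_norm P) -fg (le_trans (ip_le P _ _))//.
by rewrite mulrCA mulrA ler_wpM2r// rnorm_ge0.
Qed.

Lemma ip_adj_dense (I : Type) (g : I -> V) (T T' : V -> V) (C C' : R) :
  (forall x, approx (span g) x) -> linear T -> linear T' ->
  (forall x, ⟦T x⟧ <= C * ⟦x⟧) -> (forall x, ⟦T' x⟧ <= C' * ⟦x⟧) ->
  (forall i j, ip (T (g i)) (g j) = ip (g i) (T' (g j))) ->
  forall x y, ip (T x) y = ip x (T' y).
Proof.
move=> gd Tl T'l TC T'C TT'.
have step i y : ip (T (g i)) y = ip (g i) (T' y).
  apply: (dense_linear_eq gd (F := ip (T (g i))) (G := fun y => ip (g i) (T' y))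
    (C := ⟦T (g i)⟧) (D := ⟦g i⟧ * C')) => // [|k u v|w|w].
  - exact: ip_linear.
  - by rewrite T'l (ip_linear P).
  - exact: ip_le.
  - by rewrite (le_trans (ip_le P _ _))// -mulrA ler_wpM2l ?rnorm_ge0.
move=> x y; rewrite -[LHS](ip_flipE P) -[RHS](ip_flipE P); congr ip_flip.
apply: (dense_linear_eq gd (F := fun x => ip y (T x)) (G := ip (T' y))
  (C := ⟦y⟧ * C) (D := ⟦T' y⟧)) => [k u v||w|w|i].
- by rewrite Tl (ip_linear P).
- exact: ip_linear.
- by rewrite (le_trans (ip_le P _ _))// -mulrA ler_wpM2l ?rnorm_ge0.
- exact: ip_le.
- by rewrite -(ip_flipE P) step (ip_flipE P).
Qed.

Definition adjointable : {pred V -> V} := fun f =>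
  `[< (exists g, forall x y, ip (f x) y = ip x (g y)) /\
      (exists2 M, 0 <= M & forall x, ⟦f x⟧ <= M * ⟦x⟧) >].

Lemma adjointable_submod : submod_closed adjointable.
Proof.
split.
  rewrite unfold_in; apply/asboolP; split; last first.
    by exists 0 => // x; rewrite mul0r [X in ⟦X⟧](_ : _ = 0)// rnorm0.
  exists 0 => x y; rewrite (lin0 (ip_linear P _)).
  rewrite [(0 : V -> V) x](_ : _ = 0)//; apply: (addrI (ip 0 y)); rewrite addr0.
  by have := ip_semilinear P 1 0 0 y; rewrite rmorph1 !scale1r addr0.
move=> k f g; rewrite !unfold_in => /asboolP[[f' ff'] [M M0 fM]].
move=> /asboolP[[g' gg'] [N N0 gN]]; apply/asboolP; split.
  exists (fun x => k^* *: f' x + g' x) => x y.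
  rewrite -[(k *: f + g) x]/(k *: f x + g x) (ip_semilinear P) ff' gg'.
  by rewrite (ip_linear P).
exists (Normc.normc k * M + N).
  by rewrite addr_ge0// mulr_ge0// normc_ge0.
move=> x; rewrite -[(k *: f + g) x]/(k *: f x + g x) (le_trans (rnormD _ _))//.
by rewrite mulrDl lerD// rnormZ -mulrA ler_wpM2l// normc_ge0.
Qed.

Record adjop := AdjOp { opval :> V -> V; _ : opval \in adjointable }.

HB.instance Definition _ := [isSub for opval].
HB.instance Definition _ := [Choice of adjop by <:].
HB.instance Definition _ :=
  GRing.isSubmodClosed.Build R[i] _ adjointable adjointable_submod.
HB.instance Definition _ := [SubChoice_isSubLmodule of adjop by <:].

Implicit Types f g h : adjop.

Lemma adjopP f : (exists g : V -> V, forall x y, ip (f x) y = ip x (g y)) /\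
  (exists2 M, 0 <= M & forall x, ⟦f x⟧ <= M * ⟦x⟧).
Proof. by have /asboolP := valP f. Qed.

Lemma adjop_eq f g : f =1 g -> f = g.
Proof. by move=> fg; apply: val_inj; apply/funext. Qed.

Lemma adjop_combE k f g x : (k *: f + g) x = k *: f x + g x.
Proof. by []. Qed.

Lemma adjop_linear f : linear f.
Proof. by have [[g fg] _] := adjopP f; exact: ip_adj_linear fg. Qed.

Definition opnorm f : R := sup [set r | exists2 x, ⟦x⟧ <= 1 & r = ⟦f x⟧].

Lemma opnorm_has_sup f : has_sup [set r | exists2 x, ⟦x⟧ <= 1 & r = ⟦f x⟧].
Proof.
split; first by exists ⟦f 0⟧; exists 0 => //; rewrite rnorm0 ler01.
have [_ [M M0 fM]] := adjopP f; exists M => _ [x x1 ->].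
by rewrite (le_trans (fM _))// ler_piMr.
Qed.

Lemma opnorm_ge0 f : 0 <= opnorm f.
Proof.
rewrite (le_trans (rnorm_ge0 (f 0)))//; apply: sup_ubound.
  by case: (opnorm_has_sup f).
by exists 0 => //; rewrite rnorm0 ler01.
Qed.

Lemma le_opnorm f x : ⟦f x⟧ <= opnorm f * ⟦x⟧.
Proof.
have [x0|x0] := leP ⟦x⟧ 0.
  by rewrite (rnorm0_eq0 x0) (lin0 (adjop_linear f)) !rnorm0 mulr0.
have nx : Normc.normc (⟦x⟧^-1%:C%C : R[i]) = ⟦x⟧^-1.
  by rewrite normc_real// invr_ge0 ltW.
rewrite mulrC -ler_pdivrMl// -nx -rnormZ -(linZ (adjop_linear f)).
apply: sup_ubound; first by case: (opnorm_has_sup f).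
by exists (⟦x⟧^-1%:C%C *: x) => //; rewrite rnormZ nx mulVf// gt_eqF.
Qed.

Lemma opnorm_le f M : 0 <= M -> (forall x, ⟦f x⟧ <= M * ⟦x⟧) -> opnorm f <= M.
Proof.
move=> M0 fM; apply: ge_sup; first by case: (opnorm_has_sup f).
by move=> _ [x x1 ->]; rewrite (le_trans (fM _))// ler_piMr.
Qed.

Lemma opnormD f g : (opnorm (f + g))%:C%C <= (opnorm f)%:C%C + (opnorm g)%:C%C :> R[i].
Proof.
rewrite -rmorphD lecR opnorm_le ?addr_ge0 ?opnorm_ge0// => x.
rewrite -[(f + g) x]/(f x + g x) mulrDl (le_trans (rnormD _ _))//.
by rewrite lerD// le_opnorm.
Qed.

Lemma opnormZ k f : (opnorm (k *: f))%:C%C = `|k| * (opnorm f)%:C%C :> R[i].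
Proof.
have le l g : opnorm (l *: g) <= Normc.normc l * opnorm g.
  rewrite opnorm_le ?mulr_ge0 ?normc_ge0 ?opnorm_ge0// => x.
  rewrite -[(l *: g) x]/(l *: g x) rnormZ -mulrA ler_wpM2l ?normc_ge0//.
  exact: le_opnorm.
rewrite Defs.normcE -rmorphM; congr (_%:C%C).
apply/eqP; rewrite eq_le le /=.
have [->|k0] := eqVneq k 0; first by rewrite Normc.normc0 mul0r opnorm_ge0.
have nk0 : 0 < Normc.normc k.
  rewrite lt_neqAle normc_ge0 andbT eq_sym; apply: contra k0 => /eqP.
  by move=> /Normc.eq0_normc ->.
rewrite mulrC -ler_pdivlMr// -Normc.normcV mulrC.
by rewrite (le_trans _ (le _ _))// scalerA mulVf// scale1r.
Qed.

Lemma opnorm0_eq0 f : (opnorm f)%:C%C = 0 :> R[i] -> f = 0.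
Proof.
move=> [f0]; apply: adjop_eq => x; apply: rnorm0_eq0.
by rewrite (le_trans (le_opnorm _ _))// f0 mul0r.
Qed.

HB.instance Definition _ := Lmodule_isNormed.Build R[i] adjop
  opnormD opnormZ opnorm0_eq0.

Lemma adjop_normE f : ⟦f⟧ = opnorm f.
Proof. by []. Qed.

Lemma adjop_le f x : ⟦f x⟧ <= ⟦f⟧ * ⟦x⟧.
Proof. exact: le_opnorm. Qed.

(** Taking adjoints does not increase the bound of a difference, so the adjoints converge along with
    the operators, and their limit is an adjoint of the limit. *)
Lemma adjop_complete_seq (u : nat -> adjop) : rcauchy u -> exists l, tends u l.
Proof.
move=> uc.
pose v n : V -> V := projT1 (cid (proj1 (adjopP (u n)))).
have uv n x y : ip (u n x) y = ip x (v n y) by rewrite /v; case: cid.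
have ud m n x : ⟦u m x - u n x⟧ <= ⟦u m - u n⟧ * ⟦x⟧ by exact: (adjop_le (u m - u n)).
have ipBl (x y z : V) : ip (x - y) z = ip x z - ip y z.
  by rewrite addrC -scaleN1r (ip_semilinear P) rmorphN rmorph1 scaleN1r addrC.
have vd m n x : ⟦v m x - v n x⟧ <= ⟦u m - u n⟧ * ⟦x⟧.
  apply: (@ip_adj_bounded (u m - u n) (fun x => v m x - v n x)).
  - move=> y z; rewrite -[(u m - u n) y]/(u m y - u n y) ipBl !uv.
    by rewrite (linB (ip_linear P _)).
  - exact: rnorm_ge0.
  - exact: adjop_le.
have lim (w : nat -> V -> V) : (forall m n x, ⟦w m x - w n x⟧ <= ⟦u m - u n⟧ * ⟦x⟧) ->
    exists l : V -> V, forall e, 0 < e -> exists N, forall n, (N <= n)%N ->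
      forall x, ⟦w n x - l x⟧ <= e * ⟦x⟧.
  move=> wd; have /choice[l lP] x : exists l, tends (w ^~ x) l.
    apply: complete_tends => e e0; have x1 : 0 < ⟦x⟧ + 1.
      by rewrite ltr_wpDl// rnorm_ge0.
    have [N NP] := uc _ (divr_gt0 e0 x1); exists N => m n Nm Nn.
    rewrite (le_lt_trans (wd _ _ _))//.
    rewrite (@le_lt_trans _ _ (⟦u m - u n⟧ * (⟦x⟧ + 1)))//.
      by rewrite ler_wpM2l ?rnorm_ge0// lerDl.
    by rewrite -ltr_pdivlMr//; exact: NP.
  exists l => e e0; have [N NP] := uc _ e0; exists N => n Nn x.
  apply: le_eps => d d0; have [N' N'P] := lP x _ d0; pose K := maxn N N'.
  rewrite (le_trans (rdist_triangle (w K x) _ _))// lerD//; last first.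
    by rewrite ltW// N'P// leq_maxr.
  rewrite (le_trans (wd _ _ _))// ler_wpM2r ?rnorm_ge0// ltW// NP//.
  exact: leq_maxl.
have [l lP] := lim (fun n => u n) ud; have [l' l'P] := lim v vd.
have ll' x y : ip (l x) y = ip x (l' y).
  apply/eqP; rewrite -subr_eq0; apply/eqP/rnorm_eps => e e0.
  pose d := ⟦x⟧ * ⟦y⟧ + 1.
  have d0 : 0 < d by rewrite ltr_wpDl// mulr_ge0// rnorm_ge0.
  have e2 : 0 < e / d / 2 by rewrite !divr_gt0.
  have [N NP] := lP _ e2; have [N' N'P] := l'P _ e2; pose K := maxn N N'.
  have -> : ip (l x) y - ip x (l' y) = ip x (v K y - l' y) - ip (u K x - l x) y.
    by rewrite (linB (ip_linear P _)) ipBl uv; lmod.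
  rewrite (le_trans (rnormB _ _))// (le_trans (lerD (ip_le P _ _) (ip_le P _ _)))//.
  have := ler_wpM2l (rnorm_ge0 x) (N'P K (leq_maxr _ _) y).
  have := ler_wpM2r (rnorm_ge0 y) (NP K (leq_maxl _ _) x).
  have : e / d / 2 * ⟦x⟧ * ⟦y⟧ <= e / 2.
    rewrite -mulrA mulrAC ler_pM2r// -mulrA ler_piMr ?(ltW e0)// mulrC.
    by rewrite ler_pdivrMr// mul1r /d lerDl.
  have -> : ⟦x⟧ * (e / d / 2 * ⟦y⟧) = e / d / 2 * ⟦x⟧ * ⟦y⟧ by ring.
  lra.
have lA : l \in adjointable.
  rewrite unfold_in; apply/asboolP; split; first by exists l'.
  have [N NP] := lP 1 ltr01; exists (⟦u N⟧ + 1).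
    by rewrite addr_ge0// rnorm_ge0.
  move=> x; have := NP N (leqnn N) x; rewrite rdistC.
  have := rnormBB (l x) (u N x); have := adjop_le (u N) x; rewrite mulrDl; lra.
exists (AdjOp lA) => e e0.
have e2 : 0 < e / 2 by rewrite divr_gt0.
have [N NP] := lP _ e2; exists N => n Nn; rewrite (@le_lt_trans _ _ (e / 2))//.
  by rewrite adjop_normE; apply: opnorm_le; [exact: ltW|exact: NP].
by rewrite ltr_pdivrMr// mulr_natr mulr2n ltrDl.
Qed.

HB.instance Definition _ := Uniform_isComplete.Build adjop
  (complete_filter adjop_complete_seq).

Lemma adjop_comp_subproof f g : (f \o g) \in adjointable.
Proof.
have [[f' ff'] [M M0 fM]] := adjopP f; have [[g' gg'] [N N0 gN]] := adjopP g.
rewrite unfold_in; apply/asboolP; split.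
  by exists (g' \o f') => x y /=; rewrite ff' gg'.
exists (M * N); first exact: mulr_ge0.
by move=> x /=; rewrite (le_trans (fM _))// -mulrA ler_wpM2l.
Qed.

Definition adjop_comp f g : adjop := AdjOp (adjop_comp_subproof f g).

Lemma adjop_adj_subproof f : projT1 (cid (proj1 (adjopP f))) \in adjointable.
Proof.
case: cid => g /= fg; rewrite unfold_in; apply/asboolP; split.
  by exists f; exact: ip_sym.
exists ⟦f⟧; first exact: rnorm_ge0.
by apply: (ip_adj_bounded fg); [exact: rnorm_ge0|exact: adjop_le].
Qed.

Definition adjop_adj f : adjop := AdjOp (adjop_adj_subproof f).

Lemma adjop_adjE f x y : ip (f x) y = ip x (adjop_adj f y).
Proof. by rewrite /adjop_adj /=; case: cid. Qed.

Lemma adjop_adj_uniq f (g : V -> V) :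
  (forall x y, ip (f x) y = ip x (g y)) -> adjop_adj f =1 g.
Proof. by move=> fg x; apply: ip_inj => y; rewrite -adjop_adjE. Qed.

Lemma adjop_compA : associative adjop_comp.
Proof. by move=> f g h; exact: adjop_eq. Qed.

Lemma adjop_comp_linearl g k f h :
  adjop_comp (k *: f + h) g = k *: adjop_comp f g + adjop_comp h g.
Proof. exact: adjop_eq. Qed.

Lemma adjop_comp_linearr g k f h :
  adjop_comp g (k *: f + h) = k *: adjop_comp g f + adjop_comp g h.
Proof. by apply: adjop_eq => x; exact: adjop_linear. Qed.

Lemma adjop_adj_semilinear k f g :
  adjop_adj (k *: f + g) = k^* *: adjop_adj f + adjop_adj g.
Proof.
apply/adjop_eq/adjop_adj_uniq => x y.
by rewrite adjop_combE (ip_semilinear P) !adjop_adjE -(ip_linear P).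
Qed.

Lemma adjop_adjK : involutive adjop_adj.
Proof.
move=> f; apply/adjop_eq/adjop_adj_uniq; apply: ip_sym => x y.
exact: adjop_adjE.
Qed.

Lemma adjop_adjM f g :
  adjop_adj (adjop_comp f g) = adjop_comp (adjop_adj g) (adjop_adj f).
Proof. by apply/adjop_eq/adjop_adj_uniq => x y; rewrite /= !adjop_adjE. Qed.

HB.instance Definition _ := Lmodule_isStarAlg.Build R adjop
  adjop_compA adjop_comp_linearl adjop_comp_linearr adjop_adj_semilinear
  adjop_adjK adjop_adjM.

Lemma adjop_norm_comp f g : `|f ** g| <= `|f| * `|g|.
Proof.
rewrite !rnormE -rmorphM lecR adjop_normE.
apply: opnorm_le => [|x]; first by rewrite mulr_ge0// rnorm_ge0.
rewrite (le_trans (adjop_le f _))// -mulrA ler_wpM2l ?rnorm_ge0//.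
exact: adjop_le.
Qed.

Lemma adjop_cstar f : `|star f ** f| = `|f| ^+ 2.
Proof.
have le_sq g : ⟦g⟧ ^+ 2 <= ⟦star g ** g⟧.
  set N := ⟦star g ** g⟧; have N0 : 0 <= N by exact: rnorm_ge0.
  rewrite -[leRHS](sqr_sqrtr N0) lerXn2r ?nnegrE ?rnorm_ge0 ?sqrtr_ge0//.
  rewrite adjop_normE; apply: opnorm_le => [|x]; first exact: sqrtr_ge0.
  rewrite -(@ler_sqr _ ⟦g x⟧) ?nnegrE ?mulr_ge0 ?rnorm_ge0 ?sqrtr_ge0//.
  rewrite exprMn sqr_sqrtr// -(ip_norm P) adjop_adjE (le_trans (ip_le P _ _))//.
  by rewrite mulrC expr2 mulrA ler_wpM2r ?rnorm_ge0//; exact: (adjop_le (star g ** g)).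
have leM (g h : adjop) : ⟦g ** h⟧ <= ⟦g⟧ * ⟦h⟧.
  by rewrite rnorm_leC rmorphM /= -!rnormE adjop_norm_comp.
have le_adj g : ⟦star g⟧ <= ⟦g⟧.
  apply: opnorm_le => [|x]; first exact: rnorm_ge0.
  apply: (ip_adj_bounded (adjop_adjE g)); first exact: rnorm_ge0.
  exact: adjop_le.
rewrite !rnormE -rmorphXn; congr (_%:C%C); apply/eqP; rewrite eq_le le_sq andbT.
by rewrite (le_trans (leM _ _))// expr2 ler_wpM2r// rnorm_ge0.
Qed.

HB.instance Definition _ :=
  NormedStarAlg_isCStarAlg.Build R adjop adjop_norm_comp adjop_cstar.

End AdjointableOperators.

(** * M(A) as the adjointable operators on A *)

Section MultiplierNorm.
Context {R : realType} {A : cstarAlgType R}.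

Lemma cstar_ip_semilinear (k : R[i]) (x y z : A) :
  star (k *: x + y) ** z = k^* *: (star x ** z) + star y ** z.
Proof. by rewrite star_semilinear amul_linearl. Qed.

Lemma cstar_ip_le (x y : A) : ⟦star x ** y⟧ <= ⟦x⟧ * ⟦y⟧.
Proof. by rewrite (le_trans (rnormM _ _))// rnorm_star. Qed.

Lemma cstar_ip_flip (x y : A) : star (star x ** y) = star y ** x.
Proof. by rewrite starM starK. Qed.

Definition cstar_pairing : pairing A A := Pairing
  (cstar_ip_flip) (fun x => amull_linear (star x)) cstar_ip_semilinear
  cstar_ip_le (@rnorm_cstar R A).

Implicit Types m n : multiplier A.

Lemma lact_adj m x y : star (lact m x) ** y = star x ** lact (star m) y.
Proof.
have [_ _ _ _ m3] := multP m.
by rewrite -[lact (star m) y]/(star (ract m (star y))) -starM m3 starM starK.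
Qed.

Lemma bounded_opE (f : A -> A) : bounded_op f <->
  exists2 M : R, 0 <= M & forall x, ⟦f x⟧ <= M * ⟦x⟧.
Proof.
split=> [[M M0 fM]|[M M0 fM]].
  have ME : M = (complex.Re M)%:C%C by rewrite RRe_real// ger0_real.
  exists (complex.Re M); first by rewrite -lecR -ME.
  by move=> x; rewrite rnorm_leC rmorphM /= -ME -rnormE.
exists M%:C%C; first by rewrite lecR.
by move=> x; rewrite !rnormE -rmorphM lecR.
Qed.

Lemma lact_adjointable m : lact m \in adjointable cstar_pairing.
Proof.
rewrite unfold_in; apply/asboolP; split.
  by exists (lact (star m)) => x y; exact: lact_adj.
by have [_ [bl _] _ _ _] := multP m; apply/bounded_opE.
Qed.

Definition adjop_of_mult m : adjop cstar_pairing := AdjOp (lact_adjointable m).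

(** An adjoint pair is automatically linear over right multiplication: pairing f(ab) with c gives
    the pairing of ab with g(c), from which b can be pulled out. The right action is forced to be
    the conjugate of [g] by the involution. *)
Lemma adj_pair_centralizer (f g : A -> A) (M : R) :
  (forall x y, star (f x) ** y = star x ** g y) -> 0 <= M ->
  (forall x, ⟦f x⟧ <= M * ⟦x⟧) ->
  (f, fun b => star (g (star b))) \in @double_centralizer R A.
Proof.
move=> fg M0 fM.
have gf x y : star (g x) ** y = star x ** f y.
  exact: (ip_sym (P := cstar_pairing) fg).
have lf : linear f := ip_adj_linear (P := cstar_pairing) fg.
have lg k x y : g (k *: x + y) = k *: g x + g y.
  exact: (ip_adj_linear (P := cstar_pairing) gf).
have gM := ip_adj_bounded (P := cstar_pairing) fg M0 fM.
rewrite unfold_in; apply/asboolP; split => /=.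
- by split=> // k x y; rewrite star_semilinear lg star_semilinear conjCK.
- split; apply/bounded_opE; exists M => // x.
  by rewrite rnorm_star (le_trans (gM _))// rnorm_star.
- move=> a b; apply: (ip_inj (P := cstar_pairing)) => c /=.
  by rewrite -gf amulA gf amulA.
- move=> a b; rewrite -[a in RHS]starK -starM; congr star.
  apply: (ip_inj (P := cstar_pairing)) => c /=.
  by rewrite starM -fg amulA fg amulA.
- by move=> a b; rewrite gf starK.
Qed.

Lemma adj_mult_subproof (f : adjop cstar_pairing) :
  (f : A -> A, fun b => star (star f (star b))) \in @double_centralizer R A.
Proof.
apply: (adj_pair_centralizer (M := ⟦f⟧)); last exact: adjop_le.
- exact: (adjop_adjE f).
- exact: rnorm_ge0.
Qed.

Definition mult_of_adjop f : multiplier A := Multiplier (adj_mult_subproof f).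

(** The right action is determined by the left one through [ract m a ** b = a ** lact m b]. *)
Lemma multiplier_eq m n : lact m =1 lact n -> m = n.
Proof.
move=> mn; apply: mult_eq => // x; apply/eqP; rewrite -subr_eq0; apply/eqP.
apply: amul_eq0 => y; have [_ _ _ _ m3] := multP m; have [_ _ _ _ n3] := multP n.
by rewrite amulBl m3 n3 mn subrr.
Qed.

Lemma adjop_of_multK : cancel adjop_of_mult mult_of_adjop.
Proof. by move=> m; exact: multiplier_eq. Qed.

Lemma mult_of_adjopK : cancel mult_of_adjop adjop_of_mult.
Proof. by move=> m; exact: adjop_eq. Qed.

Lemma adjop_of_mult_lin k m n :
  adjop_of_mult (k *: m + n) = k *: adjop_of_mult m + adjop_of_mult n.
Proof. exact: adjop_eq. Qed.

Lemma adjop_of_mult_star m : adjop_of_mult (star m) = star (adjop_of_mult m).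
Proof.
by apply: adjop_eq => x; symmetry; apply: adjop_adj_uniq => {}x y; exact: lact_adj.
Qed.

Let N m : R[i] := `|adjop_of_mult m|.

Lemma multiplier_normD m n : N (m + n) <= N m + N n.
Proof.
by rewrite /N (le_trans _ (ler_normD _ _)).
Qed.

Lemma adjop_of_mult_linear : linear adjop_of_mult.
Proof. by move=> k m n; exact: adjop_of_mult_lin. Qed.

Lemma multiplier_normZ k m : N (k *: m) = `|k| * N m.
Proof. by rewrite /N (linZ adjop_of_mult_linear) normrZ. Qed.

Lemma multiplier_norm0_eq0 m : N m = 0 -> m = 0.
Proof.
move=> /eqP; rewrite normr_eq0 => /eqP m0; apply: (can_inj adjop_of_multK).
by rewrite m0 (lin0 adjop_of_mult_linear).
Qed.

HB.instance Definition _ := Lmodule_isNormed.Build R[i] (multiplier A)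
  multiplier_normD multiplier_normZ multiplier_norm0_eq0.

Lemma multiplier_normE m : ⟦m⟧ = ⟦adjop_of_mult m⟧.
Proof. by []. Qed.

Lemma multiplier_complete_seq (u : nat -> multiplier A) :
  rcauchy u -> exists l, tends u l.
Proof.
move=> uc; have [l ul] : exists l, tends (adjop_of_mult \o u) l.
  apply: complete_tends => e /uc[K KP]; exists K => m n Km Kn /=.
  by rewrite -(linB adjop_of_mult_linear); exact: KP.
exists (mult_of_adjop l) => e /ul[K KP]; exists K => n /KP /=.
by rewrite multiplier_normE (linB adjop_of_mult_linear) mult_of_adjopK.
Qed.

HB.instance Definition _ := Uniform_isComplete.Build (multiplier A)
  (complete_filter multiplier_complete_seq).

Lemma adjop_of_multM m n :
  adjop_of_mult (m ** n) = adjop_of_mult m ** adjop_of_mult n.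
Proof. exact: adjop_eq. Qed.

Lemma multiplier_normM m n : `|m ** n| <= `|m| * `|n|.
Proof.
have -> : `|m ** n| = `|adjop_of_mult (m ** n)| by [].
by rewrite adjop_of_multM; exact: amul_norm_le.
Qed.

Lemma multiplier_cstar m : `|star m ** m| = `|m| ^+ 2.
Proof.
have -> : `|star m ** m| = `|adjop_of_mult (star m ** m)| by [].
by rewrite adjop_of_multM adjop_of_mult_star; exact: cstar_identity.
Qed.

HB.instance Definition _ := NormedStarAlg_isCStarAlg.Build R (multiplier A)
  multiplier_normM multiplier_cstar.

Lemma lact_le m x : ⟦lact m x⟧ <= ⟦m⟧ * ⟦x⟧.
Proof. exact: (adjop_le (adjop_of_mult m)). Qed.

Lemma mult_norm_le m (M : R) : 0 <= M -> (forall x, ⟦lact m x⟧ <= M * ⟦x⟧) -> ⟦m⟧ <= M.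
Proof. by move=> M0 mM; rewrite multiplier_normE adjop_normE; exact: opnorm_le. Qed.

Lemma lact_linear m : linear (lact m).
Proof. exact: (adjop_linear (adjop_of_mult m)). Qed.

Lemma lactM m n x : lact (m ** n) x = lact m (lact n x).
Proof. by []. Qed.

Lemma lactDl m n x : lact (m + n) x = lact m x + lact n x.
Proof. by []. Qed.

Lemma lact_app_linear x : linear (fun m => lact m x).
Proof. by []. Qed.

Lemma lactMr m x y : lact m (x ** y) = lact m x ** y.
Proof. by have [_ _ m1 _ _] := multP m. Qed.

Lemma lact_to_mult (a x : A) : lact (to_mult a) x = a ** x.
Proof. by []. Qed.

Lemma to_mult_star_hom : star_hom (@to_mult R A).
Proof.
split=> [k x y|x y|x]; apply: multiplier_eq => z.
- exact: amul_linearl.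
- by rewrite lactM /= !lact_to_mult amulA.
- apply/eqP; rewrite -subr_eq0; apply/eqP/amul_eq0l => w.
  by rewrite amulBr -[w]starK -lact_adj !lact_to_mult starM amulA subrr.
Qed.

Lemma mult_to_mult m (a : A) : m ** to_mult a = to_mult (lact m a).
Proof. by apply: multiplier_eq => x; rewrite lactM !lact_to_mult lactMr. Qed.

(** The lower bound is obtained by letting [a] act on its own adjoint. *)
Lemma norm_to_mult (a : A) : ⟦to_mult a⟧ = ⟦a⟧.
Proof.
apply/eqP; rewrite eq_le (star_hom_contractive _ to_mult_star_hom) /=.
have [a0|a0] := leP ⟦a⟧ 0; first by rewrite (le_trans a0)// rnorm_ge0.
rewrite -(ler_pM2r a0) -expr2 -{1}rnorm_star -rnorm_cstar starK.
by have := lact_le (to_mult a) (star a); rewrite lact_to_mult rnorm_star.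
Qed.

Lemma mult_one_unit : is_unit (@mult_one R A).
Proof. by move=> m; split; exact: multiplier_eq. Qed.

End MultiplierNorm.

(** * Multipliers and ideals from dense spans *)

Section DenseSpans.
Context {R : realType} {A : cstarAlgType R}.

Section MultiplierExtension.
Context (I : Type) (g h h' : I -> A) (M M' : R).
Hypothesis gd : forall x, approx (span g) x.

Lemma mult_eq_dense (m n : multiplier A) :
  (forall i, lact m (g i) = lact n (g i)) -> m = n.
Proof.
move=> mn; apply: multiplier_eq.
exact: (dense_linear_eq gd (@lact_linear R A m) (@lact_linear R A n)
  (@lact_le R A m) (@lact_le R A n)).
Qed.

(** Two bounds are required because an operator and its adjoint are built independently by
    continuity; the last hypothesis makes them adjoint on the generators, hence everywhere. *)
Lemma mult_extension : 0 <= M -> 0 <= M' ->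
  (forall l, ⟦comb h l⟧ <= M * ⟦comb g l⟧) ->
  (forall l, ⟦comb h' l⟧ <= M' * ⟦comb g l⟧) ->
  (forall i j, star (h i) ** g j = star (g i) ** h' j) ->
  exists m : multiplier A, [/\ forall i, lact m (g i) = h i,
    forall i, lact (star m) (g i) = h' i & ⟦m⟧ <= M].
Proof.
move=> M0 M'0 hM h'M hh'.
have [T [Tl TM Tg]] := bounded_extension M0 gd hM.
have [T' [T'l T'M T'g]] := bounded_extension M'0 gd h'M.
have TT' x y : star (T x) ** y = star x ** T' y.
  apply: (ip_adj_dense (P := cstar_pairing) gd Tl T'l TM T'M) => i j /=.
  by rewrite Tg T'g.
exists (Multiplier (adj_pair_centralizer TT' M0 TM)); split=> // [i|].
  rewrite -T'g; apply: (ip_inj (P := cstar_pairing)) => x /=.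
  by rewrite -lact_adj -TT'.
exact: mult_norm_le.
Qed.

End MultiplierExtension.

(** This is how strictly convergent infinite sums are formed. On any finite set of generators such a
    sum acts like one of its partial sums, and a uniform bound on these lets the prescribed values
    extend to a multiplier. *)
Lemma mult_local (I : eqType) (g h h' : I -> A) (M : R) :
  (forall x, approx (span g) x) -> 0 <= M ->
  (forall r : seq I, exists m : multiplier A, ⟦m⟧ <= M /\
    forall i, i \in r -> lact m (g i) = h i /\ lact (star m) (g i) = h' i) ->
  exists m : multiplier A, [/\ forall i, lact m (g i) = h i,
    forall i, lact (star m) (g i) = h' i & ⟦m⟧ <= M].
Proof.
move=> gd M0 loc; apply: (mult_extension gd M0 M0).
- move=> l; have [m [mM mh]] := loc [seq p.2 | p <- l].
  have -> : comb h l = lact m (comb g l).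
    rewrite (lin_comb _ _ (@lact_linear R A m)) /comb; apply: eq_big_seq => p pl /=.
    by rewrite (mh p.2 _).1//; apply/mapP; exists p.
  by rewrite (le_trans (lact_le _ _))// ler_wpM2r ?rnorm_ge0.
- move=> l; have [m [mM mh]] := loc [seq p.2 | p <- l].
  have -> : comb h' l = lact (star m) (comb g l).
    rewrite (lin_comb _ _ (@lact_linear R A (star m))) /comb.
    apply: eq_big_seq => p pl /=.
    by rewrite (mh p.2 _).2//; apply/mapP; exists p.
  by rewrite (le_trans (lact_le _ _))// ler_wpM2r ?rnorm_ge0// rnorm_star.
- move=> i j; have [m [_ mh]] := loc [:: i; j].
  rewrite -(mh i _).1 ?mem_head// -(mh j _).2 ?inE ?eqxx ?orbT//.
  exact: lact_adj.
Qed.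

(** Generation is about *-subalgebras, whereas [J] is only a closed right ideal. The elements lying
    in [J] together with their adjoints form a *-subalgebra, since the adjoint of xy is the product
    of the adjoint of y, which is in [J], with that of x. *)
Lemma generated_ideal (S J : set A) : generates S -> approx J `<=` J -> J 0 ->
  (forall (k : R[i]) x y, J x -> J y -> J (k *: x + y)) ->
  (forall x y, J x -> J (x ** y)) ->
  (forall x, S x -> J x /\ J (star x)) -> forall x, J x.
Proof.
move=> gen Jc J0 Jl Jr SJ.
have XT : [set x | J x /\ J (star x)] = setT.
  apply: gen.
  - apply/closedP => x Xx; split; apply: Jc.
      by apply: approxS Xx => y [].
    apply: (approx_lip (F := star) (C := 1) _ _ Xx) => [y z|y [_ Jy]].
      by rewrite mul1r -starB rnorm_star.
    exact: subset_approx.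
  - by rewrite /= star0.
  - by move=> k x y [Jx Jx'] [Jy Jy']; split; rewrite ?star_semilinear; exact: Jl.
  - by move=> x y [Jx Jx'] [Jy Jy']; split; rewrite ?starM; exact: Jr.
  - by move=> x [Jx Jx']; split; rewrite ?starK.
  - exact: SJ.
by move=> x; have : [set: A] x by []; rewrite -XT => -[].
Qed.

Lemma generates_star_hom_eq (B : cstarAlgType R) (S : set A) (f f' : A -> B) :
  generates S -> star_hom f -> star_hom f' -> (forall x, S x -> f x = f' x) ->
  f =1 f'.
Proof.
move=> gen fh fh' ff' x.
have fl := star_hom_linear fh; have fl' := star_hom_linear fh'.
suff XT : [set x | f x = f' x] = setT by have : [set: A] x by []; rewrite -XT.
apply: gen => //.
- apply/closedP => y; apply: (approx_linear_eq fl fl' (C := 1) (D := 1)) => // z.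
    by rewrite mul1r star_hom_contractive.
  by rewrite mul1r star_hom_contractive.
- by rewrite /= (lin0 fl) (lin0 fl').
- by move=> k y z /= yy zz; rewrite (linD fl) (linD fl') (linZ fl) (linZ fl') yy zz.
- by move=> y z /= yy zz; rewrite (star_homM fh) (star_homM fh') yy zz.
- by move=> y /= yy; rewrite (star_homV fh) (star_homV fh') yy.
Qed.

Lemma approx_ideal (I : Type) (g : I -> A) (c : I -> A -> I) :
  (forall i x, g (c i x) = g i ** x) ->
  forall x y, approx (span g) x -> approx (span g) (x ** y).
Proof.
move=> gc x y gx.
apply: (approx_lip (F := fun x => x ** y) (amulr_lip y) _ gx) => _ [l ->].
apply: subset_approx; exists [seq (p.1, c p.2 y) | p <- l].
rewrite /comb big_map amul_suml; apply: eq_bigr => p _ /=.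
by rewrite gc amulZl.
Qed.

End DenseSpans.

Section GraphAlgebraSpan.
Context {R : realType} {E : digraph} {A : cstarAlgType R}.
Context {t : edge E -> A} {q : vertex E -> A}.
Hypothesis Ef : row_finite E.
Hypothesis cA : is_graph_calg t q.

(** The vertex projections act as local units from the left, because s_f and its adjoint are fixed
    by the projections at the source and at the range of f. With infinitely many vertices there need
    be no unit. *)
Lemma graph_dense x : approx (span (fun i : vertex E * A => q i.1 ** i.2)) x.
Proof.
have ck := graph_ck cA.
apply: (generated_ideal (graph_gen cA)).
- exact: approx_idem.
- apply: subset_approx; exists [::]; by rewrite /comb big_nil.
- apply: approx_submod; first by exists [::]; rewrite /comb big_nil.
  by move=> k y z; exact: span_lin.
- apply: (approx_ideal (c := fun i y => (i.1, i.2 ** y))) => i y.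
  by rewrite amulA.
- have J v y : approx (span (fun i : vertex E * A => q i.1 ** i.2)) (q v ** y).
    by apply: subset_approx; exact: (span_gen _ (v, y)).
  move=> y [[f _ <-]|[v _ <-]].
    split; first by rewrite -(ck_srcM Ef ck).
    by rewrite -(ck_rngM ck) starM (ck_proj ck _).2.
  by rewrite (ck_proj ck _).2 -(ck_proj ck _).1.
Qed.

End GraphAlgebraSpan.

(** * Spatial tensor products *)

Section InnerProduct.
Context {R : realType} {H : hilbertType R}.
Implicit Types x y z : H.

Lemma innerDl x y z : inner (x + y) z = inner x z + inner y z.
Proof. by have := inner_linearl z 1 x y; rewrite scale1r mul1r. Qed.

Lemma inner0l x : inner 0 x = 0.
Proof. by apply: (addrI (inner 0 x)); rewrite -innerDl !addr0. Qed.

Lemma innerZl k x z : inner (k *: x) z = k * inner x z.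
Proof. by have := inner_linearl z k x 0; rewrite addr0 inner0l addr0. Qed.

Lemma innerDr x y z : inner z (x + y) = inner z x + inner z y.
Proof. by rewrite inner_conj innerDl rmorphD /= -!inner_conj. Qed.

Lemma innerZr k x z : inner z (k *: x) = k^* * inner z x.
Proof. by rewrite inner_conj innerZl rmorphM /= -inner_conj. Qed.

Lemma inner_suml (I : Type) (r : seq I) (P : pred I) (F : I -> H) z :
  inner (\sum_(i <- r | P i) F i) z = \sum_(i <- r | P i) inner (F i) z.
Proof.
elim/big_rec2 : _ => [|i a b _ <-]; first exact: inner0l.
exact: innerDl.
Qed.

Lemma inner_sumr (I : Type) (r : seq I) (P : pred I) (F : I -> H) z :
  inner z (\sum_(i <- r | P i) F i) = \sum_(i <- r | P i) inner z (F i).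
Proof.
elim/big_rec2 : _ => [|i a b _ <-]; first by rewrite inner_conj inner0l conjC0.
exact: innerDr.
Qed.

Lemma inner_ge0 x : 0 <= inner x x.
Proof. by rewrite inner_norm exprn_ge0. Qed.

Lemma inner_real x : (inner x x)^* = inner x x.
Proof. by rewrite -inner_conj. Qed.

End InnerProduct.

Section TensorSqnorm.
Context {R : realType}.
Implicit Types H K : hilbertType R.

(* Gram-Schmidt: splitting off the component of the [x i] along one of them
   subtracts the square norm of a vector of [K]. *)
Lemma tensor_sqnorm_ge0 H K (I : finType) (x : I -> H) (y : I -> K) :
  0 <= tensor_sqnorm x y.
Proof.
(* Induction on the number of nonzero vectors among the [x i]: the projection orthogonal to [x i0]
   kills that vector and keeps zero vectors zero. *)
have [n] := ubnP #|[pred i | x i != 0]|; elim: n => // n IH in x *; rewrite ltnS => xn.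
have [/existsP[i0 xi0]|] := boolP [exists i, x i != 0]; last first.
  rewrite negb_exists => /forallP x0; rewrite /tensor_sqnorm big1// => i _.
  by rewrite big1// => j _; move: (x0 i); rewrite negbK => /eqP ->; rewrite inner0l mul0r.
set v := x i0; pose N := inner v v.
have N0 : N != 0 by rewrite /N inner_norm sqrf_eq0 normr_eq0.
pose a i := inner (x i) v / N.
pose x' i := x i + (- a i) *: v.
have xv i : inner (x i) v = a i * N by rewrite divfK.
have vx i : inner v (x i) = (a i)^* * N.
  by rewrite inner_conj xv rmorphM /= inner_real.
have xx i j : inner (x i) (x j) = inner (x' i) (x' j) + N * (a i * (a j)^*).
  rewrite /x' innerDl !innerDr !innerZl !innerZr (xv i) (vx j) rmorphN -/N.
  ring.
(* Each [x i] is [x' i] plus a multiple of [v] orthogonal to it, so the tensor splits orthogonally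
   and its second part is v tensored with the sum of the [a i *: y i]. *)
have -> : tensor_sqnorm x y = tensor_sqnorm x' y +
    N * inner (\sum_i a i *: y i) (\sum_i a i *: y i).
  rewrite /tensor_sqnorm inner_suml mulr_sumr -big_split; apply: eq_bigr => i _.
  rewrite innerZl inner_sumr !mulr_sumr -big_split; apply: eq_bigr => j _ /=.
  by rewrite innerZr xx; ring.
rewrite addr_ge0 ?mulr_ge0 ?inner_ge0//; apply: IH.
rewrite (leq_trans _ xn)//; apply: proper_card; apply/properP; split.
  apply/fintype.subsetP => i; rewrite !inE; apply: contraNneq => xi.
  by rewrite /x' /a xi inner0l mul0r oppr0 scale0r addr0.
by exists i0; rewrite !inE ?xi0// /x' /a -/v -/N divff// scaleN1r subrr eqxx.
Qed.

Lemma tensor_sqnormC H K (I : finType) (x : I -> H) (y : I -> K) :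
  tensor_sqnorm x y = tensor_sqnorm y x.
Proof. by apply: eq_bigr => i _; apply: eq_bigr => j _; rewrite mulrC. Qed.

(** The vectors [x''] are a defect: they exhibit the difference of the two Gram matrices as a Gram
    matrix, and tensoring with the [y i] preserves its positivity. *)
Lemma tensor_sqnorm_le H K (I : finType) (x x' x'' : I -> H) (y : I -> K) (k : R[i]) :
  (forall i j, inner (x i) (x j) + inner (x'' i) (x'' j) = k * inner (x' i) (x' j)) ->
  tensor_sqnorm x y <= k * tensor_sqnorm x' y.
Proof.
move=> xE; rewrite -subr_ge0 (_ : _ - _ = tensor_sqnorm x'' y).
  exact: tensor_sqnorm_ge0.
apply/eqP; rewrite subr_eq addrC /tensor_sqnorm mulr_sumr -big_split; apply/eqP.
apply: eq_bigr => i _; rewrite mulr_sumr -big_split; apply: eq_bigr => j _ /=.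
by rewrite mulrA -xE mulrDl.
Qed.

End TensorSqnorm.

Section Representations.
Context {R : realType} {B : cstarAlgType R} {H : hilbertType R} {rho : B -> H -> H}.
Hypothesis rr : is_rep rho.

Lemma rep_inner b b' x x' :
  inner (rho b x) (rho b' x') = inner x (rho (star b ** b') x').
Proof. by rewrite (rep_star rr) (rep_mul rr). Qed.

Lemma rep0 x : rho 0 x = 0.
Proof.
have := rep_linear rr 1 0 0 x; rewrite !scale1r addr0 => /eqP.
by rewrite -subr_eq0 opprD addNKr oppr_eq0 => /eqP.
Qed.

Lemma repZ k b x : rho (k *: b) x = k *: rho b x.
Proof. by have := rep_linear rr k b 0 x; rewrite !addr0 rep0 addr0. Qed.

Lemma repD b b' x : rho (b + b') x = rho b x + rho b' x.
Proof. by have := rep_linear rr 1 b b' x; rewrite !scale1r. Qed.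

(* [w / M] is the square root of [1 - m^* m / M^2]. *)
Lemma rep_contraction (m : multiplier B) (M : R) : ⟦m⟧ < M ->
  exists w : B -> B, forall b b' x x',
    inner (rho (lact m b) x) (rho (lact m b') x') +
    inner (rho (w b) x) (rho (w b') x') =
    (M ^+ 2)%:C%C * inner (rho b x) (rho b' x').
Proof.
move=> mM; have M0 : 0 < M by rewrite (le_lt_trans (rnorm_ge0 _) mM).
have MC : (M^-1%:C%C : R[i])^* = M^-1%:C%C.
  by apply/eqP; rewrite eq_complex /= oppr0 !eqxx.
pose n := M^-1%:C%C *: m.
have n1 : ⟦n⟧ < 1.
  by rewrite rnormZ normc_real ?invr_ge0 ?ltW// mulrC ltr_pdivrMr// mul1r.
have nn1 : ⟦star n ** n⟧ < 1 by rewrite rnorm_cstar expr_lt1 ?rnorm_ge0.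
have snn : star (star n ** n) = star n ** n by rewrite starM starK.
have [y [sy yy _ _]] := sqrt_one_sub snn nn1.
have MM : (M%:C%C : R[i])^* = M%:C%C.
  by apply/eqP; rewrite eq_complex /= oppr0 !eqxx.
have MM0 : (M%:C%C : R[i]) != 0 by rewrite eq_complex /= negb_and gt_eqF.
exists (fun b => M%:C%C *: (b - lact y b)) => b b' x x'.
have mE c : lact m c = M%:C%C *: lact n c.
  by rewrite -[lact n c]/(M^-1%:C%C *: lact m c) scalerA fmorphV divff// scale1r.
clearbody n.
have key : star (lact m b) ** lact m b' +
    star (M%:C%C *: (b - lact y b)) ** (M%:C%C *: (b' - lact y b')) =
    (M ^+ 2)%:C%C *: (star b ** b').
  have nE : star (lact n b) ** lact n b' +
      star (b - lact y b) ** (b' - lact y b') = star b ** b'.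
    rewrite lact_adj starB amulBl !amulBr lact_adj sy.
    have -> : lact (star n) (lact n b') = lact (y + y) b' - lact (y ** y) b'.
      by rewrite yy -lactM lactDl; lmod.
    by rewrite lact_adj sy lactM lactDl amulBr amulDr; lmod.
  have M2 : (M ^+ 2)%:C%C = M%:C%C * M%:C%C :> R[i] by rewrite -rmorphM -expr2.
  by rewrite !mE !starZ MM !amulZl !amulZr !scalerA M2 -nE; lmod.
rewrite !rep_inner -innerDr -repD key repZ innerZr.
by congr (_ * _); apply/eqP; rewrite eq_complex /= oppr0 !eqxx.
Qed.

End Representations.

Section TensorMultipliers.
Context {R : realType}.
Implicit Types B C : cstarAlgType R.

Definition tens B C (T : spatial_tensor B C) (p : B * C) : T := tensor T p.1 p.2.

Lemma sqMC (x y : R) : (x * y)%:C%C ^+ 2 = (x ^+ 2)%:C%C * y%:C%C ^+ 2 :> R[i].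
Proof. by rewrite rmorphM exprMn rmorphXn. Qed.

Section Tensor.
Context {B C : cstarAlgType R} {T : spatial_tensor B C}.

Lemma tens_dense x : approx (span (tens T)) x.
Proof.
rewrite -(lin_spanE (S := [set z | exists a b, z = tensor T a b])).
  by apply: (denseP _).1; exact: tensor_dense.
apply/seteqP; split => z.
  by move=> [a [b ->]]; exists (a, b).
by move=> [[a b] _ <-]; exists a, b.
Qed.

Lemma comb_tensE (l : seq (R[i] * (B * C))) : comb (tens T) l =
  \sum_(i < size l) tensor T ((tnth (in_tuple l) i).1 *: (tnth (in_tuple l) i).2.1)
    (tnth (in_tuple l) i).2.2.
Proof.
rewrite /comb big_tnth; apply: eq_bigr => i _.
by rewrite /tens (linZ (tensor_linearl T _)).
Qed.

Lemma rnorm_tensP n (a : 'I_n -> B) (b : 'I_n -> C) (M : R) : 0 <= M ->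
  ⟦\sum_(i < n) tensor T (a i) (b i)⟧ <= M <-> spatial_norm_le a b M%:C%C.
Proof. by move=> M0; rewrite rnorm_leC; apply: tensor_norm; rewrite lecR. Qed.

Lemma tensor0l c : tensor T 0 c = 0. Proof. exact: lin0 (tensor_linearl T c). Qed.
Lemma tensor_eq_dense (m n : multiplier T) :
  (forall b c, lact m (tensor T b c) = lact n (tensor T b c)) -> m = n.
Proof. by move=> mn; apply: (mult_eq_dense tens_dense) => -[b c]; exact: mn. Qed.

Lemma mult_tensor_left (m : multiplier B) : exists k : multiplier T,
  (forall b c, lact k (tensor T b c) = tensor T (lact m b) c) /\
  (forall b c, lact (star k) (tensor T b c) = tensor T (lact (star m) b) c).
Proof.
(* The constant exceeds the norm because the defect operator is a square root that needs a strict
   inequality; for the extension any bound will do. *)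
have bound (n : multiplier B) l :
    ⟦comb (fun p : B * C => tensor T (lact n p.1) p.2) l⟧ <=
    (⟦n⟧ + 1) * ⟦comb (tens T) l⟧.
  have N0 : 0 <= ⟦n⟧ + 1 by rewrite addr_ge0// rnorm_ge0.
  have -> : comb (fun p : B * C => tensor T (lact n p.1) p.2) l =
      \sum_(i < size l) tensor T (lact n ((tnth (in_tuple l) i).1 *: (tnth (in_tuple l) i).2.1))
        (tnth (in_tuple l) i).2.2.
    rewrite /comb big_tnth; apply: eq_bigr => i _.
    by rewrite (linZ (@lact_linear R B n)) (linZ (tensor_linearl T _)).
  apply/rnorm_tensP; first by rewrite mulr_ge0// rnorm_ge0.
  move=> H K rho sigma rr rs k x y.
  have [w wE] := @rep_contraction _ _ _ _ rr n (⟦n⟧ + 1) (eqbRL (ltrDl _ _) ltr01).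
  rewrite (le_trans (tensor_sqnorm_le _ (fun i j => wE _ _ _ _)))//.
  rewrite sqMC -mulrA ler_wpM2l ?lecR ?sqr_ge0//.
  have := @rnorm_tensP _ (fun i => (tnth (in_tuple l) i).1 *: (tnth (in_tuple l) i).2.1)
    (fun i => (tnth (in_tuple l) i).2.2) ⟦comb (tens T) l⟧ (rnorm_ge0 _).
  by rewrite -comb_tensE lexx => -[/(_ isT) + _]; apply.
have N0 (n : multiplier B) : 0 <= ⟦n⟧ + 1 by rewrite addr_ge0// rnorm_ge0.
have [|k [km ksm _]] := mult_extension tens_dense (N0 m) (N0 (star m)) (bound m) (bound (star m)).
  by move=> [b c] [b' c']; rewrite /tens /= !tensor_star !tensor_mul lact_adj.
by exists k; split=> b c; [exact: (km (b, c))|exact: (ksm (b, c))].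
Qed.

Lemma mult_tensor_right (m : multiplier C) : exists k : multiplier T,
  (forall b c, lact k (tensor T b c) = tensor T b (lact m c)) /\
  (forall b c, lact (star k) (tensor T b c) = tensor T b (lact (star m) c)).
Proof.
have bound (n : multiplier C) l :
    ⟦comb (fun p : B * C => tensor T p.1 (lact n p.2)) l⟧ <=
    (⟦n⟧ + 1) * ⟦comb (tens T) l⟧.
  have N0 : 0 <= ⟦n⟧ + 1 by rewrite addr_ge0// rnorm_ge0.
  have -> : comb (fun p : B * C => tensor T p.1 (lact n p.2)) l =
      \sum_(i < size l) tensor T ((tnth (in_tuple l) i).1 *: (tnth (in_tuple l) i).2.1)
        (lact n (tnth (in_tuple l) i).2.2).
    rewrite /comb big_tnth; apply: eq_bigr => i _.
    by rewrite (linZ (tensor_linearl T _)).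
  apply/rnorm_tensP; first by rewrite mulr_ge0// rnorm_ge0.
  move=> H K rho sigma rr rs k x y.
  have [w wE] := @rep_contraction _ _ _ _ rs n (⟦n⟧ + 1) (eqbRL (ltrDl _ _) ltr01).
  rewrite tensor_sqnormC (le_trans (tensor_sqnorm_le _ (fun i j => wE _ _ _ _)))//.
  rewrite sqMC -mulrA ler_wpM2l ?lecR ?sqr_ge0//.
  have := @rnorm_tensP _ (fun i => (tnth (in_tuple l) i).1 *: (tnth (in_tuple l) i).2.1)
    (fun i => (tnth (in_tuple l) i).2.2) ⟦comb (tens T) l⟧ (rnorm_ge0 _).
  by rewrite -comb_tensE lexx tensor_sqnormC => -[/(_ isT) + _]; apply.
have N0 (n : multiplier C) : 0 <= ⟦n⟧ + 1 by rewrite addr_ge0// rnorm_ge0.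
have [|k [km ksm _]] := mult_extension tens_dense (N0 m) (N0 (star m)) (bound m) (bound (star m)).
  by move=> [b c] [b' c']; rewrite /tens /= !tensor_star !tensor_mul lact_adj.
by exists k; split=> b c; [exact: (km (b, c))|exact: (ksm (b, c))].
Qed.

Lemma mult_tensor_ex (m : multiplier B) (n : multiplier C) : exists k : multiplier T,
  (forall b c, lact k (tensor T b c) = tensor T (lact m b) (lact n c)) /\
  (forall b c, lact (star k) (tensor T b c) = tensor T (lact (star m) b) (lact (star n) c)).
Proof.
have [k [km ksm]] := mult_tensor_left m; have [k' [km' ksm']] := mult_tensor_right n.
exists (k ** k'); split=> b c; first by rewrite lactM km' km.
by rewrite starM lactM ksm ksm'.
Qed.

End Tensor.

Definition mtensor B C (T : spatial_tensor B C) (m : multiplier B)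
  (n : multiplier C) : multiplier T := sval (cid (mult_tensor_ex m n)).

Section MultiplierTensor.
Context {B C : cstarAlgType R} {T : spatial_tensor B C}.
Implicit Types (m : multiplier B) (n : multiplier C).

Lemma mtensorE m n b c :
  lact (mtensor T m n) (tensor T b c) = tensor T (lact m b) (lact n c).
Proof. by rewrite /mtensor; case: cid => k [] /=. Qed.

Lemma mtensor_mult m n : mult_tensor m n (mtensor T m n).
Proof. exact: mtensorE. Qed.

Lemma mult_tensor_uniq m n k : mult_tensor (T := T) m n k -> k = mtensor T m n.
Proof. by move=> mn; apply: tensor_eq_dense => b c; rewrite mn mtensorE. Qed.

Lemma mtensorV m n : star (mtensor T m n) = mtensor T (star m) (star n).
Proof.
apply: tensor_eq_dense => b c; rewrite mtensorE /mtensor.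
by case: cid => k [].
Qed.

Lemma mtensorM m m' n n' :
  mtensor T m n ** mtensor T m' n' = mtensor T (m ** m') (n ** n').
Proof. by apply: tensor_eq_dense => b c; rewrite lactM !mtensorE. Qed.

Lemma mtensor_linearl n : linear (fun m => mtensor T m n).
Proof.
move=> k m m'; apply: tensor_eq_dense => b c.
by rewrite lact_comb !mtensorE lact_comb (tensor_linearl T).
Qed.

End MultiplierTensor.
End TensorMultipliers.

Section HilbertPairing.
Context {R : realType} {H : hilbertType R}.

Lemma rnorm_inner (x : H) : inner x x = (⟦x⟧ ^+ 2)%:C%C.
Proof. by rewrite inner_norm rnormE rmorphXn. Qed.

Lemma cauchy_schwarz (x y : H) : ⟦inner x y : R[i]^o⟧ <= ⟦x⟧ * ⟦y⟧.
Proof.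
have [y0|y0] := leP ⟦y⟧ 0.
  rewrite (rnorm0_eq0 y0) -(scale0r 0) innerZr conjC0 mul0r scale0r rnorm0.
  by rewrite rnorm0 mulr0.
set N := inner y y; have N0 : 0 < N by rewrite /N rnorm_inner ltcR exprn_gt0.
have := inner_ge0 (N *: x - inner x y *: y).
rewrite -scaleNr innerDl !innerDr !innerZl !innerZr /= -/N inner_real rmorphN /=.
rewrite (inner_conj x y); set z := inner x y.
have -> : N * (N * inner x x) + N * (- z^* * z) + (- z * (N * z^*) + - z * (- z^* * N))
  = N * (N * inner x x - z * z^*) by ring.
rewrite pmulr_rge0// subr_ge0 -normCK /N !rnorm_inner rnormE -rmorphXn -rmorphM lecR.
rewrite -exprMn mulrC ler_sqr ?nnegrE ?mulr_ge0 ?rnorm_ge0//.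
Qed.

Lemma inner_ip_linear (x : H) : linear (fun y => inner y x : R[i]^o).
Proof. by move=> k y z; rewrite innerDl innerZl. Qed.

(** [inner] is linear in its first argument and a pairing in its second, hence the swap. *)
Definition hilbert_pairing : pairing H R[i]^o.
Proof.
apply: (@Pairing R H R[i]^o (fun x y => inner y x) (fun z : R[i]^o => z^* : R[i]^o)).
- by move=> x y; rewrite -inner_conj.
- exact: inner_ip_linear.
- by move=> k x y z; rewrite innerDr innerZr.
- by move=> x y; rewrite mulrC cauchy_schwarz.
- by move=> x; rewrite rnorm_inner /rnorm ger0_norm ?lecR ?sqr_ge0.
Defined.

End HilbertPairing.

Section ClosedSubspaces.
Context {R : realType} {H : hilbertType R}.

Record closed_subspace := ClosedSubspace {
  subspace_pred : {pred H};
  subspace_submod : submod_closed subspace_pred;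
  subspace_closed : forall x, approx [set y | y \in subspace_pred] x ->
    x \in subspace_pred
}.

Variable S : closed_subspace.

Record subhilbert := SubHilbert { sub_val :> H; _ : sub_val \in subspace_pred S }.

HB.instance Definition _ := [isSub for sub_val].
HB.instance Definition _ := [Choice of subhilbert by <:].
HB.instance Definition _ :=
  GRing.isSubmodClosed.Build R[i] _ (subspace_pred S) (subspace_submod S).
HB.instance Definition _ := [SubChoice_isSubLmodule of subhilbert by <:].

Let N (x : subhilbert) : R[i] := `|val x|.

Lemma subhilbert_normD x y : N (x + y) <= N x + N y.
Proof. exact: ler_normD. Qed.

Lemma subhilbert_normZ k x : N (k *: x) = `|k| * N x.
Proof. exact: normrZ. Qed.

Lemma subhilbert_norm0_eq0 x : N x = 0 -> x = 0.
Proof. by move=> /eqP; rewrite normr_eq0 => /eqP x0; exact: val_inj. Qed.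

HB.instance Definition _ := Lmodule_isNormed.Build R[i] subhilbert
  subhilbert_normD subhilbert_normZ subhilbert_norm0_eq0.

Lemma subhilbert_complete (u : nat -> subhilbert) : rcauchy u -> exists l, tends u l.
Proof.
move=> uc; have [l ul] : exists l : H, tends (fun n => val (u n)) l.
  by apply: complete_tends => e /uc[K KP]; exists K.
have lS : l \in subspace_pred S.
  apply: subspace_closed; apply: tends_approx ul => n /=; exact: valP.
by exists (SubHilbert lS).
Qed.

HB.instance Definition _ := Uniform_isComplete.Build subhilbert
  (complete_filter subhilbert_complete).

Lemma subhilbert_inner_linearl (z : subhilbert) (k : R[i]) (x y : subhilbert) :
  inner (val (k *: x + y)) (val z) = k * inner (val x) (val z) + inner (val y) (val z).
Proof. exact: inner_linearl. Qed.

HB.instance Definition _ := NormedModule_isHilbert.Build R subhilbert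
  subhilbert_inner_linearl (fun x y => inner_conj (val x) (val y))
  (fun x => inner_norm (val x)).

End ClosedSubspaces.

(** * Extension of a representation to the multiplier algebra *)

Section EssentialExtension.
Context {R : realType} {B : cstarAlgType R} {H : hilbertType R} {rho : B -> H -> H}.
Hypothesis rr : is_rep rho.

Let g (p : B * H) : H := rho p.1 p.2.

(** The closed span of rho(B)H. Representations are not assumed nondegenerate, and the formula
    sending rho(b)x to rho(mb)x determines the action of a multiplier m on this subspace only. *)
Definition ess_pred : {pred H} := fun x => `[< approx (span g) x >].

Lemma ess_submod : submod_closed ess_pred.
Proof.
have S0 : span g 0 by exists [::]; rewrite /comb big_nil.
split; first by rewrite unfold_in; apply/asboolP; exact: subset_approx.
move=> k x y; rewrite !unfold_in => /asboolP xe /asboolP ye; apply/asboolP.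
by apply: approx_submod => // k' u v; exact: span_lin.
Qed.

Lemma ess_closed x : approx [set y | y \in ess_pred] x -> x \in ess_pred.
Proof.
move=> xe; rewrite unfold_in; apply/asboolP; apply: approx_idem.
by apply: approxS xe => y /=; rewrite unfold_in => /asboolP.
Qed.

Definition ess : closed_subspace := ClosedSubspace ess_submod ess_closed.

Local Notation K := (subhilbert ess).

Lemma ess_gen_subproof (p : B * H) : rho p.1 p.2 \in subspace_pred ess.
Proof.
by rewrite unfold_in; apply/asboolP; apply: subset_approx; exact: (span_gen g p).
Qed.

Definition ess_gen (p : B * H) : K := SubHilbert (ess_gen_subproof p).

Lemma val_comb (l : seq (R[i] * (B * H))) : val (comb ess_gen l) = comb g l.
Proof.
rewrite /comb; elim/big_rec2 : _ => [//|p x y _ <-].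
by [].
Qed.

Lemma ess_dense (x : K) : approx (span ess_gen) x.
Proof.
have : val x \in ess_pred by exact: valP.
rewrite unfold_in => /asboolP xe e /xe[_ [l ->] le].
by exists (comb ess_gen l); [exists l|rewrite -val_comb in le].
Qed.

Lemma inner_comb (h h' : B * H -> H) (l l' : seq (R[i] * (B * H))) :
  inner (comb h l) (comb h' l') =
  \sum_(p <- l) \sum_(q <- l') p.1 * (q.1^* * inner (h p.2) (h' q.2)).
Proof.
rewrite /comb inner_suml; apply: eq_bigr => p _.
rewrite inner_sumr; apply: eq_bigr => q _.
by rewrite innerZl innerZr.
Qed.

(** With [w] the defect of [m], the difference of the two squared norms is the squared norm of the
    corresponding combination of the rho(w b)x, hence nonnegative. *)
Lemma ess_bound (m : multiplier B) l :
  ⟦comb (fun p => ess_gen (lact m p.1, p.2)) l⟧ <= (⟦m⟧ + 1) * ⟦comb ess_gen l⟧.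
Proof.
have m1 : ⟦m⟧ < ⟦m⟧ + 1 by rewrite ltrDl.
have [w wE] := rep_contraction rr m1.
have M0 : 0 <= ⟦m⟧ + 1 by rewrite addr_ge0// rnorm_ge0.
rewrite -ler_sqr ?nnegrE ?mulr_ge0 ?rnorm_ge0// exprMn.
rewrite -lecR (rmorphM _ ((⟦m⟧ + 1) ^+ 2)) /= -!rnorm_inner.
rewrite -[inner (comb ess_gen l) _]/(inner (val (comb ess_gen l)) (val (comb ess_gen l))).
set X := comb (fun p => _) l; rewrite -[inner X X]/(inner (val X) (val X)).
have -> : val X = comb (fun p => rho (lact m p.1) p.2) l.
  by rewrite /X /comb; elim/big_rec2 : _ => [//|p x y _ <-].
rewrite val_comb -subr_ge0.
suff -> : (((⟦m⟧ + 1) ^+ 2)%:C%C * inner (comb g l) (comb g l) -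
    inner (comb (fun p => rho (lact m p.1) p.2) l)
          (comb (fun p => rho (lact m p.1) p.2) l)) =
    inner (comb (fun p => rho (w p.1) p.2) l) (comb (fun p => rho (w p.1) p.2) l).
  exact: inner_ge0.
set M2 := (_ ^+ 2)%:C%C in wE *.
apply/eqP; rewrite subr_eq !inner_comb mulr_sumr -big_split; apply/eqP.
apply: eq_bigr => p _ /=; rewrite mulr_sumr -big_split; apply: eq_bigr => q _ /=.
transitivity (p.1 * (q.1^* * (M2 * inner (g p.2) (g q.2)))); first by ring.
by rewrite -wE; ring.
Qed.

Lemma ess_rep_ex (m : multiplier B) : exists T : K -> K, [/\ linear T,
  forall x, ⟦T x⟧ <= (⟦m⟧ + 1) * ⟦x⟧ &
  forall p, T (ess_gen p) = ess_gen (lact m p.1, p.2)].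
Proof.
apply: (bounded_extension _ ess_dense (ess_bound m)).
by rewrite addr_ge0// rnorm_ge0.
Qed.

Definition ess_rep (m : multiplier B) : K -> K := sval (cid (ess_rep_ex m)).

Lemma ess_repP m : [/\ linear (ess_rep m),
  forall x, ⟦ess_rep m x⟧ <= (⟦m⟧ + 1) * ⟦x⟧ &
  forall p, ess_rep m (ess_gen p) = ess_gen (lact m p.1, p.2)].
Proof. by rewrite /ess_rep; case: cid. Qed.

Lemma ess_genD (m n : multiplier B) k p :
  ess_gen (lact (k *: m + n) p.1, p.2) =
  k *: ess_gen (lact m p.1, p.2) + ess_gen (lact n p.1, p.2).
Proof. by apply: val_inj; exact: (rep_linear rr). Qed.

Lemma ess_rep_is_rep : is_rep (A := multiplier B) ess_rep.
Proof.
split.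
- move=> m; have [ml mM _] := ess_repP m; split=> //.
  exists (⟦m⟧ + 1)%:C%C; first by rewrite lecR addr_ge0// rnorm_ge0.
  by move=> x; rewrite !rnormE -rmorphM lecR; exact: mM.
- move=> k m n; have [ml mM mE] := ess_repP m; have [nl nM nE] := ess_repP n.
  have [sl sM sE] := ess_repP (k *: m + n).
  apply: (dense_linear_eq ess_dense (F := ess_rep (k *: m + n))
    (G := fun x => k *: ess_rep m x + ess_rep n x)
    (D := Normc.normc k * (⟦m⟧ + 1) + (⟦n⟧ + 1)) sl _ sM) => [a x y|x|p].
  + by rewrite ml nl; lmod.
  + rewrite (le_trans (rnormD _ _))// mulrDl lerD//; last exact: nM.
    rewrite (le_trans (_ : _ <= Normc.normc k * ⟦ess_rep m x⟧))//.
      by rewrite -(rnormZ k (ess_rep m x)).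
    by rewrite -mulrA; apply: ler_wpM2l; [exact: normc_ge0|exact: mM].
  + by rewrite sE mE nE ess_genD.
- move=> m n; have [ml mM mE] := ess_repP m; have [nl nM nE] := ess_repP n.
  have [sl sM sE] := ess_repP (m ** n).
  apply: (dense_linear_eq ess_dense (F := ess_rep (m ** n))
    (G := fun x => ess_rep m (ess_rep n x))
    (D := (⟦m⟧ + 1) * (⟦n⟧ + 1)) sl _ sM) => [a x y|x|p].
  + by rewrite nl ml.
  + rewrite (le_trans (mM _))// -mulrA; apply: ler_wpM2l; last exact: nM.
    by rewrite addr_ge0// rnorm_ge0.
  + by rewrite sE nE mE.
- move=> m x y; have [ml mM mE] := ess_repP m; have [sl sM sE] := ess_repP (star m).
  have := @ip_adj_dense _ _ _ (@hilbert_pairing R K) _ _ _ _ _ _ ess_dense sl ml sM mM.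
  move=> adj; symmetry; apply: adj => -[b u] [b' u'].
  rewrite mE sE /= -[inner _ _]/(inner (rho b' u') (rho (lact (star m) b) u)).
  rewrite -[RHS]/(inner (rho (lact m b') u') (rho b u)) !(rep_inner rr).
  by rewrite lact_adj.
Qed.

End EssentialExtension.

(** * Tensoring a homomorphism into M(B) with the identity *)

Section TensorHomomorphism.
Context {R : realType}.
Implicit Types A B C : cstarAlgType R.

Lemma tensor_sqnorm_reindex (H K : hilbertType R) (I J : finType) (f : J -> I)
    (x : I -> H) (y : I -> K) : bijective f ->
  tensor_sqnorm (x \o f) (y \o f) = tensor_sqnorm x y.
Proof.
move=> fb; rewrite /tensor_sqnorm [RHS](reindex f) /=; last exact: onW_bij.
by apply: eq_bigr => i _; rewrite [RHS](reindex f) //; exact: onW_bij.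
Qed.

Lemma spatial_norm_fin A B n (a : 'I_n -> A) (b : 'I_n -> B) M :
  spatial_norm_le a b M ->
  forall (H K : hilbertType R) (pi : A -> H -> H) (sigma : B -> K -> K),
    is_rep pi -> is_rep sigma -> forall (J : finType) (x : J -> H) (y : J -> K),
  tensor_sqnorm (fun ij : 'I_n * J => pi (a ij.1) (x ij.2))
                (fun ij : 'I_n * J => sigma (b ij.1) (y ij.2))
    <= M ^+ 2 * tensor_sqnorm x y.
Proof.
move=> ab H K pi sigma rpi rsi J x y.
have eb := @enum_val_bij J.
rewrite -(tensor_sqnorm_reindex x y eb).
rewrite -(@tensor_sqnorm_reindex _ _ _ _ (fun p : 'I_n * 'I_#|J| => (p.1, enum_val p.2))).
  exact: (ab H K pi sigma rpi rsi _ (x \o enum_val) (y \o enum_val)).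
exists (fun p => (p.1, enum_rank p.2)) => -[i j] /=.
  by rewrite enum_valK.
by rewrite enum_rankK.
Qed.

Lemma fin_spatial_norm A B (T : spatial_tensor A B) (I : finType)
    (a : I -> A) (b : I -> B) (M : R) : 0 <= M ->
  (forall (H K : hilbertType R) (pi : A -> H -> H) (sigma : B -> K -> K),
    is_rep pi -> is_rep sigma -> forall m (x : 'I_m -> H) (y : 'I_m -> K),
    tensor_sqnorm (fun ij : I * 'I_m => pi (a ij.1) (x ij.2))
                  (fun ij : I * 'I_m => sigma (b ij.1) (y ij.2))
      <= M%:C%C ^+ 2 * tensor_sqnorm x y) ->
  ⟦\sum_i tensor T (a i) (b i)⟧ <= M.
Proof.
move=> M0 ab; have eb := @enum_val_bij I.
rewrite (reindex _ (onW_bij _ eb)); apply/rnorm_tensP => //.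
move=> H K pi sigma rpi rsi m x y; have := ab H K pi sigma rpi rsi m x y.
rewrite -(@tensor_sqnorm_reindex _ _ _ _ (fun p : 'I_#|I| * 'I_m => (enum_val p.1, p.2)))//.
exists (fun p => (enum_rank p.1, p.2)) => -[i j] /=.
  by rewrite enum_valK.
by rewrite enum_rankK.
Qed.

Lemma rep_comp A B (H : hilbertType R) (pi : A -> B) (rho : B -> H -> H) :
  star_hom pi -> is_rep rho -> is_rep (fun a => rho (pi a)).
Proof.
move=> ph rr; split => [a|k a b x|a b x|a x y].
- exact: (rep_op rr).
- by rewrite (linD (star_hom_linear ph)) (linZ (star_hom_linear ph)) (rep_linear rr).
- by rewrite (star_homM ph) (rep_mul rr).
- by rewrite (star_homV ph) (rep_star rr).
Qed.

Lemma dense_bound (V W : normedModType R[i]) (I : Type) (g : I -> V) (F : V -> W)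
    (C N : R) : (forall x, approx (span g) x) -> linear F -> 0 <= N ->
  (forall x, ⟦F x⟧ <= C * ⟦x⟧) -> (forall l, ⟦F (comb g l)⟧ <= N * ⟦comb g l⟧) ->
  forall x, ⟦F x⟧ <= N * ⟦x⟧.
Proof.
move=> gd Fl N0 FC FN x; apply: le_eps => e e0.
have D0 : 0 < `|C| + N + 1 by rewrite ltr_wpDl// addr_ge0.
have [_ [l ->] xl] := gd x _ (divr_gt0 e0 D0).
rewrite (le_trans (rnormBB (F x) (F (comb g l))))// -(linB Fl).
rewrite (le_trans (lerD (FC _) (FN l)))//.
have := rnormBB (comb g l) x; rewrite rdistC => lx.
have := ler_wpM2l N0 lx; move: xl; rewrite ltr_pdivlMr//; set d := ⟦_ - _⟧.
have d0 : 0 <= d by exact: rnorm_ge0.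
have := ler_wpM2r d0 (ler_norm C); rewrite !mulrDr !mulr1.
rewrite (mulrC d `|C|) (mulrC d N); lra.
Qed.

(** A representation of B, extended to M(B) on its essential subspace and composed with [pi], is a
    representation of A. The spatial norm in A (x) C can therefore be tested on vectors coming from
    representations of B and C. *)
Lemma tensor_hom_bound A B C (S : spatial_tensor A C) (T : spatial_tensor B C)
    (pi : A -> multiplier B) : star_hom pi -> forall l l',
  ⟦lact (comb (fun p : A * C => mtensor T (pi p.1) (to_mult p.2)) l) (comb (tens T) l')⟧
    <= ⟦comb (tens S) l⟧ * ⟦comb (tens T) l'⟧.
Proof.
move=> ph l l'.
pose k (i : 'I_(size l)) := (tnth (in_tuple l) i).1.
pose a (i : 'I_(size l)) := (tnth (in_tuple l) i).2.1.
pose c (i : 'I_(size l)) := (tnth (in_tuple l) i).2.2.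
pose k' (i : 'I_(size l')) := (tnth (in_tuple l') i).1.
pose b (i : 'I_(size l')) := (tnth (in_tuple l') i).2.1.
pose d (i : 'I_(size l')) := (tnth (in_tuple l') i).2.2.
have -> : lact (comb (fun p : A * C => mtensor T (pi p.1) (to_mult p.2)) l)
    (comb (tens T) l') = \sum_(p : 'I_(size l) * 'I_(size l'))
      tensor T (lact (pi (k p.1 *: a p.1)) (k' p.2 *: b p.2)) (c p.1 ** d p.2).
  rewrite comb_tensE (lin_sum (@lact_linear R T _)).
  rewrite -(pair_bigA _ (fun i j => tensor T (lact (pi (k i *: a i)) (k' j *: b j))
    (c i ** d j))) /= exchange_big; apply: eq_bigr => j _.
  rewrite (lin_comb _ _ (f := fun m => lact m _))// /comb [LHS]big_tnth.
  apply: eq_bigr => i _ /=; rewrite mtensorE -(linZ (tensor_linearl T _)).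
  by rewrite (linZ (star_hom_linear ph)).
apply: fin_spatial_norm; first by rewrite mulr_ge0// rnorm_ge0.
move=> H K rho sigma rr rs m x y.
have SN : spatial_norm_le (fun i => k i *: a i) c ⟦comb (tens S) l⟧%:C%C.
  by apply/(rnorm_tensP (T := S) _ _ (rnorm_ge0 _)); rewrite -comb_tensE.
have TN : spatial_norm_le (fun i => k' i *: b i) d ⟦comb (tens T) l'⟧%:C%C.
  by apply/(rnorm_tensP (T := T) _ _ (rnorm_ge0 _)); rewrite -comb_tensE.
have repA : is_rep (fun a => ess_rep rr (pi a)) := rep_comp ph (ess_rep_is_rep rr).
(* The bound for [l] is applied to the vectors that the terms of [l'] produce; the bound for [l']
   then controls those vectors. *)
have := spatial_norm_fin SN repA rs
  (fun jk : 'I_(size l') * 'I_m => @ess_gen R B H rho (k' jk.1 *: b jk.1, x jk.2))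
  (fun jk => sigma (d jk.1) (y jk.2)).
rewrite -(@tensor_sqnorm_reindex _ _ _ _
  (fun p : 'I_(size l) * 'I_(size l') * 'I_m => (p.1.1, (p.1.2, p.2)))); last first.
  by exists (fun p => ((p.1, p.2.1), p.2.2)) => [[[i j] h]|[i [j h]]].
move=> le1; have le2 := TN H K rho sigma rr rs m x y.
rewrite rmorphM exprMn -mulrA.
apply: le_trans (ler_wpM2l (exprn_ge0 _ _) le2); last by rewrite lecR rnorm_ge0.
apply: le_trans le1; rewrite le_eqVlt; apply/orP; left; apply/eqP.
apply: eq_bigr => p _; apply: eq_bigr => q _ /=; congr (_ * _).
  have [_ _ E] := ess_repP rr (pi (k p.1.1 *: a p.1.1)).
  have [_ _ E'] := ess_repP rr (pi (k q.1.1 *: a q.1.1)).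
  by rewrite E E'.
by rewrite !(rep_mul rs).
Qed.

Theorem hom_tensor_id_ex A B C (S : spatial_tensor A C) (T : spatial_tensor B C)
    (pi : A -> multiplier B) : star_hom pi ->
  exists Phi : S -> multiplier T, star_hom Phi /\
    forall a c, Phi (tensor S a c) = mtensor T (pi a) (to_mult c).
Proof.
move=> ph; pose h (p : A * C) := mtensor T (pi p.1) (to_mult p.2).
have hb l : ⟦comb h l⟧ <= 1 * ⟦comb (tens S) l⟧.
  rewrite mul1r; apply: mult_norm_le; first exact: rnorm_ge0.
  apply: (dense_bound tens_dense (@lact_linear R T _) (rnorm_ge0 _) (@lact_le R T _)).
  exact: tensor_hom_bound.
have [Phi [Pl PM PE]] := bounded_extension ler01 tens_dense hb.
have PE' a c : Phi (tensor S a c) = mtensor T (pi a) (to_mult c) := PE (a, c).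
exists Phi; split=> //.
have tl := star_hom_linear (@to_mult_star_hom R C).
split=> // [x y|x].
  apply: (dense_linear_eq tens_dense (F := fun y => Phi (x ** y))
    (G := fun y => Phi x ** Phi y) (C := ⟦x⟧) (D := ⟦x⟧)) => [k u v|k u v|w|w|[a c]].
  - by rewrite amul_linearr Pl.
  - by rewrite Pl amul_linearr.
  - by rewrite (le_trans (PM _))// mul1r rnormM.
  - rewrite (le_trans (rnormM _ _))// ler_pM ?rnorm_ge0//.
      by have := PM x; rewrite mul1r.
    by have := PM w; rewrite mul1r.
  apply: (dense_linear_eq tens_dense (F := fun x => Phi (x ** tens S (a, c)))
    (G := fun x => Phi x ** Phi (tens S (a, c)))
    (C := ⟦tens S (a, c)⟧) (D := ⟦Phi (tens S (a, c))⟧)) => [k u v|k u v|w|w|[a' c']].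
  - by rewrite amul_linearl Pl.
  - by rewrite Pl amul_linearl.
  - by rewrite (le_trans (PM _))// mul1r mulrC rnormM.
  - by rewrite (le_trans (rnormM _ _))// mulrC ler_wpM2l ?rnorm_ge0//;
      have := PM w; rewrite mul1r.
  rewrite /tens /= tensor_mul !PE' mtensorM (star_homM ph).
  by rewrite (star_homM (@to_mult_star_hom R C)).
have starlin (V : cstarAlgType R) k (u v : V) :
    star (k *: u + v) = k^* *: star u + star v by exact: star_semilinear.
rewrite -{2}[x]starK; move: (star x) => {}x; symmetry.
apply: (dense_linear_eq tens_dense (F := fun x => star (Phi (star x)))
    (G := Phi) (C := 1) (D := 1) _ Pl _ PM) => [k u v|w|[a c]] /=.
- by rewrite starlin Pl starlin conjCK.
- by rewrite rnorm_star (le_trans (PM _))// rnorm_star.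
- rewrite /tens tensor_star !PE' mtensorV (star_homV ph).
  by rewrite (star_homV (@to_mult_star_hom R C)) !starK.
Qed.

End TensorHomomorphism.

(** * The regular representation on square summable functions *)

Section UnorderedSums.
Context {R : realType} {T : choiceType}.
Implicit Types (f : T -> R[i]) (z : R[i]) (s : seq T).

Local Notation normc := (@Normc.normc R).

(** Convergence over the net of finite subsets of a possibly uncountable index set; a duplicate-free
    list stands for a finite subset. *)
Definition sums f z : Prop := forall e : R, 0 < e -> exists s0, forall s,
  uniq s -> {subset s0 <= s} -> normc (\sum_(t <- s) f t - z) < e.

Lemma sums_witness f z f' z' (e : R) : sums f z -> sums f' z' -> 0 < e ->
  exists s, [/\ uniq s, normc (\sum_(t <- s) f t - z) < e &
    normc (\sum_(t <- s) f' t - z') < e].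
Proof.
move=> fz fz' e0; have [s0 sP] := fz _ e0; have [s0' sP'] := fz' _ e0.
exists (undup (s0 ++ s0')); split; first exact: undup_uniq.
  by apply: sP; [exact: undup_uniq|move=> t ts; rewrite mem_undup mem_cat ts].
by apply: sP'; [exact: undup_uniq|move=> t ts; rewrite mem_undup mem_cat ts orbT].
Qed.

Lemma normcN (x : R[i]) : normc (- x) = normc x.
Proof. by apply: complexI; rewrite -!Defs.normcE normrN. Qed.

Lemma normc_sub_le (x y : R[i]) : normc x <= normc (y - x) + normc y.
Proof.
have -> : normc (y - x) = normc (x - y) by rewrite -normcN opprB.
by rewrite (le_trans _ (normcD _ _))// subrK.
Qed.

Lemma sums_le f z (M : R) : sums f z ->
  (forall s, uniq s -> normc (\sum_(t <- s) f t) <= M) -> normc z <= M.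
Proof.
move=> fz fM; apply: le_eps => e e0.
have [s [us fs _]] := sums_witness fz fz e0.
by rewrite (le_trans (normc_sub_le _ (\sum_(t <- s) f t)))// addrC lerD ?fM ?ltW.
Qed.

Lemma sums_comb k f z f' z' : sums f z -> sums f' z' ->
  sums (fun t => k * f t + f' t) (k * z + z').
Proof.
move=> fz fz' e e0; have e2 : 0 < e / 2 by rewrite divr_gt0.
have k1 : 0 < normc k + 1 by rewrite ltr_wpDl// normc_ge0.
have [s0 sP] := fz _ (divr_gt0 e2 k1); have [s0' sP'] := fz' _ e2.
exists (s0 ++ s0') => s us ss.
rewrite big_split -mulr_sumr /= opprD addrACA -mulrBr.
rewrite (le_lt_trans (normcD _ _))// Normc.normcM [e]splitr ler_ltD//; last first.
  by apply: sP' => // t ts; apply: ss; rewrite mem_cat ts orbT.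
have : normc (\sum_(t <- s) f t - z) < e / 2 / (normc k + 1).
  by apply: sP => // t ts; apply: ss; rewrite mem_cat ts.
rewrite ltr_pdivlMr// => /ltW; apply: le_trans.
by rewrite mulrC ler_wpM2l ?normc_ge0// lerDl.
Qed.

Lemma sums_uniq f z z' : sums f z -> sums f z' -> z = z'.
Proof.
move=> fz fz'; apply/eqP; rewrite -subr_eq0; apply/eqP/Normc.eq0_normc/eqP.
rewrite eq_le normc_ge0 andbT.
have := sums_comb (-1) fz' fz; rewrite mulN1r addrC => /sums_le; apply=> s _.
by rewrite big1 ?Normc.normc0// => t _; rewrite mulN1r addNr.
Qed.

Lemma eq_sums f f' z : f =1 f' -> sums f z -> sums f' z.
Proof. by move=> /funext <-. Qed.

Lemma normc_conj (x : R[i]) : normc x^* = normc x.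
Proof. by apply: complexI; rewrite -!Defs.normcE norm_conjC. Qed.

Lemma sums_conj f z : sums f z -> sums (fun t => (f t)^*) z^*.
Proof.
move=> fz e /fz[s0 sP]; exists s0 => s us ss; have := sP s us ss.
by rewrite -normc_conj rmorphB rmorph_sum.
Qed.

Lemma sums_reindex (h h' : T -> T) f z : cancel h h' -> cancel h' h ->
  sums f z -> sums (f \o h) z.
Proof.
move=> hK h'K fz e /fz[s0 sP]; exists (map h' s0) => s us ss.
rewrite (_ : \sum_(t <- s) _ = \sum_(t <- map h s) f t); last by rewrite big_map.
apply: sP; first by rewrite map_inj_uniq//; exact: can_inj hK.
by move=> t ts; rewrite -(h'K t) map_f// ss// map_f.
Qed.

Lemma sums_nonneg (a : T -> R) (M : R) : (forall t, 0 <= a t) ->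
  (forall s, uniq s -> \sum_(t <- s) a t <= M) ->
  sums (fun t => (a t)%:C%C) (sup [set r | exists2 s, uniq s & r = \sum_(t <- s) a t])%:C%C.
Proof.
move=> a0 aM; set S := [set r | _].
have hS : has_sup S.
  split; first by exists 0, [::] => //; rewrite big_nil.
  by exists M => _ [s us ->]; exact: aM.
move=> e e0; have [_ [s0 us0 ->] s0e] := sup_adherent e0 hS.
exists s0 => s us ss.
have le1 : \sum_(t <- s) a t <= sup S by apply: sup_ubound; [case: hS|exists s].
have le2 : \sum_(t <- s0) a t <= \sum_(t <- s) a t.
  have ps : perm_eq [seq t <- s | t \in s0] s0.
    apply: uniq_perm; rewrite ?filter_uniq// => t.
    by rewrite mem_filter; apply/andP/idP => [[]//|ts]; split=> //; exact: ss.
  rewrite -(perm_big _ ps) big_filter [leRHS](bigID (fun t => t \in s0)) /=.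
  by rewrite lerDl sumr_ge0.
rewrite -rmorph_sum -rmorphB -normcN -rmorphN normc_real opprB ?subr_ge0//.
by lra.
Qed.

End UnorderedSums.

(* The complex numbers are [C0 R unit], which is complete. *)
Lemma complex_complete (R : realType) (u : nat -> R[i]) :
  (forall e : R, 0 < e -> exists N, forall m n, (N <= m)%N -> (N <= n)%N ->
    Normc.normc (u m - u n) < e) ->
  exists l, forall e : R, 0 < e -> exists N, forall n, (N <= n)%N ->
    Normc.normc (u n - l) < e.
Proof.
have cv (z : R[i]) : (fun _ : unit => z) \in @vanishing R unit.
  apply/vanishingP => e e0; apply: (@sub_finite_set _ _ [set tt]) => //.
  by case.
move=> uc; pose v n : C0 R unit := MkC0 (cv (u n)).
have [l vl] : exists l, tends v l.
  apply: complete_tends => e e0; have e2 : 0 < e / 2 by rewrite divr_gt0.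
  have [K KP] := uc _ e2; exists K => m n Km Kn.
  apply: (@le_lt_trans _ _ (e / 2)); last by lra.
  by apply: C0_sup_le => [|t]; [exact: ltW|exact: ltW (KP m n Km Kn)].
exists (l tt) => e /vl[K KP]; exists K => n Kn.
exact: le_lt_trans (C0_sup_ge (v n - l) tt) (KP n Kn).
Qed.

Section SquareSummable.
Context {R : realType} (T : choiceType).

Local Notation normc := (@Normc.normc R).

Definition sqsummable : {pred T -> R[i]} := fun f =>
  `[< exists M : R, forall s : seq T, uniq s ->
      \sum_(t <- s) normc (f t) ^+ 2 <= M >].

Lemma normc_add_sq (x y : R[i]) :
  normc (x + y) ^+ 2 <= 2 * normc x ^+ 2 + 2 * normc y ^+ 2.
Proof.
have := normcD x y; have := normc_ge0 (x + y).
have := normc_ge0 x; have := normc_ge0 y.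
set a := normc x; set b := normc y; set c := normc _ => b0 a0 c0 cab.
have : c ^+ 2 <= (a + b) ^+ 2 by rewrite ler_sqr ?nnegrE// addr_ge0.
have := sqr_ge0 (a - b); nra.
Qed.

Lemma sqsummable_submod : submod_closed sqsummable.
Proof.
split.
  rewrite unfold_in; apply/asboolP; exists 0 => s _.
  by rewrite big1// => t _; rewrite Normc.normc0 expr0n.
move=> k f g; rewrite !unfold_in => /asboolP[M fM] /asboolP[N gN].
apply/asboolP; exists (2 * (normc k ^+ 2 * M) + 2 * N) => s us.
apply: (@le_trans _ _ (\sum_(t <- s) (2 * (normc k ^+ 2 * normc (f t) ^+ 2) +
    2 * normc (g t) ^+ 2))).
  by apply: ler_sum => t _; rewrite -exprMn -Normc.normcM; exact: normc_add_sq.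
rewrite big_split -!mulr_sumr /= lerD// ler_wpM2l//; last exact: gN.
by rewrite ler_wpM2l ?sqr_ge0// fM.
Qed.

Record l2 := L2 { l2_val :> T -> R[i]; _ : l2_val \in sqsummable }.

HB.instance Definition _ := [isSub for l2_val].
HB.instance Definition _ := [Choice of l2 by <:].
HB.instance Definition _ :=
  GRing.isSubmodClosed.Build R[i] _ sqsummable sqsummable_submod.
HB.instance Definition _ := [SubChoice_isSubLmodule of l2 by <:].

Implicit Types x y z : l2.

Definition l2_sq x : R :=
  sup [set r | exists2 s, uniq s & r = \sum_(t <- s) normc (x t) ^+ 2].

Definition l2_norm x : R := Num.sqrt (l2_sq x).

Lemma l2_bound x : exists M : R, forall s : seq T, uniq s ->
  \sum_(t <- s) normc (x t) ^+ 2 <= M.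
Proof. by have /asboolP := valP x. Qed.

Lemma l2_sq_sums x : sums (fun t => (normc (x t) ^+ 2)%:C%C) (l2_sq x)%:C%C.
Proof.
have [M xM] := l2_bound x; apply: sums_nonneg xM => t.
exact: sqr_ge0.
Qed.

Lemma l2_sq_ge0 x : 0 <= l2_sq x.
Proof.
have [M xM] := l2_bound x; apply: sup_ubound.
  by exists M => _ [s us ->]; exact: xM.
by exists [::] => //; rewrite big_nil.
Qed.

Lemma l2_norm_sq x : l2_norm x ^+ 2 = l2_sq x.
Proof. by rewrite sqr_sqrtr// l2_sq_ge0. Qed.

Lemma l2_norm_ge0 x : 0 <= l2_norm x. Proof. exact: sqrtr_ge0. Qed.

Lemma le_l2_norm x s : uniq s -> \sum_(t <- s) normc (x t) ^+ 2 <= l2_norm x ^+ 2.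
Proof.
move=> us; rewrite l2_norm_sq; apply: sup_ubound; last by exists s.
by have [M xM] := l2_bound x; exists M => _ [s' us' ->]; exact: xM.
Qed.

Lemma l2_norm_le x (M : R) : 0 <= M ->
  (forall s, uniq s -> \sum_(t <- s) normc (x t) ^+ 2 <= M ^+ 2) -> l2_norm x <= M.
Proof.
move=> M0 xM; rewrite -ler_sqr ?nnegrE ?l2_norm_ge0// l2_norm_sq.
apply: ge_sup => [|_ [s us ->]]; last exact: xM.
by exists 0, [::] => //; rewrite big_nil.
Qed.

Lemma l2_norm_coord x t : normc (x t) <= l2_norm x.
Proof.
rewrite -ler_sqr ?nnegrE ?normc_ge0 ?l2_norm_ge0//.
by have := @le_l2_norm x [:: t] isT; rewrite big_seq1.
Qed.

(** With p and q the norms of x and y, this is the sum of the inequalities 2pq ab <= q^2 a^2 + p^2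
    b^2 over the coordinates. *)
Lemma l2_sum_mul x y s : uniq s ->
  \sum_(t <- s) normc (x t) * normc (y t) <= l2_norm x * l2_norm y.
Proof.
move=> us; have px := l2_norm_ge0 x; have py := l2_norm_ge0 y.
have [x0|x0] := leP (l2_norm x) 0.
  rewrite big1 ?mulr_ge0// => t _; have := l2_norm_coord x t.
  have := normc_ge0 (x t); move=> ge0 le; have -> : normc (x t) = 0 by lra.
  by rewrite mul0r.
have [y0|y0] := leP (l2_norm y) 0.
  rewrite big1 ?mulr_ge0// => t _; have := l2_norm_coord y t.
  have := normc_ge0 (y t); move=> ge0 le; have -> : normc (y t) = 0 by lra.
  by rewrite mulr0.
set p := l2_norm x in px x0 *; set q := l2_norm y in py y0 *.
rewrite -(ler_pM2l (_ : 0 < 2 * (p * q))) ?mulr_gt0// mulr_sumr.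
apply: (@le_trans _ _ (\sum_(t <- s) (q ^+ 2 * normc (x t) ^+ 2 +
    p ^+ 2 * normc (y t) ^+ 2))).
  apply: ler_sum => t _; have := sqr_ge0 (q * normc (x t) - p * normc (y t)).
  nra.
rewrite big_split -!mulr_sumr /=.
have := ler_wpM2l (sqr_ge0 q) (le_l2_norm x us).
have := ler_wpM2l (sqr_ge0 p) (le_l2_norm y us).
rewrite -/p -/q; nra.
Qed.

Lemma l2_normD x y : (l2_norm (x + y))%:C%C <= (l2_norm x)%:C%C + (l2_norm y)%:C%C :> R[i].
Proof.
rewrite -rmorphD lecR; apply: l2_norm_le => [|s us].
  by rewrite addr_ge0// l2_norm_ge0.
apply: (@le_trans _ _ (\sum_(t <- s) (normc (x t) ^+ 2 +
    (2 * (normc (x t) * normc (y t)) + normc (y t) ^+ 2)))).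
  apply: ler_sum => t _; have := normcD (x t) (y t).
  rewrite [(x + y) t]/(x t + y t).
  have := normc_ge0 (x t + y t); have := normc_ge0 (x t); have := normc_ge0 (y t).
  nra.
have -> : (l2_norm x + l2_norm y) ^+ 2 =
  l2_norm x ^+ 2 + 2 * (l2_norm x * l2_norm y) + l2_norm y ^+ 2 by ring.
rewrite !big_split -mulr_sumr /= addrA.
apply: lerD; last exact: le_l2_norm.
by apply: lerD; [exact: le_l2_norm|rewrite ler_wpM2l// l2_sum_mul].
Qed.

Lemma l2_normZ_le k x : l2_norm (k *: x) <= normc k * l2_norm x.
Proof.
apply: l2_norm_le => [|s us]; first by rewrite mulr_ge0 ?normc_ge0 ?l2_norm_ge0.
rewrite exprMn (eq_bigr (fun t => normc k ^+ 2 * normc (x t) ^+ 2)) => [|t _].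
  by rewrite -mulr_sumr ler_wpM2l ?sqr_ge0 ?le_l2_norm.
by rewrite -exprMn -Normc.normcM.
Qed.

Lemma l2_normZ k x : (l2_norm (k *: x))%:C%C = `|k| * (l2_norm x)%:C%C :> R[i].
Proof.
rewrite Defs.normcE -rmorphM; congr (_%:C%C).
apply/eqP; rewrite eq_le l2_normZ_le /=.
have [->|k0] := eqVneq k 0; first by rewrite Normc.normc0 mul0r l2_norm_ge0.
have nk0 : 0 < normc k.
  rewrite lt_neqAle normc_ge0 andbT eq_sym; apply: contra k0 => /eqP.
  by move=> /Normc.eq0_normc ->.
rewrite mulrC -ler_pdivlMr// -Normc.normcV mulrC.
by rewrite (le_trans _ (l2_normZ_le _ _))// scalerA mulVf// scale1r.
Qed.

Lemma l2_eq x y : x =1 y -> x = y.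
Proof. by move=> xy; apply: val_inj; apply/funext. Qed.

Lemma l2_norm0_eq0 x : (l2_norm x)%:C%C = 0 :> R[i] -> x = 0.
Proof.
move=> [x0]; apply: l2_eq => t; apply: Normc.eq0_normc; apply/eqP.
by rewrite eq_le normc_ge0 andbT -x0 l2_norm_coord.
Qed.

HB.instance Definition _ := Lmodule_isNormed.Build R[i] l2
  l2_normD l2_normZ l2_norm0_eq0.

Lemma l2_normE x : ⟦x⟧ = l2_norm x. Proof. by []. Qed.

Lemma l2_complete (u : nat -> l2) : rcauchy u -> exists l, tends u l.
Proof.
move=> uc.
have /choice[l lP] t : exists l, forall e : R, 0 < e -> exists N, forall n,
    (N <= n)%N -> normc (u n t - l) < e.
  apply: complex_complete => e /uc[K KP]; exists K => m n Km Kn.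
  exact: le_lt_trans (l2_norm_coord (u m - u n) t) (KP _ _ Km Kn).
have close n s (d : R) : 0 < d -> exists K, forall m, (K <= m)%N ->
    \sum_(t <- s) normc (u n t - l t) ^+ 2 <=
    \sum_(t <- s) normc (u n t - u m t) ^+ 2 + d.
  elim: s d => [|t s IH] d d0; first by exists 0%N => m _; rewrite !big_nil add0r ltW.
  have d2 : 0 < d / 2 by rewrite divr_gt0.
  have [K KP] := IH _ d2; set b := normc (u n t - l t).
  have b0 : 0 <= b by exact: normc_ge0.
  have b1 : 0 < 2 * b + 1 by lra.
  have [K' K'P] := lP t _ (divr_gt0 d2 b1).
  exists (maxn K K') => m; rewrite geq_max => /andP[Km K'm].
  rewrite !big_cons -/b; have := KP _ Km; set X := \sum_(_ <- _) _; set Y := \sum_(_ <- _) _.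
  have := K'P _ K'm; rewrite ltr_pdivlMr//.
  have := normcD (u n t - u m t) (u m t - l t); rewrite addrA subrK -/b.
  have := normc_ge0 (u n t - u m t); have := normc_ge0 (u m t - l t).
  set a := normc (u n t - u m t); set c := normc _ => c0 a0 bac cd XY.
  (* Here b - a <= c, and a + b <= 2b in the only case of interest, a <= b. The added 1 keeps the
     factor positive, since c was made small by dividing by it. *)
  have : b ^+ 2 <= a ^+ 2 + c * (2 * b + 1).
    by have [ab|ab] := leP a b; nra.
  lra.
have lim (e : R) : 0 < e -> exists K, forall n, (K <= n)%N -> forall s, uniq s ->
    \sum_(t <- s) normc (u n t - l t) ^+ 2 <= e ^+ 2.
  move=> e0; have [K KP] := uc _ e0; exists K => n Kn s us.
  apply: le_eps => d d0; have [K' K'P] := close n s _ d0.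
  rewrite (le_trans (K'P (maxn K K') (leq_maxr _ _)))// lerD2r.
  rewrite (le_trans (le_l2_norm (u n - u (maxn K K')) us))//.
  rewrite ler_sqr ?nnegrE ?l2_norm_ge0 ?(ltW e0)// ltW//.
  by apply: KP => //; exact: leq_maxl.
have ls : l \in sqsummable.
  have [K KP] := lim 1 ltr01.
  rewrite unfold_in; apply/asboolP; exists (2 * l2_norm (u K) ^+ 2 + 2 * 1) => s us.
  apply: (@le_trans _ _ (\sum_(t <- s) (2 * normc (u K t) ^+ 2 +
      2 * normc (u K t - l t) ^+ 2))).
    apply: ler_sum => t _; rewrite -(normcN (_ - _)).
    by rewrite (le_trans _ (normc_add_sq _ _))// opprB addrC subrK.
  rewrite big_split -!mulr_sumr /= lerD// ler_wpM2l ?le_l2_norm//.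
  by have := KP K (leqnn _) s us; rewrite expr1n.
exists (L2 ls) => e e0; have e2 : 0 < e / 2 by rewrite divr_gt0.
have [K KP] := lim _ e2; exists K => n Kn.
apply: (@le_lt_trans _ _ (e / 2)); last by lra.
by rewrite l2_normE; apply: l2_norm_le => [|s us]; [exact: ltW|exact: KP].
Qed.

HB.instance Definition _ := Uniform_isComplete.Build l2 (complete_filter l2_complete).

(* Polarization reduces convergence to sums of squares. *)
Lemma l2_inner_ex x y : exists w : R[i], sums (fun t => (x t)^* * y t) w.
Proof.
have sq (a : R[i]) : (normc a ^+ 2)%:C%C = a^* * a.
  by rewrite mulrC -normCK Defs.normcE rmorphXn.
pose q (k : R[i]) := (l2_sq (y + k *: x))%:C%C : R[i].
have qs k := l2_sq_sums (y + k *: x).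
have z0 : sums (fun _ : T => 0) (0 : R[i]).
  by move=> e e0; exists [::] => s _ _; rewrite big1// subr0 Normc.normc0.
(* The square norm of [y + k *: x] gets the weight k / 4 for k = 1, -1, i, -i, which leaves only the
   term linear in [y]. *)
have := sums_comb (1 / 4) (qs 1) (sums_comb (- (1 / 4)) (qs (-1))
   (sums_comb ('i%C / 4) (qs 'i%C) (sums_comb (- ('i%C / 4)) (qs (- 'i%C)) z0))).
move=> sw; eexists; apply: eq_sums sw => t; rewrite !sq.
have ii : ('i%C : R[i]) * 'i%C = -1.
  by apply/eqP; rewrite eq_complex /= !mul0r !mul1r sub0r addr0 oppr0 !eqxx.
have E k : (y + k *: x) t = y t + k * x t by [].
rewrite !E !(rmorphD, rmorphM, rmorphN, rmorph1) /= conj_i.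
set I := 'i%C in ii *; set X := x t; set Y := y t; set X' := X^*; set Y' := Y^*.
apply/eqP; rewrite -subr_eq0; apply/eqP.
(* [field] treats [I] as a variable, so the relation I^2 = -1 is isolated in a factor. *)
transitivity ((I * I + 1) / 2 * (Y' * X - X' * Y)); first by field.
by rewrite ii addNr !mul0r.
Qed.

Definition l2_inner x y : R[i] := sval (cid (l2_inner_ex x y)).

Lemma l2_innerP x y : sums (fun t => (x t)^* * y t) (l2_inner x y).
Proof. by rewrite /l2_inner; case: cid. Qed.

Lemma l2_inner_uniq x y w : sums (fun t => (x t)^* * y t) w -> l2_inner x y = w.
Proof. exact: sums_uniq (l2_innerP x y). Qed.

(** A pairing suffices here: only the C*-algebra of adjointable operators on this space is used, as
    a target for the universal property of the group algebra. *)
Definition l2_pairing : pairing l2 R[i]^o.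
Proof.
apply: (@Pairing R l2 R[i]^o l2_inner (fun w : R[i]^o => w^* : R[i]^o)).
- move=> x y; symmetry; apply: l2_inner_uniq.
  apply: eq_sums (sums_conj (l2_innerP x y)) => t.
  by rewrite rmorphM /= conjCK mulrC.
- move=> x k y z; apply: l2_inner_uniq.
  apply: eq_sums (sums_comb k (l2_innerP x y) (l2_innerP x z)) => t.
  by rewrite [(k *: y + z) t]/(k * y t + z t) mulrDr mulrCA.
- move=> k x y z; apply: l2_inner_uniq.
  apply: eq_sums (sums_comb k^* (l2_innerP x z) (l2_innerP y z)) => t.
  by rewrite [(k *: x + y) t]/(k * x t + y t) rmorphD rmorphM /= mulrDl mulrA.
- move=> x y; apply: (sums_le (l2_innerP x y)) => s us.
  apply: le_trans (l2_sum_mul x y us).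
  elim/big_rec2 : _ => [|t a b _ ab]; first by rewrite Normc.normc0.
  by rewrite (le_trans (normcD _ _))// Normc.normcM normc_conj lerD2l.
- move=> x; rewrite l2_normE l2_norm_sq -(normc_real (l2_sq_ge0 x)).
  congr normc; apply: l2_inner_uniq; apply: eq_sums (l2_sq_sums x) => t.
  by rewrite [RHS]mulrC -normCK Defs.normcE rmorphXn.
Defined.

Section Translation.
Context (h h' : T -> T).
Hypotheses (hK : cancel h h') (h'K : cancel h' h).

Lemma l2_shift_subproof x : (fun t => x (h t)) \in sqsummable.
Proof.
rewrite unfold_in; apply/asboolP; have [M xM] := l2_bound x; exists M => s us.
rewrite -(big_map h predT (fun t => normc (x t) ^+ 2)); apply: xM.
by rewrite map_inj_uniq//; exact: can_inj hK.
Qed.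

Definition l2_shift x : l2 := L2 (l2_shift_subproof x).

Lemma l2_shift_le x : ⟦l2_shift x⟧ <= 1 * ⟦x⟧.
Proof.
rewrite mul1r !l2_normE; apply: l2_norm_le => [|s us]; first exact: l2_norm_ge0.
rewrite -(big_map h predT (fun t => normc (x t) ^+ 2)); apply: le_l2_norm.
by rewrite map_inj_uniq//; exact: can_inj hK.
Qed.

End Translation.

Lemma l2_shift_adj h h' (hK : cancel h h') (h'K : cancel h' h) x y :
  pip l2_pairing (l2_shift hK x) y = pip l2_pairing x (l2_shift h'K y).
Proof.
apply: l2_inner_uniq => /=.
apply: eq_sums (sums_reindex hK h'K (l2_innerP x (l2_shift h'K y))) => t /=.
by rewrite hK.
Qed.

Lemma l2_shift_adjointable h h' (hK : cancel h h') (h'K : cancel h' h) :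
  l2_shift hK \in adjointable l2_pairing.
Proof.
rewrite unfold_in; apply/asboolP; split.
  by exists (l2_shift h'K) => x y; exact: l2_shift_adj.
by exists 1 => // x; exact: l2_shift_le.
Qed.

Definition l2_shift_op h h' (hK : cancel h h') (h'K : cancel h' h) :
  adjop l2_pairing := AdjOp (l2_shift_adjointable hK h'K).

Lemma l2_shift_op_star h h' (hK : cancel h h') (h'K : cancel h' h) :
  star (l2_shift_op hK h'K) = l2_shift_op h'K hK.
Proof. by apply/adjop_eq/adjop_adj_uniq => x y; exact: l2_shift_adj. Qed.

Lemma delta_sqsummable (t : T) : (fun s => if s == t then 1 else 0) \in sqsummable.
Proof.
rewrite unfold_in; apply/asboolP; exists 1 => s us.
have [ts|ts] := boolP (t \in s); last first.
  rewrite big_seq big1// => r rs; case: eqP => [rt|_]; last by rewrite Normc.normc0 expr0n.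
  by move: ts; rewrite -rt rs.
rewrite (bigD1_seq t)//= eqxx big1 => [|r /negPf ->]; last by rewrite Normc.normc0 expr0n.
by rewrite addr0 Normc.normc1 expr1n.
Qed.

Definition l2_delta (t : T) : l2 := L2 (delta_sqsummable t).

End SquareSummable.

Section RegularRepresentation.
Context {R : realType} {G : groupType}.

Definition translation (g : G) : adjop (@l2_pairing R G) :=
  @l2_shift_op R G (fun t => g^-1 * t)%g (fun t => g * t)%g (mulVKg g) (mulKg g).

Lemma translation_rep : unitary_rep translation.
Proof.
have tE g x t : translation g x t = x (g^-1 * t)%g by [].
split.
- by move=> f; split; apply: adjop_eq => x; [apply: l2_eq => t|congr (f _); apply: l2_eq => t];
   rewrite /= invg1 mul1g.
- by move=> s t; apply: adjop_eq => x; apply: l2_eq => r; rewrite /= invgM mulgA.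
- move=> t; rewrite l2_shift_op_star; apply: adjop_eq => x; apply: l2_eq => r.
  by rewrite /= invgK.
Qed.

(** The left regular representation separates group elements, because it moves the unit vector at 1
    to the unit vector at s. This is what allows group elements in the second tensor factor to be
    told apart. *)
Lemma group_calg_inj (CG : cstarAlgType R) (u : G -> CG) :
  is_group_calg u -> injective u.
Proof.
move=> uCG s t ust.
have [phi [_ phiu]] := group_univ uCG translation_rep.
have : translation s (@l2_delta R G 1%g) s = translation t (@l2_delta R G 1%g) s.
  by rewrite -!phiu ust.
rewrite /= mulVg eqxx; case: eqP => [ts _|_ /eqP]; last by rewrite oner_eq0.
by rewrite -(mulVKg t s) ts mulg1.
Qed.

End RegularRepresentation.

(** * The covariant representation in M(B) *)

Lemma mult_one_star (R : realType) (A : cstarAlgType R) :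
  star mult_one = mult_one :> multiplier A.
Proof. by apply: multiplier_eq => x; rewrite [LHS]lact_star starK. Qed.

Lemma mult_oneM (R : realType) (A : cstarAlgType R) :
  mult_one ** mult_one = mult_one :> multiplier A.
Proof. exact: (mult_one_unit _).1. Qed.

Lemma star_hom_comp (R : realType) (A B C : cstarAlgType R) (f : A -> B) (h : B -> C) :
  star_hom f -> star_hom h -> star_hom (h \o f).
Proof.
move=> fh hh; have fl := star_hom_linear fh; have hl := star_hom_linear hh.
split=> [k x y|x y|x] /=.
- by rewrite (linD fl) (linZ fl) (linD hl) (linZ hl).
- by rewrite (star_homM fh) (star_homM hh).
- by rewrite (star_homV fh) (star_homV hh).
Qed.

Lemma star_hom_conj (R : realType) (A B : cstarAlgType R) (f : A -> multiplier B)
    (W : multiplier B) : star_hom f -> star W ** W = mult_one ->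
  star_hom (fun a => W ** f a ** star W).
Proof.
move=> fh WW; have fl := star_hom_linear fh; split=> [k x y|x y|x] /=.
- by rewrite (linD fl) (linZ fl) amul_linearr amul_linearl.
- rewrite (star_homM fh) !amulA -(amulA _ (star W) W) WW.
  by rewrite (mult_one_unit _).2.
- by rewrite (star_homV fh) !starM starK amulA.
Qed.

Lemma mtensor_one_hom (R : realType) (B C : cstarAlgType R) (T : spatial_tensor B C) :
  star_hom (fun m => mtensor T m mult_one).
Proof.
split=> [|m n|m]; first exact: mtensor_linearl.
- by rewrite mtensorM mult_oneM.
- by rewrite mtensorV mult_one_star.
Qed.

Lemma orth_sum_projection (R : realType) (A : cstarAlgType R) (I : eqType)
    (e : I -> A) (r : seq I) : uniq r -> (forall i, projection (e i)) ->
  (forall i j, i <> j -> e i ** e j = 0) ->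
  projection (\sum_(i <- r) e i) /\
  forall j, (\sum_(i <- r) e i) ** e j = if j \in r then e j else 0.
Proof.
move=> ur pe oe.
have sumE j : (\sum_(i <- r) e i) ** e j = if j \in r then e j else 0.
  rewrite amul_suml; case: ifPn => jr.
    rewrite (bigD1_seq j)//= (pe j).1 big1 ?addr0// => i /eqP ij.
    exact: oe.
  rewrite big_seq big1// => i ir; apply: oe => ij.
  by move: jr; rewrite -ij ir.
split=> //; split; last by rewrite star_sum; apply: eq_bigr => i _; exact: (pe i).2.
by rewrite {2}big_seq amul_sumr [RHS]big_seq; apply: eq_bigr => j jr; rewrite sumE jr.
Qed.

Section C0Functions.
Context {R : realType} {T : choiceType}.

Lemma chiE (t r : T) : (chi t : C0 R T) r = (if r == t then 1 else 0).
Proof. by []. Qed.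

Lemma C0M (f g : C0 R T) r : (f ** g) r = f r * g r.
Proof. by []. Qed.

Lemma C0V (f : C0 R T) r : (star f) r = (f r)^*.
Proof. by []. Qed.

Lemma chi_mul (t t' : T) : chi t ** chi t' = (if t == t' then chi t else 0) :> C0 R T.
Proof.
apply: C0_eq => r; rewrite C0M !chiE.
have [<-|tt'] := eqVneq t t'.
  by rewrite chiE; case: ifP => _; rewrite ?mulr1 ?mulr0.
case: ifP => [/eqP ->|_]; last by rewrite mul0r.
by rewrite (negPf tt') mulr0.
Qed.

Lemma chi_proj (t : T) : projection (chi t : C0 R T).
Proof.
split; first by rewrite chi_mul eqxx.
apply: C0_eq => r; rewrite C0V !chiE.
by case: ifP => _; rewrite ?rmorph1 ?conjC0.
Qed.

Lemma chi_dense (f : C0 R T) : approx (span chi) f.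
Proof.
move=> e e0; have e2 : 0 < e / 2 by rewrite divr_gt0.
have /finite_seqP[s sE] : finite_set [set t | (e / 2)%:C%C <= `|f t|].
  by apply: C0P; rewrite ltcR.
exists (comb chi [seq (f t, t) | t <- undup s]); first by eexists.
apply: (@le_lt_trans _ _ (e / 2)); last by lra.
apply: C0_sup_le => [|t]; first exact: ltW.
have -> : (f - comb chi [seq (f t, t) | t <- undup s]) t = if t \in s then 0 else f t.
  rewrite -[LHS]/(f t - (comb chi [seq (f t, t) | t <- undup s] : C0 R T) t).
  have -> : (comb chi [seq (f t, t) | t <- undup s] : C0 R T) t =
      \sum_(r <- undup s) f r * (if t == r then 1 else 0).
    rewrite /comb big_map; elim/big_rec2 : _ => [//|r a b _ <-].
    by [].
  case: ifPn => ts.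
    rewrite (bigD1_seq t) ?undup_uniq ?mem_undup//= eqxx mulr1 big1 ?addr0 ?subrr//.
    by move=> r /negPf rt; rewrite eq_sym rt mulr0.
  rewrite big_seq big1 ?subr0// => r; rewrite mem_undup => rs.
  by case: eqP => [tr|_]; [move: ts; rewrite tr rs|rewrite mulr0].
case: ifPn => ts; first by rewrite Normc.normc0 ltW.
have : ~ [set t | (e / 2)%:C%C <= `|f t|] t by rewrite sE /=; apply/negP.
by rewrite /= Defs.normcE lecR => /negP; rewrite -ltNge => /ltW.
Qed.

End C0Functions.

Section TensorDense.
Context {R : realType} {B C : cstarAlgType R} (T : spatial_tensor B C).
Context (e : C).
Hypotheses (eu : is_unit e) (se : star e = e).

(** Tensoring with the unit is a *-homomorphism, hence contractive, and b (x) c is the image of b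
    (x) e under the multiplier 1 (x) c. Continuity in b follows without computing the norm of an
    elementary tensor. *)
Lemma tensor_unit_bound (b : B) (c : C) :
  ⟦tensor T b c⟧ <= ⟦mtensor T mult_one (to_mult c)⟧ * ⟦b⟧.
Proof.
have eh : star_hom (fun b => tensor T b e).
  split=> [|x y|x]; first exact: tensor_linearl.
    by rewrite tensor_mul (eu e).1.
  by rewrite tensor_star se.
have -> : tensor T b c = lact (mtensor T mult_one (to_mult c)) (tensor T b e).
  by rewrite mtensorE lact_to_mult (eu c).2.
rewrite (le_trans (lact_le _ _))// ler_wpM2l ?rnorm_ge0//.
exact: (star_hom_contractive b eh).
Qed.

Lemma tensor_dense_left (I : Type) (g : I -> B) : (forall x, approx (span g) x) ->
  forall z, approx (span (fun p : I * C => tensor T (g p.1) p.2)) z.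
Proof.
move=> gd z; apply: approx_idem; move: z.
have sub : span (tens T) `<=` approx (span (fun p : I * C => tensor T (g p.1) p.2)).
  apply: span_min.
  - by apply: subset_approx; exists [::]; rewrite /comb big_nil.
  - apply: approx_submod; first by exists [::]; rewrite /comb big_nil.
    by move=> k x y; exact: span_lin.
  - move=> [b c]; apply: (approx_lip (F := fun b => tensor T b c)
      (C := ⟦mtensor T mult_one (to_mult c)⟧) _ _ (gd b)) => [x y|_ [l ->]].
      by rewrite -(linB (tensor_linearl T c)) tensor_unit_bound.
    apply: subset_approx; rewrite (lin_comb _ _ (tensor_linearl T c)).
    exists [seq (p.1, (p.2, c)) | p <- l]; rewrite /comb big_map.
    by [].
by move=> z; apply: approxS sub _ (tens_dense z).
Qed.

End TensorDense.

Lemma nondegenerateP (R : realType) (A B : cstarAlgType R) (pi : A -> multiplier B) :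
  Defs.nondegenerate pi <->
  forall x, approx (span (fun i : A * B => lact (pi i.1) i.2)) x.
Proof.
have E := @lin_spanE R B [set b' | exists a b, b' = lact (pi a) b] (A * B)
  (fun i => lact (pi i.1) i.2).
rewrite -E; first exact: denseP.
apply/seteqP; split=> y; first by move=> [a [b ->]]; exists (a, b).
by move=> [[a b] _ <-]; exists a, b.
Qed.

(** * Vertex, edge and function sums in the multipliers of the skew-product algebra *)

Section SkewProductFamily.
Context {R : realType} {G : groupType} {E : digraph} {c : edge E -> G}.
Hypothesis Ef : row_finite E.

Lemma skew_row_finite : row_finite (skew_product c).
Proof.
move=> [v r]; apply: (@sub_finite_set _ _
  ((fun f => (f, ((c f)^-1 * r)%g)) @` [set f | src f = v])).
  by move=> [f t] [/= sf ct]; exists f => //; rewrite -ct mulKg.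
exact: finite_image.
Qed.

Context {B : cstarAlgType R}.
Context {sB : edge (skew_product c) -> B} {pB : vertex (skew_product c) -> B}.
Hypothesis cB : is_graph_calg sB pB.

Let ck := graph_ck cB.
Let rf := skew_row_finite.
Local Notation I := (vertex (skew_product c) * B)%type.
Let g (i : I) : B := pB i.1 ** i.2.

Let gd : forall x, approx (span g) x.
Proof. exact: (graph_dense rf cB). Qed.

Let pB_sum (r : seq (vertex (skew_product c))) : uniq r ->
  projection (\sum_(x <- r) pB x) /\
  forall y, (\sum_(x <- r) pB x) ** pB y = if y \in r then pB y else 0.
Proof. by move=> ur; apply: orth_sum_projection (ck_proj ck) (ck_orth ck). Qed.

(** The multiplier is the sum of the p_(v,t) over all t in G. Finitely many of its terms act on a
    given finite list of generators, and their sum is a projection. *)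
Lemma vertex_sum_ex (v : vertex E) : exists m : multiplier B,
  [/\ forall i, lact m (g i) = if i.1.1 == v then g i else 0,
      forall i, lact (star m) (g i) = if i.1.1 == v then g i else 0 & ⟦m⟧ <= 1].
Proof.
apply: (mult_local gd ler01) => r.
pose L : seq (vertex (skew_product c)) := undup [seq x <- [seq i.1 | i <- r] | x.1 == v].
have [pL LE] := pB_sum (undup_uniq _ : uniq L).
exists (to_mult (\sum_(x <- L) pB x)); split.
  by rewrite norm_to_mult rnorm_proj.
move=> i ir; rewrite -(star_homV to_mult_star_hom) pL.2 lact_to_mult /g amulA LE.
have -> : (i.1 \in L) = (i.1.1 == v).
  by rewrite mem_undup mem_filter (map_f fst ir) andbT.
by case: ifP => _; rewrite ?mul0a.
Qed.

Lemma edge_sum_ex (f : edge E) : exists m : multiplier B,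
  [/\ forall i, lact m (g i) = if i.1.1 == rng f then sB (f, i.1.2) ** i.2 else 0,
      forall i, lact (star m) (g i) =
        if i.1.1 == src f then star (sB (f, ((c f)^-1 * i.1.2)%g)) ** i.2 else 0 &
      ⟦m⟧ <= 1].
Proof.
apply: (mult_local gd ler01) => r.
(* On p_(w,t) the sum of the s_(f,t) acts through the index t, but its adjoint acts through c(f)^-1
   t, because (f,r) has source (s(f), c(f)r); the finite sum must contain both indices. *)
pose L : seq G := undup ([seq i.1.2 | i <- r] ++ [seq ((c f)^-1 * i.1.2)%g | i <- r]).
have uL : uniq L := undup_uniq _.
pose S := \sum_(t <- L) sB (f, t).
exists (to_mult S); split.
  rewrite norm_to_mult -(@expr_le1 _ 2) ?rnorm_ge0// -rnorm_cstar rnorm_proj//.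
  (* Distinct edges have orthogonal ranges, so the partial sum is a partial isometry whose initial
     projection is a sum of vertex projections. *)
  have -> : star S ** S = \sum_(x <- [seq (rng f, t) | t <- L]) pB x.
    rewrite /S star_sum amul_suml big_map; apply: eq_big_seq => t tL.
    rewrite amul_sumr (bigD1_seq t)//= (ck_rng ck) big1 ?addr0// => t' tt'.
    rewrite (ck_starM_eq0 rf ck)// => -[E1].
    by move: tt'; rewrite E1 eqxx.
  apply: (pB_sum _).1; rewrite map_inj_uniq// => t t' [].
  exact.
move=> [[v t] b] ir; rewrite /g /= -(star_homV to_mult_star_hom) !lact_to_mult.
split.
  have tL : t \in L.
    by rewrite mem_undup mem_cat (map_f (fun i : I => i.1.2) ir).
  rewrite amulA /S amul_suml; case: eqP => [->|vf].
    rewrite (bigD1_seq t)//= (ck_rngM ck (f, t)) big1 ?addr0// => t' tt'.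
    by rewrite (ck_rngM0 ck)// => -[E1]; move: tt'; rewrite E1 eqxx.
  by rewrite big1 ?mul0a// => t' _; rewrite (ck_rngM0 ck)// => -[].
set t1 := ((c f)^-1 * t)%g.
have tL : t1 \in L.
  rewrite mem_undup mem_cat; apply/orP; right.
  by apply/mapP; exists ((v, t), b).
rewrite amulA /S star_sum amul_suml; case: eqP => [->|vf].
  rewrite (bigD1_seq t1)//= big1 ?addr0 => [|t' tt'].
    rewrite -(ck_proj ck _).2 -starM -{1}(mulVKg (c f) t).
    by rewrite (ck_srcM rf ck (f, t1)).
  rewrite -(ck_proj ck _).2 -starM (ck_srcM0 rf ck) ?star0// => -[] E1.
  by move: tt'; rewrite /t1 E1 mulKg eqxx.
by rewrite big1 ?mul0a// => t' _; rewrite -(ck_proj ck _).2 -starM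
  (ck_srcM0 rf ck) ?star0// => -[].
Qed.

Lemma function_sum_ex (f : C0 R G) : exists m : multiplier B,
  [/\ forall i, lact m (g i) = f i.1.2 *: g i,
      forall i, lact (star m) (g i) = (f i.1.2)^* *: g i & ⟦m⟧ <= ⟦f⟧].
Proof.
apply: (mult_local gd (rnorm_ge0 f)) => r.
pose L : seq (vertex (skew_product c)) := undup [seq i.1 | i <- r].
have uL : uniq L := undup_uniq _.
pose S (h : C0 R G) := \sum_(x <- L) h x.2 *: pB x.
have SE h y : S h ** pB y = if y \in L then h y.2 *: pB y else 0.
  rewrite /S amul_suml; case: ifPn => yL.
    rewrite (bigD1_seq y)//= amulZl (ck_proj ck _).1 big1 ?addr0// => x /eqP xy.
    by rewrite amulZl (ck_orth ck)// scaler0.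
  rewrite big_seq big1// => x xL; rewrite amulZl (ck_orth ck) ?scaler0// => xy.
  by move: yL; rewrite -xy xL.
have SV h : star (S h) = S (star h).
  rewrite star_sum; apply: eq_bigr => x _.
  by rewrite starZ (ck_proj ck _).2.
(* For a fixed finite set of vertices the weighted sum is a *-homomorphism of the function, so
   contractivity bounds it by the sup norm. *)
have Sh : star_hom S.
  split=> // [k x y|x y].
    rewrite /S scaler_sumr -big_split; apply: eq_bigr => z _ /=.
    by rewrite scalerA -scalerDl.
  transitivity (\sum_(z <- L) S x ** (y z.2 *: pB z)); last by rewrite -amul_sumr.
  by apply: eq_big_seq => z zL; rewrite amulZr SE zL scalerA mulrC.
exists (to_mult (S f)); split.
  by rewrite norm_to_mult (star_hom_contractive _ Sh).
move=> i ir; have iL : i.1 \in L by rewrite mem_undup (map_f fst ir).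
rewrite -(star_homV to_mult_star_hom) !lact_to_mult /g !amulA SV !SE iL !amulZl.
by [].
Qed.

Definition vertex_sum v : multiplier B := sval (cid (vertex_sum_ex v)).
Definition edge_sum f : multiplier B := sval (cid (edge_sum_ex f)).
Definition function_sum f : multiplier B := sval (cid (function_sum_ex f)).

Lemma vertex_sumE v x b :
  lact (vertex_sum v) (pB x ** b) = if x.1 == v then pB x ** b else 0.
Proof. by rewrite /vertex_sum; case: cid => m [/= /(_ (x, b))]. Qed.

Lemma vertex_sumV v : star (vertex_sum v) = vertex_sum v.
Proof.
apply: (mult_eq_dense gd) => i; rewrite vertex_sumE.
by rewrite /vertex_sum; case: cid => m [_ /= /(_ i)].
Qed.

Lemma edge_sumE f x b :
  lact (edge_sum f) (pB x ** b) = if x.1 == rng f then sB (f, x.2) ** b else 0.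
Proof. by rewrite /edge_sum; case: cid => m [/= /(_ (x, b))]. Qed.

Lemma edge_sumVE f x b : lact (star (edge_sum f)) (pB x ** b) =
  if x.1 == src f then star (sB (f, ((c f)^-1 * x.2)%g)) ** b else 0.
Proof. by rewrite /edge_sum; case: cid => m [_ /= /(_ (x, b))]. Qed.

Lemma function_sumE f x b : lact (function_sum f) (pB x ** b) = f x.2 *: (pB x ** b).
Proof. by rewrite /function_sum; case: cid => m [/= /(_ (x, b))]. Qed.

Lemma function_sumV f : star (function_sum f) = function_sum (star f).
Proof.
apply: (mult_eq_dense gd) => i; rewrite function_sumE.
by rewrite /function_sum; case: cid => m [_ /= /(_ i)].
Qed.

Lemma function_sum_hom : star_hom function_sum.
Proof.
split=> [k f h|f h|f]; last by rewrite function_sumV.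
  apply: (mult_eq_dense gd) => i; rewrite function_sumE lact_comb !function_sumE.
  by rewrite scalerA -scalerDl.
apply: (mult_eq_dense gd) => i; rewrite function_sumE lactM !function_sumE.
by rewrite (linZ (@lact_linear R B _)) function_sumE scalerA mulrC.
Qed.

Lemma edge_sum_sB f t b : lact (star (edge_sum f)) (sB (f, t) ** b) = pB (rng f, t) ** b.
Proof.
rewrite -(ck_srcM rf ck) -amulA edge_sumVE /= eqxx mulKg amulA.
by rewrite (ck_rng ck).
Qed.

Lemma edge_sum_sBV f t b : lact (edge_sum f) (star (sB (f, t)) ** b) =
  sB (f, t) ** (star (sB (f, t)) ** b).
Proof.
rewrite -{1}(ck_rngM ck (f, t)) starM (ck_proj ck _).2 -amulA edge_sumE /=.
by rewrite eqxx.
Qed.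

(** Compressed to (v,t) this is the relation of the skew product there: its edges are the (f,
    c(f)^-1 t) with f leaving v, so (v,t) is not a sink when v is not. *)
Lemma edge_sum_src v : ~ sink v ->
  vertex_sum v = \sum_(f \in [set f | src f = v]) (edge_sum f ** star (edge_sum f)).
Proof.
move=> ns; rewrite fsbig_finite//; apply: (mult_eq_dense gd) => -[[w t] b].
rewrite (lin_sum (@lact_app_linear R B _)) [LHS]vertex_sumE /=.
case: eqP => [->|wv]; last first.
  rewrite big_seq big1// => f; rewrite in_fset_set// inE /= => fv.
  rewrite lactM /g edge_sumVE /=.
  case: eqP => [wf|_]; first by case: wv; rewrite wf.
  exact: (lin0 (@lact_linear R B _)).
have nst : ~ sink ((v, t) : vertex (skew_product c)).
  by move=> sv; apply: ns => f fv; apply: (sv (f, ((c f)^-1 * t)%g)) => /=; rewrite fv mulVKg.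
rewrite (ck_src ck nst).
rewrite (@reindex_fsbig _ _ _ _ _ (fun f : edge E => (f, ((c f)^-1 * t)%g) : edge (skew_product c))
  [set f | src f = v]) /=; last first.
  split.
  - by move=> f /= ->; rewrite mulVKg.
  - by move=> f f' _ _ [].
  - by move=> [f r] /= [fv ct]; exists f => //; rewrite -ct mulKg.
rewrite fsbig_finite// amul_suml; apply: eq_big_seq => f; rewrite in_fset_set// inE /= => fv.
by rewrite lactM /g edge_sumVE /= fv eqxx edge_sum_sBV amulA.
Qed.

End SkewProductFamily.

Section SkewProductCovariance.
Context {R : realType} {TP : forall A B : cstarAlgType R, spatial_tensor A B}.
Context {G : groupType} {CG : cstarAlgType R} {u : G -> CG}.
Hypothesis uCG : is_group_calg u.
Context {E : digraph} {c : edge E -> G}.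
Hypothesis Ef : row_finite E.
Context {B : cstarAlgType R}.
Context {sB : edge (skew_product c) -> B} {pB : vertex (skew_product c) -> B}.
Hypothesis cB : is_graph_calg sB pB.

Let ck := graph_ck cB.
Let rf : row_finite (skew_product c) := skew_row_finite Ef.
Let ru := group_urep uCG.
Local Notation I := (vertex (skew_product c) * B)%type.
Local Notation g := (fun i : I => pB i.1 ** i.2).
Local Notation Q := (vertex_sum Ef cB).
Local Notation T := (edge_sum Ef cB).
Local Notation mu := (function_sum Ef cB).

Let gd : forall x, approx (span g) x.
Proof. exact: (graph_dense rf cB). Qed.

Let u1 : star (u 1%g) = u 1%g.
Proof. by rewrite (urep_star ru) invg1. Qed.

Lemma multiplier_ck : ck_family T Q.
Proof.
have rngE f : star (T f) ** T f = Q (rng f).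
  apply: (mult_eq_dense gd) => -[[w t] b]; rewrite lactM edge_sumE vertex_sumE /=.
  case: eqP => [->|_]; last exact: (lin0 (@lact_linear R B _)).
  by rewrite edge_sum_sB.
split=> [f|v|v w vw|//|v ns].
- rewrite /partial_isometry -amulA rngE; apply: (mult_eq_dense gd) => -[[w t] b].
  rewrite lactM vertex_sumE edge_sumE /=; case: eqP => [->|_].
    by rewrite edge_sumE /= eqxx.
  exact: (lin0 (@lact_linear R B _)).
- split; last exact: vertex_sumV.
  apply: (mult_eq_dense gd) => -[[w t] b]; rewrite lactM vertex_sumE /=.
  by case: eqP => [->|_]; rewrite ?vertex_sumE ?eqxx//= (lin0 (@lact_linear R B _)).
- apply: (mult_eq_dense gd) => -[[x t] b]; rewrite lactM vertex_sumE /=.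
  case: eqP => [->|_]; last exact: (lin0 (@lact_linear R B _)).
  by rewrite vertex_sumE /=; case: eqP => // /esym.
- exact: edge_sum_src.
Qed.

Local Notation g' := (fun p : I * CG => tensor (TP B CG) (g p.1) p.2).

Let g'd : forall z, approx (span g') z.
Proof. exact: (tensor_dense_left (urep_unit ru) u1 gd). Qed.

(** The multiplier is the sum over t of mu(chi_t) (x) u_t, the image of w_G under mu (x) id. A
    partial sum W0 has W0^* W0 equal to the sum of the projections mu(chi_t) (x) 1, which gives the
    bound 1. *)
Lemma group_shift_ex : exists W : multiplier (TP B CG),
  (forall x b d, lact W (tensor (TP B CG) (pB x ** b) d) =
    tensor (TP B CG) (pB x ** b) (u x.2 ** d)) /\
  (forall x b d, lact (star W) (tensor (TP B CG) (pB x ** b) d) =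
    tensor (TP B CG) (pB x ** b) (u x.2^-1%g ** d)).
Proof.
pose h (p : I * CG) := tensor (TP B CG) (g p.1) (u p.1.1.2 ** p.2).
pose h' (p : I * CG) := tensor (TP B CG) (g p.1) (u p.1.1.2^-1%g ** p.2).
have loc (r : seq (I * CG)) : exists m : multiplier (TP B CG), ⟦m⟧ <= 1 /\
    forall i, i \in r -> lact m (g' i) = h i /\ lact (star m) (g' i) = h' i.
  pose L : seq G := undup [seq i.1.1.2 | i <- r].
  have uL : uniq L := undup_uniq _.
  have mh := function_sum_hom Ef cB.
  have muM t t' : mu (chi t) ** mu (chi t') = if t == t' then mu (chi t) else 0.
    rewrite -(star_homM mh) chi_mul; case: ifP => // _.
    exact: (lin0 (star_hom_linear mh)).
  have mup t : projection (mu (chi t)).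
    by split; rewrite ?muM ?eqxx// -(star_homV mh) (chi_proj t).2.
  pose P t : multiplier (TP B CG) := mtensor (TP B CG) (mu (chi t)) mult_one.
  have pP t : projection (P t).
    by split; rewrite /P ?mtensorM ?mtensorV ?mult_oneM ?mult_one_star ?(mup t).1 ?(mup t).2.
  have oP t t' : t <> t' -> P t ** P t' = 0.
    move=> /eqP/negPf tt'; rewrite /P mtensorM muM tt'.
    exact: (lin0 (mtensor_linearl _)).
  pose S : multiplier (TP B CG) :=
    \sum_(t <- L) mtensor (TP B CG) (mu (chi t)) (to_mult (u t)).
  have SV : star S = \sum_(t <- L) mtensor (TP B CG) (mu (chi t)) (to_mult (u t^-1%g)).
    rewrite star_sum; apply: eq_bigr => t _.
    by rewrite mtensorV (mup t).2 -(star_homV to_mult_star_hom) (urep_star ru).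
  have lactS (v : G -> CG) i : i \in r ->
      lact (\sum_(t <- L) mtensor (TP B CG) (mu (chi t)) (to_mult (v t))) (g' i) =
      tensor (TP B CG) (g i.1) (v i.1.1.2 ** i.2).
    move=> ir; rewrite (lin_sum (@lact_app_linear R (TP B CG) _)).
    have iL : i.1.1.2 \in L by rewrite mem_undup (map_f (fun i : I * CG => i.1.1.2) ir).
    rewrite (bigD1_seq i.1.1.2)//= big1 => [|t tt']; rewrite mtensorE function_sumE chiE.
      by rewrite eqxx scale1r addr0 lact_to_mult.
    by rewrite eq_sym (negPf tt') scale0r tensor0l.
  exists S; split.
    rewrite -(@expr_le1 _ 2) ?rnorm_ge0// -rnorm_cstar rnorm_proj//.
    have -> : star S ** S = \sum_(t <- L) P t.
      rewrite SV /S amul_suml; apply: eq_big_seq => t tL.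
      rewrite amul_sumr (bigD1_seq t)//= big1 => [|t' tt']; rewrite mtensorM muM.
        rewrite eqxx addr0 /P; congr mtensor; apply: multiplier_eq => x.
        by rewrite lactM !lact_to_mult amulA -(urep_mul ru) mulVg (urep_unit ru x).1.
      rewrite eq_sym (negPf tt'); exact: (lin0 (mtensor_linearl _)).
    exact: (orth_sum_projection uL pP oP).1.
  by move=> i ir; rewrite SV !lactS.
have [W [WE WV _]] := mult_local g'd ler01 loc.
exists W; split=> x b d; first exact: (WE ((x, b), d)).
exact: (WV ((x, b), d)).
Qed.

Definition group_shift : multiplier (TP B CG) := sval (cid group_shift_ex).
Local Notation W := group_shift.

Lemma group_shiftE x b d : lact W (tensor (TP B CG) (pB x ** b) d) =
  tensor (TP B CG) (pB x ** b) (u x.2 ** d).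
Proof. by rewrite /group_shift; case: cid => m [/= H _]; exact: H. Qed.

Lemma group_shiftVE x b d : lact (star W) (tensor (TP B CG) (pB x ** b) d) =
  tensor (TP B CG) (pB x ** b) (u x.2^-1%g ** d).
Proof. by rewrite /group_shift; case: cid => m [/= _ H]; exact: H. Qed.

Lemma group_shiftK : star W ** W = mult_one.
Proof.
apply: (mult_eq_dense g'd) => -[[x b] d]; rewrite lactM group_shiftE group_shiftVE.
by rewrite amulA -(urep_mul ru) mulVg (urep_unit ru d).1.
Qed.

Lemma group_shiftVK : W ** star W = mult_one.
Proof.
apply: (mult_eq_dense g'd) => -[[x b] d]; rewrite lactM group_shiftVE group_shiftE.
by rewrite amulA -(urep_mul ru) mulgV (urep_unit ru d).1.
Qed.

Context {A : cstarAlgType R} {s : edge E -> A} {p : vertex E -> A}.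
Hypothesis cA : is_graph_calg s p.
Context {delta : A -> TP A CG}.
Hypothesis delta_hom : star_hom delta.
Hypothesis delta_s : forall f : edge E, delta (s f) = tensor (TP A CG) (s f) (u (c f)).
Hypothesis delta_p : forall v : vertex E, delta (p v) = tensor (TP A CG) (p v) (u 1%g).
Context {w : multiplier (TP (C0 R G) CG)}.
Hypothesis wG : is_wG u w.
Context {rho : A -> multiplier B}.
Hypothesis pih : star_hom rho.
Hypothesis pi_s : forall f, rho (s f) = T f.
Hypothesis pi_p : forall v, rho (p v) = Q v.

Lemma skew_covariant : covariant_rep u delta rho mu.
Proof.
have muh := function_sum_hom Ef cB.
have dns (D : cstarAlgType R) (f : D -> multiplier B) :
    (forall i, exists a, lact (f a) (g i) = g i) -> Defs.nondegenerate f.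
  move=> fg; apply/nondegenerateP => x; apply: approxS (gd x); apply: span_min.
  - by exists [::]; rewrite /comb big_nil.
  - by move=> k y z; exact: span_lin.
  - move=> i; have [a <-] := fg i.
    exact: (span_gen (fun i : D * B => lact (f i.1) i.2) (a, g i)).
split=> //.
- apply: dns => -[[v t] b]; exists (p v).
  by rewrite /= pi_p vertex_sumE /= eqxx.
- apply: dns => -[[v t] b]; exists (chi t).
  by rewrite /= function_sumE chiE eqxx scale1r.
have [pi_id [pi_idh pi_idE]] := hom_tensor_id_ex (TP A CG) (TP B CG) pih.
have [mu_id [mu_idh mu_idE]] := hom_tensor_id_ex (TP (C0 R G) CG) (TP B CG) muh.
exists pi_id, mu_id, w, W; split=> //.
- by split=> // a d; rewrite pi_idE; exact: mtensor_mult.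
- by split=> // a d; rewrite mu_idE; exact: mtensor_mult.
- have ml := star_hom_linear mu_idh.
  have cd := tensor_dense_left (T := TP (C0 R G) CG) (urep_unit ru) u1 chi_dense.
  apply: (dense_linear_eq cd (F := fun a => W ** mu_id a) (G := fun a => mu_id (lact w a))
      (C := ⟦W⟧) (D := ⟦w⟧)) => [k y z|k y z|y|y|[t x]].
  + by rewrite ml amul_linearr.
  + by rewrite (linD (@lact_linear R _ w)) (linZ (@lact_linear R _ w)) ml.
  + by rewrite (le_trans (rnormM _ _))// ler_wpM2l ?rnorm_ge0// star_hom_contractive.
  + by rewrite (le_trans (star_hom_contractive _ mu_idh))// lact_le.
  rewrite wG !mu_idE; apply: (mult_eq_dense g'd) => -[[y b] d] /=.
  rewrite lactM !mtensorE function_sumE chiE !lact_to_mult.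
  case: eqP => [<-|_]; last by rewrite scale0r !tensor0l (lin0 (@lact_linear R _ _)).
  by rewrite scale1r group_shiftE amulA.
move=> a; exists (mtensor (TP B CG) (rho a) mult_one); first exact: mtensor_mult.
have lh := star_hom_comp delta_hom pi_idh.
(* As W is unitary, both sides of the covariance condition are *-homomorphisms in [a]; it remains to
   compare them on generators, where the condition is an intertwining relation. *)
have rh := star_hom_conj (star_hom_comp pih (mtensor_one_hom (TP B CG))) group_shiftK.
apply: (generates_star_hom_eq (graph_gen cA) lh rh) => _ [[f _ <-]|[v _ <-]] /=.
  rewrite delta_s pi_idE pi_s.
  suff E1 : mtensor (TP B CG) (T f) (to_mult (u (c f))) ** W =
      W ** mtensor (TP B CG) (T f) mult_one.
    by rewrite -E1 -amulA group_shiftVK (mult_one_unit _).2.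
  apply: (mult_eq_dense g'd) => -[[[v t] b] d] /=.
  rewrite !lactM group_shiftE !mtensorE edge_sumE lact_to_mult /=.
  case: eqP => [_|_]; last by rewrite !tensor0l (lin0 (@lact_linear R _ _)).
  (* The element s_(f,t) b lies under the vertex (s(f), c(f)t), so W contributes u(c(f)t), which is
     the factor u(c(f)) of the coaction times the u(t) already present. *)
  rewrite -(ck_srcM rf ck) -amulA group_shiftE /= (urep_mul ru) amulA.
  by rewrite !amulA.
rewrite delta_p pi_idE pi_p.
suff E1 : mtensor (TP B CG) (Q v) (to_mult (u 1%g)) ** W =
    W ** mtensor (TP B CG) (Q v) mult_one.
  by rewrite -E1 -amulA group_shiftVK (mult_one_unit _).2.
apply: (mult_eq_dense g'd) => -[[[v' t] b] d] /=.
rewrite !lactM group_shiftE !mtensorE vertex_sumE lact_to_mult /=.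
case: eqP => [->|_]; last by rewrite !tensor0l (lin0 (@lact_linear R _ _)).
by rewrite group_shiftE (urep_unit ru _).1.
Qed.

End SkewProductCovariance.

(** * The Cuntz-Krieger family in the crossed product *)

Lemma to_mult_inj (R : realType) (A : cstarAlgType R) : injective (@to_mult R A).
Proof.
move=> x y xy; apply/eqP; rewrite -subr_eq0; apply/eqP/rnorm0_eq0.
rewrite -norm_to_mult (linB (star_hom_linear to_mult_star_hom)) xy subrr.
by rewrite rnorm0.
Qed.

Lemma dense_ip_inj (R : realType) (A : cstarAlgType R) (I : Type) (g : I -> A) x y :
  (forall z, approx (span g) z) -> (forall i, star (g i) ** x = star (g i) ** y) -> x = y.
Proof.
move=> gd xy; apply: (ip_inj (P := cstar_pairing)) => z /=.
rewrite -[LHS]starK -[RHS]starK; congr star; rewrite !starM !starK.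
apply: (dense_linear_eq gd (amull_linear _) (amull_linear _) (rnormM _) (rnormM _)) => i.
by rewrite -[LHS]starK -[RHS]starK; congr star; rewrite !starM !starK.
Qed.

(** * Commutation relations in a covariant representation *)

Section CovariantRepresentation.
Context {R : realType} {TP : forall A B : cstarAlgType R, spatial_tensor A B}.
Context {G : groupType} {CG : cstarAlgType R} {u : G -> CG}.
Hypothesis uCG : is_group_calg u.
Context {A D : cstarAlgType R} {delta : A -> TP A CG}.
Context {rho : A -> multiplier D} {mu : C0 R G -> multiplier D}.
Hypothesis cov : covariant_rep u delta rho mu.

Let ru := group_urep uCG.
Let muh : star_hom mu := cov_mu cov.
Local Notation X t := (mu (chi t)).

Let u1 : star (u 1%g) = u 1%g.
Proof. by rewrite (urep_star ru) invg1. Qed.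

Lemma cov_chiM t t' : X t ** X t' = if t == t' then X t else 0.
Proof.
rewrite -(star_homM muh) chi_mul; case: ifP => // _.
exact: (lin0 (star_hom_linear muh)).
Qed.

Lemma cov_chiV t : star (X t) = X t.
Proof. by rewrite -(star_homV muh) (chi_proj t).2. Qed.

Lemma cov_chi_dense x : approx (span (fun i : G * D => lact (X i.1) i.2)) x.
Proof.
apply: approx_idem; apply: approxS ((nondegenerateP mu).1 (cov_mu_nondeg cov) x).
set J := span (fun i : G * D => lact (X i.1) i.2); have J0 : J 0 by exists [::]; rewrite /comb big_nil.
have Jl := @span_lin R D (G * D) (fun i : G * D => lact (X i.1) i.2).
apply: span_min; first exact: subset_approx.
  exact: approx_submod.
move=> [f d] /=; apply: (approx_lip (F := fun f => lact (mu f) d) (C := ⟦d⟧) _ _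
  (chi_dense f)) => [h h'|_ [l ->]].
  have -> : lact (mu h) d - lact (mu h') d = lact (mu (h - h')) d.
    by rewrite (linB (star_hom_linear muh)).
  rewrite (le_trans (lact_le _ _))// mulrC ler_wpM2l ?rnorm_ge0//.
  exact: star_hom_contractive.
apply: subset_approx; exists [seq (q.1, (q.2, d)) | q <- l].
rewrite (lin_comb _ _ (star_hom_linear muh)) (lin_comb _ _ (@lact_app_linear R D d)).
by rewrite /comb big_map.
Qed.

Local Notation g' := (fun i : (G * D) * CG =>
  tensor (TP D CG) (lact (X i.1.1) i.1.2) i.2).

Let g'd : forall z, approx (span g') z.
Proof. exact: (tensor_dense_left (urep_unit ru) u1 cov_chi_dense). Qed.

Lemma cov_shift : exists W : multiplier (TP D CG),
  [/\ forall t b d, lact W (tensor (TP D CG) (lact (X t) b) d) =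
        tensor (TP D CG) (lact (X t) b) (u t ** d),
      star W ** W = mult_one &
      forall a k, delta a = tensor (TP A CG) a (u k) ->
        mtensor (TP D CG) (rho a) (to_mult (u k)) ** W =
        W ** mtensor (TP D CG) (rho a) mult_one].
Proof.
have [rho_id [mu_id [w [W [[rih riE] [mih miE] wG ext cE]]]]] := cov_eq cov.
have riE' a d : rho_id (tensor (TP A CG) a d) = mtensor (TP D CG) (rho a) (to_mult d).
  exact: mult_tensor_uniq.
have miE' a d : mu_id (tensor _ a d) = mtensor (TP D CG) (mu a) (to_mult d).
  exact: mult_tensor_uniq.
have WE t b d : lact W (tensor (TP D CG) (lact (X t) b) d) =
    tensor (TP D CG) (lact (X t) b) (u t ** d).
  have := ext (tensor _ (chi t) (u 1%g)); rewrite wG !miE'.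
  rewrite (urep_unit ru _).2 => /(congr1 (fun m => lact m (tensor (TP D CG) b d))).
  by rewrite lactM !mtensorE !lact_to_mult (urep_unit ru _).1.
have WW : star W ** W = mult_one.
  (* The values of [star W] are not known, only those of W; the isometry property is therefore
     verified on inner products of generators. *)
  apply: (mult_eq_dense g'd) => -[[t b] d]; apply: (dense_ip_inj g'd) => -[[t' b'] d'] /=.
  rewrite lactM -lact_adj !WE !tensor_star !tensor_mul !lact_adj !cov_chiV.
  rewrite -!lactM !cov_chiM; case: eqP => [->|_].
    by rewrite starM (urep_star ru) -!amulA (amulA (u _)) -(urep_mul ru) mulVg (urep_unit ru _).1.
  by rewrite [lact 0 b](_ : _ = 0)// amul0 !tensor0l.
exists W; split=> // a k da; have [P1 P1E Wa] := cE a.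
rewrite -riE' -da Wa -!amulA WW (mult_one_unit _).2.
by rewrite (mult_tensor_uniq P1E).
Qed.

(* Slicing the covariance condition at [t]: the two sides carry [u (k r)] and
   [u t] in the second leg, so only [t = k r] survives. *)
Lemma cov_commute a k r : delta a = tensor (TP A CG) a (u k) ->
  rho a ** X r = X (k * r)%g ** rho a.
Proof.
move=> da; have [W [WE WW /(_ a k da) Wa]] := cov_shift.
have zero t r' b : t != (k * r')%g -> lact (X t) (lact (rho a) (lact (X r') b)) = 0.
  move=> tkr; set y := lact (rho a) _.
  have E1 : tensor (TP D CG) y (u (k * r')%g) = lact W (tensor (TP D CG) y (u 1%g)).
    have := congr1 (fun m => lact m (tensor (TP D CG) (lact (X r') b) (u 1%g))) Wa.
    rewrite !lactM WE !mtensorE !lact_to_mult -/y (urep_unit ru _).2.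
    by rewrite -(urep_mul ru).
  have WX : mtensor (TP D CG) (X t) mult_one ** W = W ** mtensor (TP D CG) (X t) mult_one.
    apply: (mult_eq_dense g'd) => -[[t' b'] d] /=; rewrite !lactM WE !mtensorE.
    rewrite -!lactM cov_chiM; case: eqP => [->|_]; first by rewrite WE.
    by rewrite [lact 0 b'](_ : _ = 0)// !tensor0l (lin0 (@lact_linear R _ _)).
  have E2 : tensor (TP D CG) (lact (X t) y) (u (k * r')%g) =
      tensor (TP D CG) (lact (X t) y) (u t).
    have := congr1 (fun z => lact (mtensor (TP D CG) (X t) mult_one) z) E1.
    rewrite -lactM WX lactM !mtensorE WE => ->.
    by rewrite (urep_unit ru _).2.
  (* Injectivity of [u] makes this single element a linearly independent family, as the embedding of
     the algebraic tensor product requires. *)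
  have un : u (k * r')%g - u t != 0.
    rewrite subr_eq0; apply: contra tkr => /eqP/(group_calg_inj uCG) ->.
    exact: eqxx.
  apply: (@tensor_inj _ _ _ (TP D CG) 1 (fun=> lact (X t) y)
    (fun=> u (k * r')%g - u t) _ _ ord0).
    move=> h; rewrite big_ord1 => /eqP; rewrite scaler_eq0 (negPf un) orbF => /eqP h0 i.
    by rewrite ord1.
  by rewrite big_ord1 (linB (tensor_linearr _ _)) E2 subrr.
(* The vector is annihilated by every other characteristic function, and their ranges span a dense
   subspace, so the one at k r' must fix it. *)
have keep r' b : lact (X (k * r')%g) (lact (rho a) (lact (X r') b)) =
    lact (rho a) (lact (X r') b).
  set y := lact (rho a) _; apply: (dense_ip_inj cov_chi_dense) => -[t b'] /=.
  rewrite !lact_adj cov_chiV -lactM cov_chiM; case: eqP => [->//|/eqP tk].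
  by rewrite [lact 0 y](_ : _ = 0)// /y zero.
apply: (mult_eq_dense cov_chi_dense) => -[r' b] /=; rewrite !lactM -[lact (X r) _]lactM.
rewrite cov_chiM; have [->|rr'] := eqVneq r r'; first by rewrite keep.
rewrite [lact 0 b](_ : _ = 0)// (lin0 (@lact_linear R _ _)) zero//.
by apply: contra rr' => /eqP/mulgI ->.
Qed.

End CovariantRepresentation.

Section CrossedProductFamily.
Context {R : realType} {TP : forall A B : cstarAlgType R, spatial_tensor A B}.
Context {G : groupType} {CG : cstarAlgType R} {u : G -> CG}.
Hypothesis uCG : is_group_calg u.
Context {E : digraph} {c : edge E -> G}.
Hypothesis Ef : row_finite E.
Context {A : cstarAlgType R} {s : edge E -> A} {p : vertex E -> A}.
Hypothesis cA : is_graph_calg s p.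
Context {delta : A -> TP A CG}.
Hypothesis delta_s : forall f : edge E, delta (s f) = tensor (TP A CG) (s f) (u (c f)).
Hypothesis delta_p : forall v : vertex E, delta (p v) = tensor (TP A CG) (p v) (u 1%g).
Context {D : cstarAlgType R} {jA : A -> multiplier D} {jG : C0 R G -> multiplier D}.
Hypothesis cov : covariant_rep u delta jA jG.

Let ck := graph_ck cA.
Let jAh : star_hom jA := cov_pi cov.
Let jAl := star_hom_linear jAh.
Let toh := @to_mult_star_hom R D.

Local Notation S f := (jA (s f)).
Local Notation P v := (jA (p v)).
Local Notation X t := (jG (chi t)).

Lemma cross_edge_commute f r : S f ** X r = X (c f * r)%g ** S f.
Proof. exact: (cov_commute uCG cov). Qed.

Lemma cross_vertex_commute v r : P v ** X r = X r ** P v.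
Proof. by rewrite (cov_commute uCG cov (k := 1%g))// mul1g. Qed.

Lemma cross_edge_star_commute f r : star (S f) ** X r = X ((c f)^-1 * r)%g ** star (S f).
Proof.
rewrite -[LHS]starK starM starK (cov_chiV cov) -{1}(mulVKg (c f) r).
by rewrite -cross_edge_commute starM (cov_chiV cov).
Qed.

Context {sD : edge (skew_product c) -> D} {pD : vertex (skew_product c) -> D}.
Hypothesis sDE : forall f r, to_mult (sD (f, r)) = S f ** X r.
Hypothesis pDE : forall v r, to_mult (pD (v, r)) = P v ** X r.

(** The relations are computed in M(D), where the generators factor as products, and pulled back
    along the injective map [to_mult]. The shift of r in the commutation rule is exactly the one
    built into the source map of the skew product. *)
Lemma cross_ck : ck_family sD pD.
Proof.
have PP v : P v ** P v = P v by rewrite -(star_homM jAh) (ck_proj ck _).1.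
have PV v : star (P v) = P v by rewrite -(star_homV jAh) (ck_proj ck _).2.
have XX r : X r ** X r = X r by rewrite (cov_chiM cov) eqxx.
have XV r : star (X r) = X r := cov_chiV cov r.
have rngE f r : star (sD (f, r)) ** sD (f, r) = pD (rng f, r).
  apply: to_mult_inj; rewrite (star_homM toh) (star_homV toh) sDE pDE starM XV.
  rewrite -amulA (amulA (star _)) -(star_homV jAh) -(star_homM jAh) (ck_rng ck).
  by rewrite cross_vertex_commute amulA XX.
split=> [[f r]|[v r]|[v r] [w t] vw|[f r]|[v r] ns] /=.
- rewrite /partial_isometry -amulA rngE; apply: to_mult_inj.
  rewrite (star_homM toh) !sDE pDE -amulA (amulA (X r)) -cross_vertex_commute.
  by rewrite -amulA XX amulA -(star_homM jAh) (ck_rngM ck).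
- split; apply: to_mult_inj; rewrite ?(star_homM toh) ?(star_homV toh) pDE.
    by rewrite -amulA (amulA (X r)) -cross_vertex_commute -amulA XX amulA PP.
  by rewrite starM XV PV cross_vertex_commute.
- apply: to_mult_inj; rewrite (star_homM toh) !pDE (lin0 (star_hom_linear toh)).
  rewrite -amulA (amulA (X r)) -cross_vertex_commute -amulA (cov_chiM cov) amulA.
  case: eqP => [rt|_]; last by rewrite amul0.
  rewrite -(star_homM jAh) (ck_orth ck) ?(lin0 jAl) ?mul0a// => vw'.
  by apply: vw; rewrite rt vw'.
- exact: rngE.
have nsv : ~ sink v.
  by move=> sv; apply: ns => -[f t] [/sv].
apply: to_mult_inj; rewrite pDE (ck_src ck nsv) fsbig_finite// (lin_sum jAl).
rewrite (@reindex_fsbig _ _ _ _ _ (fun f : edge E => (f, ((c f)^-1 * r)%g) : edge (skew_product c))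
  [set f | src f = v]) /=; last first.
  split.
  - by move=> f /= ->; rewrite mulVKg.
  - by move=> f f' _ _ [].
  - by move=> [f t] /= [fv ct]; exists f => //; rewrite -ct mulKg.
rewrite fsbig_finite// (lin_sum (star_hom_linear toh)) amul_suml.
apply: eq_bigr => f _; rewrite (star_homM toh) (star_homV toh) sDE.
(* The characteristic function at c(f)^-1 r, caught between [S f] and its adjoint, moves to the
   right and becomes the one at r, independent of f. *)
rewrite starM XV -amulA (amulA (X _)) XX -cross_edge_star_commute.
by rewrite amulA -(star_homV jAh) -(star_homM jAh).
Qed.

End CrossedProductFamily.

(** * The isomorphism and its equivariance *)

Section IsometricRange.
Context {R : realType} {A B : cstarAlgType R} {phi : A -> B}.
Hypothesis ph : star_hom phi.
Hypothesis phi_iso : forall a, ⟦phi a⟧ = ⟦a⟧.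

Lemma isometric_range_closed d : approx (range phi) d -> range phi d.
Proof.
move=> /approx_seq[v vr vd].
have /choice[a av] n : exists a, phi a = v n by case: (vr n) => a _ <-; exists a.
have pl := star_hom_linear ph.
have [l al] : exists l, tends a l.
  apply: complete_tends => e e0; have e2 : 0 < e / 2 by rewrite divr_gt0.
  have [K KP] := vd _ e2; exists K => m n Km Kn.
  rewrite -phi_iso (linB pl) !av.
  have := rdist_triangle d (v m) (v n); rewrite (rdistC d).
  by have := KP _ Km; have := KP _ Kn; lra.
exists l => //; apply/eqP; rewrite -subr_eq0; apply/eqP/rnorm_eps => e e0.
have e2 : 0 < e / 2 by rewrite divr_gt0.
have [K KP] := vd _ e2; have [K' K'P] := al _ e2; pose N := maxn K K'.
have := KP N (leq_maxl _ _); have := K'P N (leq_maxr _ _).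
rewrite -phi_iso (linB pl) av; have := rdist_triangle (v N) (phi l) d.
by rewrite (rdistC (phi l) (v N)); lra.
Qed.

End IsometricRange.

Lemma graph_dense_right (R : realType) (E : digraph) (A : cstarAlgType R)
    (s : edge E -> A) (p : vertex E -> A) : row_finite E -> is_graph_calg s p ->
  forall a, approx (span (fun i : A * vertex E => i.1 ** p i.2)) a.
Proof.
move=> Ef cA a; have ck := graph_ck cA; rewrite -[a]starK.
apply: (approx_lip (F := star) (C := 1) _ _ (graph_dense Ef cA (star a))) => [x y|].
  by rewrite mul1r -starB rnorm_star.
move=> x sx; apply: subset_approx; move: x sx.
apply: span_min.
- by exists [::]; rewrite /comb big_nil star0.
- by move=> k x y sx sy; rewrite star_semilinear; exact: span_lin.
- move=> [v b]; rewrite /= starM (ck_proj ck _).2.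
  exact: (span_gen (fun i : A * vertex E => i.1 ** p i.2) (star b, v)).
Qed.

Theorem theorem2p4
  (R : realType)
  (TP : forall A B : cstarAlgType R, spatial_tensor A B)
  (G : groupType) (CG : cstarAlgType R) (u : G -> CG)
  (CG_group : is_group_calg u)
  (E : digraph) (E_rf : row_finite E) (c : edge E -> G)
  (A : cstarAlgType R) (s : edge E -> A) (p : vertex E -> A)
  (A_graph : is_graph_calg s p)
  (delta : A -> TP A CG)
  (delta_coact : is_coaction u delta)
  (delta_s : forall f : edge E, delta (s f) = tensor (TP A CG) (s f) (u (c f)))
  (delta_p : forall v : vertex E, delta (p v) = tensor (TP A CG) (p v) (u 1%g))
  (D : cstarAlgType R) (jA : A -> multiplier D) (jG : C0 R G -> multiplier D)
  (D_cross : is_crossed_product u delta jA jG)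
  (dual : G -> D -> D)
  (dual_act : is_dual_action jA jG dual)
  (B : cstarAlgType R)
  (sB : edge (skew_product c) -> B) (pB : vertex (skew_product c) -> B)
  (B_graph : is_graph_calg sB pB)
  (gamma : G -> B -> B)
  (gamma_act : is_skew_action sB pB gamma) :
  exists Theta : D -> B,
    star_hom Theta /\ bijective Theta /\
    forall (t : G) (d : D), Theta (dual t d) = gamma t (Theta d).
Proof.
have cov := cross_cov D_cross.
have jAh := cov_pi cov; have jGh := cov_mu cov.
have jAl := star_hom_linear jAh; have jGl := star_hom_linear jGh.
have toh := @to_mult_star_hom R D; have tol := star_hom_linear toh.
have ckA := graph_ck A_graph; have ckB := graph_ck B_graph.
have rfB : row_finite (skew_product c) := skew_row_finite E_rf.
have /choice[sD sDE'] (x : edge (skew_product c)) := cross_in D_cross (s x.1) (chi x.2).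
have /choice[pD pDE'] (x : vertex (skew_product c)) := cross_in D_cross (p x.1) (chi x.2).
have sDE f r : to_mult (sD (f, r)) = jA (s f) ** jG (chi r) := sDE' (f, r).
have pDE v r : to_mult (pD (v, r)) = jA (p v) ** jG (chi r) := pDE' (v, r).
have ckD := cross_ck CG_group E_rf A_graph delta_s delta_p cov sDE pDE.
have [phi [ph phis phip]] := graph_univ B_graph ckD.
have pl := star_hom_linear ph.
have [rho [rh rhs rhp]] := graph_univ A_graph (multiplier_ck E_rf B_graph).
(* The element w_G is not constructed: the covariance of the crossed product itself supplies one. *)
have [_ [_ [w [_ [_ _ wG _ _]]]]] := cov_eq cov.
have covB := skew_covariant CG_group (Ef := E_rf) (cB := B_graph) A_graph
  (coact_hom delta_coact) delta_s delta_p wG rh rhs rhp.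
have [theta [th tnd tA tG]] := cross_univ D_cross covB.
(* The universal property describes [theta] only through its extension to multipliers; nondegeneracy
   turns this into a formula on the elements of D. *)
have thetaE d a g : to_mult d = jA a ** jG g ->
    theta d = rho a ** function_sum E_rf B_graph g.
  move=> dE; apply: (mult_eq_dense ((nondegenerateP theta).1 tnd)) => -[d' b] /=.
  rewrite -!lactM; congr (lact _ b).
  by rewrite -amulA tG tA -(star_homM th) -lactM -dE.
have thetaphi : theta \o phi =1 to_mult.
  apply: (generates_star_hom_eq (graph_gen B_graph) (star_hom_comp ph th)
    to_mult_star_hom) => _ [[[f r] _ <-]|[[v r] _ <-]] /=.
    rewrite phis (thetaE _ _ _ (sDE f r)) rhs.
    apply: (mult_eq_dense (graph_dense rfB B_graph)) => -[[x t] b] /=.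
    rewrite lactM function_sumE (linZ (@lact_linear R B _)) edge_sumE chiE lact_to_mult /=.
    rewrite amulA; have [->|tr] := eqVneq t r; last first.
      rewrite scale0r (ck_rngM0 ckB) ?mul0a// => -[] _ tr'.
      by move: tr; rewrite tr' eqxx.
    rewrite scale1r; case: eqP => [->|xf]; first by rewrite (ck_rngM ckB (f, r)).
    by rewrite (ck_rngM0 ckB) ?mul0a// => -[].
  rewrite phip (thetaE _ _ _ (pDE v r)) rhp.
  apply: (mult_eq_dense (graph_dense rfB B_graph)) => -[[x t] b] /=.
  rewrite lactM function_sumE (linZ (@lact_linear R B _)) vertex_sumE chiE lact_to_mult /=.
  rewrite amulA; have [->|tr] := eqVneq t r; last first.
    rewrite scale0r (ck_orth ckB) ?mul0a// => -[] _ tr'.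
    by move: tr; rewrite tr' eqxx.
  rewrite scale1r; case: eqP => [->|xv]; first by rewrite (ck_proj ckB _).1.
  by rewrite (ck_orth ckB) ?mul0a// => -[] /esym.
have phi_iso b : ⟦phi b⟧ = ⟦b⟧.
  apply/eqP; rewrite eq_le star_hom_contractive//= -(norm_to_mult b) -thetaphi.
  exact: (star_hom_contractive (phi b) th).
have rcl := isometric_range_closed ph phi_iso.
have r0 : range phi 0 by exists 0 => //; exact: lin0.
have rl (k : R[i]) x y : range phi x -> range phi y -> range phi (k *: x + y).
  by move=> [b _ <-] [b' _ <-]; exists (k *: b + b') => //; rewrite (linD pl) (linZ pl).
have rM x y : range phi x -> range phi y -> range phi (x ** y).
  by move=> [b _ <-] [b' _ <-]; exists (b ** b') => //; rewrite (star_homM ph).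
(* Proving that [J] is all of A is the core of surjectivity: the range of [phi] contains the
   products of p_v with chi_r, and stability under jA(a) will supply a left factor from A. *)
pose J : set A := [set a | forall b, range phi (lact (jA a) (phi b))].
(* B is the closed span of the p_x b and the range is closed under right multiplication by phi(b),
   so testing on the vertex elements is enough. *)
have Jgen a : (forall x, range phi (lact (jA a) (pD x))) -> J a.
  move=> aD b; apply: rcl.
  apply: (approx_lip (F := fun b => lact (jA a) (phi b)) (C := ⟦a⟧) _ _
    (graph_dense rfB B_graph b)) => [x y|x xs].
    rewrite -(linB (@lact_linear R D _)) -(linB pl) -(phi_iso (x - y)).
    rewrite (le_trans (lact_le _ _))// ler_wpM2r ?rnorm_ge0//.
    exact: star_hom_contractive.
  apply: subset_approx; move: x xs; apply: span_min.
  - by rewrite /= (lin0 pl) (lin0 (@lact_linear R D _)).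
  - move=> k x y /= rx ry.
    by rewrite (linD pl) (linZ pl) (linD (@lact_linear R D _)) (linZ (@lact_linear R D _)); exact: rl.
  - move=> [x b'] /=; rewrite (star_homM ph) lactMr phip; exact: rM.
have act a v r d : to_mult d = jA (a ** p v) ** jG (chi r) -> lact (jA a) (pD (v, r)) = d.
  by move=> dE; apply: to_mult_inj; rewrite -mult_to_mult pDE amulA -(star_homM jAh).
have act0 a v r : a ** p v = 0 -> lact (jA a) (pD (v, r)) = 0.
  by move=> av; apply: act; rewrite av (lin0 jAl) mul0a (lin0 tol).
have JT a : J a.
  (* The condition is imposed on [a] and its adjoint together because generation is about sets
     stable under the involution. *)
  have XT : [set a | J a /\ J (star a)] = setT.
    apply: (graph_gen A_graph).
    - apply/closedP => x Xx; split=> b; apply: rcl.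
        apply: (approx_lip (F := fun a => lact (jA a) (phi b)) (C := ⟦b⟧) _ _ Xx)
          => [y z|y [Jy _]]; last exact/subset_approx/Jy.
        rewrite -[X in ⟦X⟧]/(lact (jA y - jA z) (phi b)) -(linB jAl) -(phi_iso b).
        rewrite (le_trans (lact_le _ _))// mulrC ler_wpM2l ?rnorm_ge0//.
        exact: star_hom_contractive.
      apply: (approx_lip (F := fun a => lact (jA (star a)) (phi b)) (C := ⟦b⟧) _ _ Xx)
        => [y z|y [_ Jy]]; last exact/subset_approx/Jy.
      rewrite -[X in ⟦X⟧]/(lact (jA (star y) - jA (star z)) (phi b)) -(linB jAl) -(phi_iso b).
      rewrite (le_trans (lact_le _ _))// mulrC ler_wpM2l ?rnorm_ge0//.
      by rewrite -starB (le_trans (star_hom_contractive _ jAh))// rnorm_star.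
    - by split=> b; rewrite ?star0 (lin0 jAl).
    - move=> k x y [Jx Jx'] [Jy Jy']; split=> b; rewrite ?star_semilinear (linD jAl) (linZ jAl) lact_comb.
        by apply: rl; [exact: Jx|exact: Jy].
      by apply: rl; [exact: Jx'|exact: Jy'].
    - move=> x y [Jx Jx'] [Jy Jy']; split=> b; rewrite ?starM (star_homM jAh) lactM.
        by have [b' _ <-] := Jy b; exact: Jx.
      by have [b' _ <-] := Jx' b; exact: Jy'.
    - by move=> x [Jx Jx']; split; rewrite ?starK.
    - move=> _ [[f _ <-]|[v _ <-]].
        split; apply: Jgen => -[v r].
          have [->|/eqP vf] := eqVneq v (rng f); last by rewrite act0 ?(ck_rngM0 ckA).
          exists (sB (f, r)) => //; rewrite phis; apply/esym/act.
          by rewrite sDE (ck_rngM ckA).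
        have [->|/eqP vf] := eqVneq v (src f); last first.
          by rewrite act0// -(ck_proj ckA v).2 -starM (ck_srcM0 E_rf ckA) ?star0.
        (* The adjoint of s_f meets the source vertex (s(f), r), and the edge over f with that
           source is (f, c(f)^-1 r). *)
        exists (star (sB (f, ((c f)^-1 * r)%g))) => //.
        rewrite (star_homV ph) phis; apply/esym/act.
        rewrite -(ck_proj ckA (src f)).2 -starM (ck_srcM E_rf ckA) (star_homV toh) sDE.
        rewrite starM (cov_chiV cov) (star_homV jAh).
        by rewrite (cross_edge_star_commute CG_group delta_s cov).
      suff Jv : J (p v) by split=> //; rewrite (ck_proj ckA v).2.
      apply: Jgen => -[v' r]; have [->|/eqP vv'] := eqVneq v' v; last first.
        by rewrite act0// (ck_orth ckA) //; exact: nesym.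
      exists (pB (v, r)) => //; rewrite phip; apply/esym/act.
      by rewrite (ck_proj ckA v).1 pDE.
  by have : [set: A] a by []; rewrite -XT => -[].
(* The products of jA(a) and jG(g) live in M(D), so the closed-range argument is repeated for the
   image of B there before returning to D. *)
have psi_iso b : ⟦(to_mult \o phi) b⟧ = ⟦b⟧ by rewrite /= norm_to_mult phi_iso.
have tcl := isometric_range_closed (star_hom_comp ph toh) psi_iso.
have t0 : range (to_mult \o phi) 0.
  by exists 0 => //=; rewrite (lin0 pl) (lin0 tol).
have tl (k : R[i]) x y : range (to_mult \o phi) x -> range (to_mult \o phi) y ->
    range (to_mult \o phi) (k *: x + y).
  move=> [b _ <-] [b' _ <-]; exists (k *: b + b') => //=.
  by rewrite (linD pl) (linZ pl) (linD tol) (linZ tol).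
(* By density [a] may be taken of the form a' p_v, and then the product is jA(a') applied to the
   image of p_(v,r). *)
have surj_chi a r : range (to_mult \o phi) (jA a ** jG (chi r)).
  apply: tcl; apply: (approx_lip (F := fun a => jA a ** jG (chi r)) (C := ⟦jG (chi r)⟧)
    _ _ (graph_dense_right E_rf A_graph a)) => [x y|x xs].
    rewrite -amulBl -(linB jAl) mulrC (le_trans (rnormM _ _))// ler_wpM2r ?rnorm_ge0//.
    exact: star_hom_contractive.
  apply: subset_approx; move: x xs; apply: span_min.
  - by rewrite /= (lin0 jAl) mul0a.
  - by move=> k x y /= rx ry; rewrite (linD jAl) (linZ jAl) amul_linearl; exact: tl.
  - move=> [a' v] /=; rewrite (star_homM jAh) -amulA -pDE mult_to_mult -phip.
    by have [b _ <-] := JT a' (pB (v, r)); exists b.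
have surj_gen a g : range (to_mult \o phi) (jA a ** jG g).
  apply: tcl; apply: (approx_lip (F := fun g => jA a ** jG g) (C := ⟦jA a⟧)
    _ _ (chi_dense g)) => [x y|x xs].
    rewrite -amulBr -(linB jGl) (le_trans (rnormM _ _))// ler_wpM2l ?rnorm_ge0//.
    exact: star_hom_contractive.
  apply: subset_approx; move: x xs; apply: span_min.
  - by rewrite /= (lin0 jGl) amul0.
  - by move=> k x y /= rx ry; rewrite (linD jGl) (linZ jGl) amul_linearr; exact: tl.
  - by move=> r /=; exact: surj_chi.
have phi_surj d : exists b, phi b = d.
  have : range phi d; last by move=> [b _ <-]; exists b.
  apply: rcl; have := (denseP _).1 (cross_dense D_cross) d.
  apply: approxS => x [n [k [y [yP ->]]]].
  elim/big_rec : _ => // i z _; apply: rl.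
  have [a [g yE]] := yP i; have [b _ bE] := surj_gen a g.
  by exists b => //; apply: to_mult_inj; rewrite yE.
have phi_inj : injective phi.
  move=> b b' bb'; apply/eqP; rewrite -subr_eq0; apply/eqP/rnorm0_eq0.
  by rewrite -phi_iso (linB pl) bb' subrr rnorm0.
(* [theta] takes values in M(B) a priori, so the map from D to B is obtained by inverting [phi]. *)
have [Psi PsiK] := choice phi_surj.
have phiK : cancel phi Psi by move=> b; apply: phi_inj; rewrite PsiK.
(* Both sides are *-homomorphisms in [b], and on generators each action replaces r by r t^-1. *)
have phi_gamma t b : phi (gamma t b) = dual t (phi b).
  have [[gh _ _] gs gp] := gamma_act; have [[dh _ _] dE] := dual_act.
  apply: (generates_star_hom_eq (graph_gen B_graph) (star_hom_comp (gh t) ph)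
    (star_hom_comp ph (dh t))) => _ [[[f r] _ <-]|[[v r] _ <-]] /=.
    rewrite gs !phis; symmetry; apply: dE; first exact: sDE.
    exact: sDE.
  rewrite gp !phip; symmetry; apply: dE; first exact: pDE.
  exact: pDE.
exists Psi; split; last split.
- split=> [k x y|x y|x]; apply: phi_inj.
  + by rewrite (linD pl) (linZ pl) !PsiK.
  + by rewrite (star_homM ph) !PsiK.
  + by rewrite (star_homV ph) !PsiK.
- by exists phi.
- by move=> t d; apply: phi_inj; rewrite phi_gamma !PsiK.
Qed.
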